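(* Let $P\subset\mathbb{R}^3$ be a compact convex polyhedron with vertices $p_1,\dots,p_n$ and with $0$ in its interior, and put $r_i^0=\|p_i\|$. Let $Q=P^*$ be the polar dual of $P$, that is, $$Q=\{x\in\mathbb{R}^3\mid\langle x,\nu_i\rangle\le h_i^0,\ i=1,\dots,n\},\qquad \nu_i=\frac{p_i}{\|p_i\|},\quad h_i^0=\frac1{r_i^0}.$$ Then $$D^2_{h^0}\operatorname{Vol}=D^2_{r^0}\operatorname{HE},$$ i.e. $\frac{\partial^2\operatorname{Vol}}{\partial h_i\partial h_j}(h^0)=\frac{\partial^2\operatorname{HE}}{\partial r_i\partial r_j}(r^0)$ for all $i,j\in\{1,\dots,n\}$, where $\operatorname{Vol}(h)$ is the volume of the polyhedron with face normals $\nu_i$ and support parameters $h_i$, and $\operatorname{HE}(r)$ is the discrete Hilbert-Einstein functional of the warped polyhedron $P(r)$.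
   Context: Volume: for $h$ in a small neighborhood of $h^0=(h_1^0,\dots,h_n^0)$, $\operatorname{Vol}(h)$ is the volume of $Q(h)=\{x\in\mathbb{R}^3\mid\langle x,\nu_i\rangle\le h_i,\ i=1,\dots,n\}$. Warped polyhedra: if $P$ has non-triangular faces, subdivide them into triangles by non-crossing diagonals without new vertices, and count the diagonals among the edges of $P$. Put $\ell_{ij}=\|p_i-p_j\|$ for every edge $p_ip_j$. Cut $P$ into triangular pyramids with apex $0$ over the (triangular) faces. For $r$ in a small neighborhood $U$ of $r^0=(r^0_1,\dots,r^0_n)$, replace the pyramid over each face $p_ip_jp_k$ by the Euclidean tetrahedron with lateral edge lengths $r_i,r_j,r_k$ and base edge lengths $\ell_{ij},\ell_{jk},\ell_{ik}$, and glue by the old rules; the result is the warped polyhedron $P(r)$. Let $\kappa_i(r)=2\pi-\omega_i(r)$, where $\omega_i(r)$ is the sum of all dihedral angles at the lateral edge $0p_i$, and let $\lambda_{ij}(r)=\pi-\theta_{ij}(r)$ be the exterior dihedral angle at the boundary edge $p_ip_j$, where $\theta_{ij}(r)$ is the sum of the dihedral angles at $p_ip_j$ of the two tetrahedra containing this edge. Discrete Hilbert-Einstein functional: $\operatorname{HE}(r)=\sum_i r_i\kappa_i(r)+\sum_{\{i,j\}}\ell_{ij}\lambda_{ij}(r)$, where the second sum is over all boundary edges, each taken once. *)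

(* Defs.v *)
From mathcomp Require Import all_boot all_order all_algebra.
From mathcomp Require Import all_classical all_reals all_analysis.

Set Implicit Arguments.
Unset Strict Implicit.
Unset Printing Implicit Defensive.

Import Order.TTheory GRing.Theory Num.Theory.
Import numFieldNormedType.Exports.

Local Open Scope classical_set_scope.
Local Open Scope ring_scope.

(* Points of R^3 are row vectors. The library norm on matrices is the sup norm,
   so the Euclidean one is introduced separately. *)

Definition dot {R : realType} (x y : 'rV[R]_3) : R :=
  \sum_(k < 3) x ord0 k * y ord0 k.

Definition enorm {R : realType} (x : 'rV[R]_3) : R := Num.sqrt (dot x x).

Definition angle {R : realType} (u v : 'rV[R]_3) : R :=
  acos (dot u v / (enorm u * enorm v)).

Definition conv_hull {R : realType} (A : set 'rV[R]_3) : set 'rV[R]_3 :=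
  \bigcap_(C in [set C : set 'rV[R]_3 | convex_set C /\ A `<=` C]) C.

Definition is_convex_polyhedron {R : realType} (P : set 'rV[R]_3) : Prop :=
  exists A : set 'rV[R]_3, finite_set A /\ P = conv_hull A.

Definition plane {R : realType} (a : 'rV[R]_3) (b : R) : set 'rV[R]_3 :=
  [set x | dot a x = b].

Definition is_face {R : realType} (P F : set 'rV[R]_3) : Prop :=
  exists (a : 'rV[R]_3) (b : R),
    [/\ a != 0, (forall x, P x -> dot a x <= b) & F = P `&` plane a b].

Definition vertices {R : realType} (P : set 'rV[R]_3) : set 'rV[R]_3 :=
  [set x | is_face P [set x]].

(* Two-dimensional faces: those containing three non-collinear points. *)
Definition is_facet {R : realType} (P F : set 'rV[R]_3) : Prop :=
  is_face P F /\
  exists x y z, [/\ F x, F y, F z & row_free (col_mx (y - x) (z - x))].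

Definition polar_dual {R : realType} (P : set 'rV[R]_3) : set 'rV[R]_3 :=
  [set x | forall y, P y -> dot x y <= 1].

Definition volume {R : realType} (A : set 'rV[R]_3) : R :=
  fine (((lebesgue_measure \x lebesgue_measure) \x lebesgue_measure)%E
    [set x : R * R * R | A (\row_(k < 3) [:: x.1.1; x.1.2; x.2]`_k)]).

Definition polyhedron_of {R : realType} n (nu : 'I_n -> 'rV[R]_3)
    (h : 'rV[R]_n) : set 'rV[R]_3 :=
  [set x | forall i, dot x (nu i) <= h ord0 i].

Definition Vol {R : realType} n (nu : 'I_n -> 'rV[R]_3) (h : 'rV[R]_n) : R :=
  volume (polyhedron_of nu h).

Definition hull_of {R : realType} n (p : 'I_n -> 'rV[R]_3) (t : {set 'I_n}) :
    set 'rV[R]_3 :=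
  conv_hull (p @` [set` t]).

(* A triangle is recorded as the set of the indices of its three vertices. The
   last clause says that two triangles meet exactly in their common vertex,
   edge or triangle, i.e., that the diagonals used do not cross. *)
Definition is_triangulation {R : realType} n (P : set 'rV[R]_3)
    (p : 'I_n -> 'rV[R]_3) (T : {set {set 'I_n}}) : Prop :=
  [/\ forall t, t \in T ->
        #|t| = 3%N /\ exists F, is_facet P F /\ hull_of p t `<=` F,
      forall F, is_facet P F ->
        F = \bigcup_(t in [set t | t \in T /\ hull_of p t `<=` F]) hull_of p t &
      forall t u, t \in T -> u \in T ->
        hull_of p t `&` hull_of p u = hull_of p (t :&: u)].

(* Angle along the line ab between the half-planes through c and through d. *)
Definition dihedral {R : realType} (a b c d : 'rV[R]_3) : R :=
  let e := b - a in
  let orth w := w - (dot w e / dot e e) *: e in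
  angle (orth (c - a)) (orth (d - a)).

Section WarpedPolyhedron.
Context {R : realType} {n : nat} (p : 'I_n -> 'rV[R]_3) (T : {set {set 'I_n}}).
Implicit Types (r : 'rV[R]_n) (t : {set 'I_n}) (i j : 'I_n).

Definition ell i j : R := enorm (p i - p j).

Definition is_edge i j : bool :=
  (i != j) && [exists t in T, (i \in t) && (j \in t)].

(* A tetrahedron with apex 0 over the triangle t, with lateral edge lengths r_i
   and base edge lengths ell_ij; row i of the matrix is the base vertex of index
   i, and the rows of index outside t are irrelevant. Such a tetrahedron is
   unique up to isometry; the value is the junk 0 if there is none. *)
Definition tetrahedron r t : 'M[R]_(n, 3) :=
  xget 0 [set q : 'M[R]_(n, 3) |
    (forall i, i \in t -> enorm (row i q) = r ord0 i) /\
    (forall i j, i \in t -> j \in t -> enorm (row i q - row j q) = ell i j)].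

(* The two inner sums have a single term, the pair j < k with t = {i, j, k}. *)
Definition omega r i : R :=
  \sum_(t in T | i \in t) \sum_(j in t :\ i) \sum_(k in t :\ i | (j < k)%N)
    dihedral 0 (row i (tetrahedron r t))
      (row j (tetrahedron r t)) (row k (tetrahedron r t)).

(* The inner sum has a single term, the k with t = {i, j, k}. *)
Definition theta r i j : R :=
  \sum_(t in T | (i \in t) && (j \in t)) \sum_(k in t :\ i :\ j)
    dihedral (row i (tetrahedron r t)) (row j (tetrahedron r t))
      (row k (tetrahedron r t)) 0.

Definition kappa r i : R := 2 * pi - omega r i.

Definition lambda r i j : R := pi - theta r i j.

Definition HE r : R :=
  \sum_i r ord0 i * kappa r i +
  \sum_i \sum_(j | is_edge i j && (i < j)%N) ell i j * lambda r i j.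

End WarpedPolyhedron.

Definition partial {R : realType} n (i : 'I_n) (f : 'rV[R]_n -> R) :
    'rV[R]_n -> R :=
  fun x => 'D_(delta_mx ord0 i) f x.

Definition twice_differentiable {R : realType} n (f : 'rV[R]_n -> R)
    (x : 'rV[R]_n) : Prop :=
  (\forall y \near x, differentiable f y) /\
  forall i, differentiable (partial i f) x.

(* Main.v *)
(* Both Hessians are computed entry by entry. By Fubini's theorem, the derivative
   of the volume in [h_i] is the area of the i-th face of [Q(h)], and the derivative
   of that area in [h_j] is the length of the common edge of the faces i and j,
   divided by the norm of [nu_i x nu_j]. By Schlaefli's formula, the derivative of HE
   in [r_i] is the curvature [kappa_i], and the derivative of [kappa_i] in [r_j] is a
   sum over the triangles containing [p_i p_j]. The vertices of [Q] are the vectors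
   [m_t] with [<m_t, p_a> = 1] for the three vertices [p_a] of a triangle [t], and the
   summand of [t] is, up to the factor [r_i r_j], the abscissa of [m_t] on the line
   that carries the edge of [Q] dual to [p_i p_j]. The two triangles containing
   [p_i p_j] contribute with opposite signs, hence the sum is the length of the dual
   edge (which is zero if [p_i p_j] is a diagonal of a face).
   Each diagonal entry follows from the entries off the diagonal: the area of the i-th
   face does not change when [Q] is translated along [nu_i], and [kappa_i] does not
   change, to first order, when the apex [0] is moved along the edge [0 p_i]. *)

Require Import Defs.
From HB Require Import structures.
From mathcomp Require Import all_boot all_order all_algebra.
From mathcomp Require Import all_classical all_reals all_analysis.
From mathcomp Require Import measurable_realfun ring lra.
Import Order.TTheory GRing.Theory Num.Theory.
Import numFieldNormedType.Exports.
Local Open Scope classical_set_scope.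
Local Open Scope ring_scope.

Set Implicit Arguments.
Unset Strict Implicit.
Unset Printing Implicit Defensive.

(** * Linear maps and slices of Lebesgue measure *)

(** A face of [P] with more than three vertices gives a vertex of [Q] that lies on more than three
    face planes, and the combinatorial type of [Q(h)] then changes arbitrarily close to [h0]. Hence
    no formula in terms of vertices is available for face areas. Areas and lengths are treated
    instead as measures of sets cut out by linear inequalities: these depend continuously on the
    bounds as soon as the bounding hyperplanes are null sets. The only genericity required at [h0]
    is that no two face planes coincide and no three share a line, and this holds because no three
    vertices of [P] are collinear.

    For [HE], the chosen tetrahedra are replaced by explicit functions of the lengths: all dihedral
    angles are arccosines in the cofactors of a Gram matrix.

    That an edge has exactly one triangle on each side is not part of the definition of a
    triangulation. It is derived from the cones over the triangles, which cover space and meet along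
    cones over common faces.

    The linear relations that yield the diagonal entries have, for both Hessians, the same weights
    [dot (nu i) (nu l)] up to a factor [r_i]. *)

Lemma measurable_fun_affine (R : realType) (d s : R) :
  measurable_fun [set: measurableTypeR R]
    (fun z : measurableTypeR R => (d * z + s : measurableTypeR R)).
Proof.
apply: measurable_realfun.measurable_funD; last exact: measurable_cst.
by apply: measurable_realfun.measurable_funM => //; exact: measurable_cst.
Qed.

(** The pushforward under the map, rescaled by [|d|], gives every half-open interval its length, and
    this characterizes Lebesgue measure. *)
Lemma lebesgue_measure_affine (R : realType) (d s : R) (A : set (measurableTypeR R)) :
  d != 0 -> measurable A ->
  lebesgue_measure ((fun z : measurableTypeR R => (d * z + s : measurableTypeR R)) @^-1` A) =
  (`|d|^-1%:E * lebesgue_measure A)%E.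
Proof.
move=> d0 mA.
have dpos : 0 < `|d| by rewrite normr_gt0.
pose f := (fun z : measurableTypeR R => (d * z + s : measurableTypeR R)).
have mf : measurable_fun setT f := measurable_fun_affine d s.
pose nd : {nonneg R} := NngNum (ltW dpos).
pose mu0 : {measure set (measurableTypeR R) -> \bar R} :=
  mscale nd (pushforward lebesgue_measure f).
pose mu := mu0 mf.
suff -> : lebesgue_measure A = mu A.
  rewrite /mu /= /mscale /= muleA -EFinM mulVf ?gt_eqF// mul1e.
  by [].
apply: lebesgue_measure_unique => // _ [[a b] _ <-].
rewrite /mu /= /mscale /= /pushforward.
rewrite lebesgue_measure_itv /=.
case: (ltP 0 d) => dd.
  have -> : f @^-1` `]a, b]%classic = `](a - s) / d, (b - s) / d]%classic.
    apply/seteqP; split=> z /=; rewrite !in_itv /= /f ltr_pdivrMr// ler_pdivlMr// => /andP[h1 h2]; apply/andP; split; lra.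
  rewrite lebesgue_measure_itv /= !lte_fin ltr_pM2r ?invr_gt0// ltrBlDr subrK.
  case: ifPn => // _; last by rewrite mule0.
  rewrite -!EFinB -EFinM; congr (_%:E). rewrite gtr0_norm//. field.
  by rewrite gt_eqF.
(* A negative slope reverses the interval, so the preimage is closed on the left and open on the
   right. *)
have dn : d < 0 by rewrite lt_neqAle d0.
have -> : f @^-1` `]a, b]%classic = `[(b - s) / d, (a - s) / d[%classic.
  apply/seteqP; split=> z /=; rewrite !in_itv /= /f ler_ndivrMr// ltr_ndivlMr// => /andP[h1 h2]; apply/andP; split; lra.
rewrite lebesgue_measure_itv /= !lte_fin ltr_nM2r ?invr_lt0// ltrBlDr subrK.
case: ifPn => // _; last by rewrite mule0.
rewrite -!EFinB -EFinM; congr (_%:E). rewrite ltr0_norm//. field.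
by rewrite lt_eqF.
Qed.

Section product.
Context d1 d2 (T1 : measurableType d1) (T2 : measurableType d2) (R : realType).
Variable m1 : {sigma_finite_measure set T1 -> \bar R}.
Variable m2 : {sigma_finite_measure set T2 -> \bar R}.

(** The product is defined by integration over the first factor. Tonelli gives the slicing along the
    second one, which serves as the height below. *)
Lemma product_measureE (A : set (T1 * T2)) : measurable A ->
  (m1 \x m2)%E A = (\int[m2]_y m1 (ysection A y))%E.
Proof.
move=> mA.
have := indic_fubini_tonelli m1 m2 mA.
rewrite indic_fubini_tonelli_FE// indic_fubini_tonelli_GE//.
Qed.

(** Slice by slice, then integrate. The linear maps of the plane and of space are factored into maps
    that change one block of coordinates in this way. *)
Lemma product_measure_preimage_fst (psi : T2 -> T1 -> T1) (c : R)
    (A : set (T1 * T2)) :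
  0 <= c ->
  measurable_fun setT (fun z : T1 * T2 => (psi z.2 z.1, z.2)) ->
  (forall y B, measurable B -> m1 (psi y @^-1` B) = (c%:E * m1 B)%E) ->
  measurable A ->
  (m1 \x m2)%E ((fun z : T1 * T2 => (psi z.2 z.1, z.2)) @^-1` A) =
  (c%:E * (m1 \x m2)%E A)%E.
Proof.
move=> c0 mpsi mupsi mA.
have mA' := mpsi measurableT _ mA; rewrite setTI in mA'.
rewrite !product_measureE// -ge0_integralZl//; last exact: measurable_fun_ysection.
apply: eq_integral => y _.
rewrite -(mupsi y); last exact: measurable_ysection.
congr (m1 _); apply/seteqP; split=> x /=; by rewrite /ysection /= !inE.
Qed.

Lemma product_measure_preimage_snd (psi : T1 -> T2 -> T2) (c : R)
    (A : set (T1 * T2)) :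
  0 <= c ->
  measurable_fun setT (fun z : T1 * T2 => (z.1, psi z.1 z.2)) ->
  (forall y B, measurable B -> m2 (psi y @^-1` B) = (c%:E * m2 B)%E) ->
  measurable A ->
  (m1 \x m2)%E ((fun z : T1 * T2 => (z.1, psi z.1 z.2)) @^-1` A) =
  (c%:E * (m1 \x m2)%E A)%E.
Proof.
move=> c0 mpsi mupsi mA.
have mA' := mpsi measurableT _ mA; rewrite setTI in mA'.
rewrite /product_measure1 -ge0_integralZl//; last exact: measurable_fun_xsection.
apply: eq_integral => y _ /=.
rewrite -(mupsi y); last exact: measurable_xsection.
congr (m2 _); apply/seteqP; split=> x /=; by rewrite /xsection /= !inE.
Qed.

End product.

(** The factor refers to preimages, so for a linear map it is the inverse of the absolute value of
    the determinant. Measurability is bundled in so that factors multiply under composition. *)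
Definition scales_measure d (T : measurableType d) (R : realType)
    (mu : set T -> \bar R) (f : T -> T) (c : R) : Prop :=
  measurable_fun setT f /\
  forall A, measurable A -> mu (f @^-1` A) = (c%:E * mu A)%E.

Lemma scales_measure_comp d (T : measurableType d) (R : realType)
    (mu : set T -> \bar R) (f g : T -> T) (c e : R) :
  scales_measure mu f c -> scales_measure mu g e ->
  scales_measure mu (g \o f) (c * e).
Proof.
move=> [mf sf] [mg sg]; split; first exact: measurableT_comp.
move=> A mA; rewrite comp_preimage sf ?sg ?EFinM ?muleA//.
by rewrite -[X in measurable X]setTI; exact: mg.
Qed.

(* The library declares the product of two measures as sigma-finite only for
   subprobabilities (an earlier instance masks the general one). *)
Definition area_measure (R : realType) :
    set (measurableTypeR R * measurableTypeR R) -> \bar R :=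
  (lebesgue_measure \x lebesgue_measure)%E.

HB.instance Definition _ (R : realType) := Measure.on (@area_measure R).

Lemma sigma_finite_area_measure (R : realType) :
  sigma_finite [set: measurableTypeR R * measurableTypeR R] (@area_measure R).
Proof.
pose I n : set (measurableTypeR R) := `[- n%:R, n%:R]%classic.
have Ifin n : (lebesgue_measure (I n) < +oo)%E.
  by rewrite /I lebesgue_measure_itv /=; case: ifPn => _; rewrite ?ltry// -EFinB ltry.
have mI n : measurable (I n) by exact: measurable_itv.
exists (fun n => I n `*` I n); last first.
  move=> n; split; first exact: measurableX.
  rewrite /area_measure product_measure1E; [|exact: mI|exact: mI].
  by apply: lte_mul_pinfty; [exact: measure_ge0|rewrite ge0_fin_numE; [exact: Ifin|exact: measure_ge0]|exact: Ifin].
apply/seteqP; split=> // -[x y] _.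
exists (maxn (Num.truncn `|x|).+1 (Num.truncn `|y|).+1) => //.
by rewrite /I; split; rewrite /= in_itv /= -ler_norml;
  apply: (le_trans (ltW (truncnS_gt _))); rewrite ler_nat leq_max leqnn ?orbT.
Qed.

HB.instance Definition _ (R : realType) :=
  Measure_isSigmaFinite.Build _ _ _ (@area_measure R) (@sigma_finite_area_measure R).

(** * Linear maps of the plane and of space scale measure by the determinant *)

Section linear_maps.
Context {R : realType}.
Local Notation RR := (measurableTypeR R).
Local Notation mu1 := (@lebesgue_measure R).
Local Notation mu2 := (@area_measure R).
Local Notation mu3 := (@area_measure R \x @lebesgue_measure R)%E.

(** The translation part is needed because a linear map of space acts on the horizontal planes by
    affine maps that depend on the height. *)
Definition affine2 (a b e c d f : R) (z : RR * RR) : RR * RR :=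
  (a * z.1 + b * z.2 + e, c * z.1 + d * z.2 + f).

Lemma measurable_fun_affine2 (a b e c d f : R) :
  measurable_fun setT (affine2 a b e c d f).
Proof.
by apply/measurable_fun_pair; apply: measurable_realfun.measurable_funD => //;
  apply: measurable_realfun.measurable_funD; apply: measurable_realfun.measurable_funM.
Qed.

Lemma scales_affine2_upper (a b e : R) : a != 0 ->
  scales_measure mu2 (affine2 a b e 0 1 0) `|a|^-1.
Proof.
move=> a0; split; first exact: measurable_fun_affine2.
move=> A mA.
rewrite /area_measure -(@product_measure_preimage_fst _ _ _ _ _ mu1 mu1 (fun z x => a * x + (b * z + e)))//.
- congr (_ _); apply/seteqP; split=> -[x z] /=; rewrite /affine2 /= mul0r add0r mul1r addr0 addrA; exact.
- have := measurable_fun_affine2 a b e 0 1 0.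
  apply: eq_measurable_fun => -[x z] _ /=.
  by rewrite /affine2 /= mul0r add0r mul1r addr0 addrA.
- by move=> y B mB; exact: lebesgue_measure_affine.
Qed.

Lemma scales_affine2_lower (c d f : R) : d != 0 ->
  scales_measure mu2 (affine2 1 0 0 c d f) `|d|^-1.
Proof.
move=> a0; split; first exact: measurable_fun_affine2.
move=> A mA.
have E x z : affine2 1 0 0 c d f (x, z) = (x, d * z + (c * x + f)).
  by rewrite /affine2 /=; congr (_, _); ring.
rewrite /area_measure -(@product_measure_preimage_snd _ _ _ _ _ mu1 mu1 (fun x z => d * z + (c * x + f)))//.
- by congr (_ _); apply/seteqP; split=> -[x z] /=; rewrite E.
- have := measurable_fun_affine2 1 0 0 c d f.
  by apply: eq_measurable_fun => -[x z] _ /=; rewrite E.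
- by move=> y B mB; exact: lebesgue_measure_affine.
Qed.

(** LU factorization if the pivot [a] is nonzero; otherwise a preliminary shear replaces the pivot
    by [- b]. *)
Lemma scales_affine2 (a b e c d f : R) : a * d - b * c != 0 ->
  scales_measure mu2 (affine2 a b e c d f) `|a * d - b * c|^-1.
Proof.
have gen a' b' e' c' d' f' : a' != 0 -> a' * d' - b' * c' != 0 ->
    scales_measure mu2 (affine2 a' b' e' c' d' f') `|a' * d' - b' * c'|^-1.
  move=> a0 det0.
  have d0 : d' - c' * b' / a' != 0.
    by apply: contra_neq det0 => h; rewrite -[RHS](mulr0 a') -h; field.
  have -> : affine2 a' b' e' c' d' f' =
      affine2 1 0 0 (c' / a') (d' - c' * b' / a') (f' - c' / a' * e') \o
      affine2 a' b' e' 0 1 0.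
    by apply/funext => -[x z]; rewrite /affine2 /=; congr (_, _); field.
  have -> : `|a' * d' - b' * c'|^-1 = `|a'|^-1 * `|d' - c' * b' / a'|^-1.
    rewrite -invfM -normrM; congr (`|_|^-1); by field.
  apply: scales_measure_comp; first exact: scales_affine2_upper.
  exact: scales_affine2_lower.
have [->|a0] := eqVneq a 0; last exact: gen.
rewrite mul0r sub0r => det0.
have -> : affine2 0 b e c d f = affine2 (- b) b e (c - d) d f \o affine2 1 0 0 1 1 0.
  by apply/funext => -[x z]; rewrite /affine2 /=; congr (_, _); ring.
have -> : `| - (b * c)|^-1 = `|1|^-1 * `|(- b) * d - b * (c - d)|^-1 :> R.
  by rewrite normr1 invr1 mul1r; congr (`|_|^-1); ring.
apply: scales_measure_comp; first by apply: scales_affine2_lower; exact: oner_neq0.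
apply: gen.
  by move: det0; rewrite oppr_eq0 mulf_eq0 negb_or oppr_eq0 => /andP[].
by rewrite (_ : _ - _ = - (b * c))//; ring.
Qed.

Definition linear3 (a1 a2 a3 b1 b2 b3 c1 c2 c3 : R) (z : RR * RR * RR) : RR * RR * RR :=
  (a1 * z.1.1 + a2 * z.1.2 + a3 * z.2, b1 * z.1.1 + b2 * z.1.2 + b3 * z.2,
   c1 * z.1.1 + c2 * z.1.2 + c3 * z.2).

Lemma measurable_fun_linear3 (a1 a2 a3 b1 b2 b3 c1 c2 c3 : R) :
  measurable_fun setT (linear3 a1 a2 a3 b1 b2 b3 c1 c2 c3).
Proof.
have m11 : measurable_fun setT (fun z : RR * RR * RR => z.1.1).
  by apply: (measurableT_comp (f := fst)).
have m12 : measurable_fun setT (fun z : RR * RR * RR => z.1.2).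
  by apply: (measurableT_comp (f := snd)).
have lin c c' c'' : measurable_fun setT (fun z : RR * RR * RR =>
    (c * z.1.1 + c' * z.1.2 + c'' * z.2 : RR)).
  apply: measurable_realfun.measurable_funD; last exact: measurable_realfun.measurable_funM.
  by apply: measurable_realfun.measurable_funD; apply: measurable_realfun.measurable_funM.
by apply/measurable_fun_pair => //; apply/measurable_fun_pair.
Qed.

Lemma scales_linear3_lower (a b d : R) : d != 0 ->
  scales_measure mu3 (linear3 1 0 0 0 1 0 a b d) `|d|^-1.
Proof.
move=> d0; split; first exact: measurable_fun_linear3.
move=> A mA.
have E x y z : linear3 1 0 0 0 1 0 a b d (x, y, z) = (x, y, d * z + (a * x + b * y)).
  by rewrite /linear3 /=; congr (_, _, _); ring.
rewrite -(@product_measure_preimage_snd _ _ _ _ _ mu2 mu1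
  (fun x z => d * z + (a * x.1 + b * x.2)))//.
- by congr (mu3 _); apply/seteqP; split=> -[[x y] z] /=; rewrite E.
- have := measurable_fun_linear3 1 0 0 0 1 0 a b d.
  by apply: eq_measurable_fun => -[[x y] z] _ /=; rewrite E.
- by move=> y B mB; exact: lebesgue_measure_affine.
Qed.

Lemma scales_linear3_upper (a1 a2 a3 b1 b2 b3 : R) : a1 * b2 - a2 * b1 != 0 ->
  scales_measure mu3 (linear3 a1 a2 a3 b1 b2 b3 0 0 1) `|a1 * b2 - a2 * b1|^-1.
Proof.
move=> d0; split; first exact: measurable_fun_linear3.
move=> A mA.
have E x y z : linear3 a1 a2 a3 b1 b2 b3 0 0 1 (x, y, z) =
    (affine2 a1 a2 (a3 * z) b1 b2 (b3 * z) (x, y), z).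
  by rewrite /linear3 /=; congr (_, _, _); ring.
rewrite -(@product_measure_preimage_fst _ _ _ _ _ mu2 mu1
  (fun z => affine2 a1 a2 (a3 * z) b1 b2 (b3 * z)))//.
- by congr (mu3 _); apply/seteqP; split=> -[[x y] z] /=; rewrite E.
- have := measurable_fun_linear3 a1 a2 a3 b1 b2 b3 0 0 1.
  by apply: eq_measurable_fun => -[[x y] z] _ /=; rewrite E.
- by move=> y B mB; have [_] := scales_affine2 (a3 * y) (b3 * y) d0; exact.
Qed.

Definition det3 (a1 a2 a3 b1 b2 b3 c1 c2 c3 : R) : R :=
  a1 * (b2 * c3 - b3 * c2) - a2 * (b1 * c3 - b3 * c1) + a3 * (b1 * c2 - b2 * c1).

(** Block LU factorization if the leading minor of order two is nonzero; otherwise a preliminary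
    shear makes it nonzero. *)
Lemma scales_linear3 (a1 a2 a3 b1 b2 b3 c1 c2 c3 : R) :
  det3 a1 a2 a3 b1 b2 b3 c1 c2 c3 != 0 ->
  scales_measure mu3 (linear3 a1 a2 a3 b1 b2 b3 c1 c2 c3)
    `|det3 a1 a2 a3 b1 b2 b3 c1 c2 c3|^-1.
Proof.
have gen a1' a2' a3' b1' b2' b3' c1' c2' c3' : a1' * b2' - a2' * b1' != 0 ->
    det3 a1' a2' a3' b1' b2' b3' c1' c2' c3' != 0 ->
    scales_measure mu3 (linear3 a1' a2' a3' b1' b2' b3' c1' c2' c3')
    `|det3 a1' a2' a3' b1' b2' b3' c1' c2' c3'|^-1.
  set m := (X in X != 0 -> _) => m0; set D := det3 _ _ _ _ _ _ _ _ _ => D0.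
  pose x := (c1' * b2' - c2' * b1') / m; pose y := (a1' * c2' - a2' * c1') / m.
  have -> : linear3 a1' a2' a3' b1' b2' b3' c1' c2' c3' =
      linear3 1 0 0 0 1 0 x y (D / m) \o linear3 a1' a2' a3' b1' b2' b3' 0 0 1.
    apply/funext => -[[u v] z]; rewrite /linear3 /= /x /y /D /det3.
    by congr (_, _, _); try ring; rewrite /m; field; exact: m0.
  have -> : `|D|^-1 = `|m|^-1 * `|D / m|^-1.
    by rewrite -invfM -normrM; congr (`|_|^-1); field; exact: m0.
  apply: scales_measure_comp; first exact: scales_linear3_upper.
  by apply: scales_linear3_lower; rewrite mulf_neq0// invr_eq0.
set D := det3 _ _ _ _ _ _ _ _ _ => D0.
(* The shear adds to the leading minor a combination of the other two minors of the first two
   rows. *)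
have shear al be : (a1 * b2 - a2 * b1) - be * (a1 * b3 - a3 * b1)
    + al * (a2 * b3 - a3 * b2) != 0 ->
    scales_measure mu3 (linear3 a1 a2 a3 b1 b2 b3 c1 c2 c3) `|D|^-1.
  move=> h.
  have -> : linear3 a1 a2 a3 b1 b2 b3 c1 c2 c3 =
      linear3 (a1 - al * a3) (a2 - be * a3) a3 (b1 - al * b3) (b2 - be * b3) b3
       (c1 - al * c3) (c2 - be * c3) c3 \o linear3 1 0 0 0 1 0 al be 1.
    by apply/funext => -[[u v] z]; rewrite /linear3 /=; congr (_, _, _); ring.
  have DE : D = det3 (a1 - al * a3) (a2 - be * a3) a3 (b1 - al * b3) (b2 - be * b3) b3
       (c1 - al * c3) (c2 - be * c3) c3 by rewrite /D /det3; ring.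
  have -> : `|D|^-1 = `|1|^-1 * `|D|^-1 :> R by rewrite normr1 invr1 mul1r.
  apply: scales_measure_comp; first by apply: scales_linear3_lower; exact: oner_neq0.
  rewrite DE; apply: gen; last by rewrite -DE.
  by apply: contra_neq h => <-; ring.
have [m12|] := eqVneq (a1 * b2 - a2 * b1) 0; last first.
  by move=> h; apply: (shear 0 0); rewrite !mul0r subr0 addr0.
have [m23|] := eqVneq (a2 * b3 - a3 * b2) 0; last first.
  by move=> h; apply: (shear 1 0); rewrite m12 mul0r subr0 add0r mul1r.
have [m13|] := eqVneq (a1 * b3 - a3 * b1) 0; last first.
  by move=> h; apply: (shear 0 1); rewrite m12 mul0r addr0 add0r mul1r oppr_eq0.
(* All minors of the first two rows vanish, hence so does the expansion of the determinant along the
   third row. *)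
case/eqP: D0; rewrite /D /det3.
have -> : a1 * (b2 * c3 - b3 * c2) - a2 * (b1 * c3 - b3 * c1) + a3 * (b1 * c2 - b2 * c1)
  = (a1 * b2 - a2 * b1) * c3 - (a1 * b3 - a3 * b1) * c2 + (a2 * b3 - a3 * b2) * c1 by ring.
by rewrite m12 m13 m23 !mul0r subr0 addr0.
Qed.

End linear_maps.

Lemma is_derive_lineP (R : numFieldType) (V W : normedModType R) (F : V -> W)
    (x v : V) (d : W) :
  is_derive (0 : R) (1 : R) (fun s : R => F (x + s *: v)) d -> is_derive x v F d.
Proof.
have E : (fun h : R => h^-1 *: ((F \o shift x) (h *: v) - F x)) =
  (fun h : R => h^-1 *: (((fun s : R => F (x + s *: v)) \o shift 0) (h *: (1 : R))
      - F (x + (0 : R) *: v))).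
  apply/funext => h /=; rewrite scale0r addr0.
  rewrite !addr0; have -> : h *: (1 : R) = h by rewrite /GRing.scale /= mulr1.
  by rewrite [x + _]addrC.
by case=> d1 d2; split; rewrite ?/derivable ?/derive E.
Qed.

(** * Polyhedra as sublevel sets: continuity of the measure in the bounds *)

Section sublevel.
Context d (T : measurableType d) (R : realType).
Variables (n : nat) (f : 'I_n -> T -> R) (P : pred 'I_n).

Definition sublevel (k : 'rV[R]_n) : set T :=
  [set x | forall l, P l -> f l x <= k ord0 l].

Hypothesis mf : forall l, P l -> measurable_fun setT (f l).

Lemma measurable_sublevel k : measurable (sublevel k).
Proof.
have -> : sublevel k = \bigcap_(l in [set l : 'I_n | P l]) (f l @^-1` `]-oo, k ord0 l]).
  by apply/seteqP; split=> x h l /= Pl; have := h l Pl; rewrite /= in_itv.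
apply: fin_bigcap_measurable => // l Pl.
rewrite -[X in measurable X]setTI; apply: mf => //; exact: measurable_itv.
Qed.

Lemma sublevelS (k k' : 'rV[R]_n) : (forall l, k ord0 l <= k' ord0 l) ->
  sublevel k `<=` sublevel k'.
Proof. by move=> kk' x h l Pl; apply: le_trans (h l Pl) (kk' l). Qed.

Variable mu : {measure set T -> \bar R}.

(** Near [k] the set lies between those with all bounds changed by plus or minus [1 / (m + 1)]. The
    outer sets decrease to the sublevel set; the inner ones increase to a subset that omits at most
    points with some [f l x = k_l], a null set. *)
Lemma continuous_measure_sublevel (k : 'rV[R]_n) :
  (forall k, mu (sublevel k) < +oo)%E ->
  (forall l, P l -> mu [set x | f l x = k ord0 l] = 0) ->
  {for k, continuous (fun k => fine (mu (sublevel k)))}.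
Proof.
move=> fin null.
have fn k' : mu (sublevel k') \is a fin_num by rewrite ge0_fin_numE.
pose up m := sublevel (k + const_mx m.+1%:R^-1).
pose dn m := sublevel (k - const_mx m.+1%:R^-1).
have cup : mu \o up @ \oo --> mu (sublevel k).
  have -> : sublevel k = \bigcap_m up m.
    apply/seteqP; split=> x h.
      move=> m _ l Pl; rewrite !mxE; apply: le_trans (h l Pl) _.
      by rewrite lerDl invr_ge0.
    move=> l Pl; apply/ler_addgt0Pr => e e0.
    have [m _ hm] : \forall m \near \oo, m.+1%:R^-1 < e :> R.
      near=> m; near: m; exact: (near_infty_natSinv_lt (PosNum e0)).
    have := h m I l Pl; rewrite !mxE => /le_trans; apply.
    by rewrite lerD2l ltW// hm//=.
  apply: nonincreasing_cvg_mu => //.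
  - exact: fin.
  - by move=> m; exact: measurable_sublevel.
  - by apply: bigcapT_measurable => m; exact: measurable_sublevel.
  - move=> a b ab; apply/subsetPset; apply: sublevelS => l; rewrite !mxE lerD2l.
    by rewrite lef_pV2 ?posrE// ler_nat ltnS.
have cdn : mu \o dn @ \oo --> mu (sublevel k).
  have mB : measurable (\bigcup_m dn m).
    by apply: bigcupT_measurable => m; exact: measurable_sublevel.
  have -> : mu (sublevel k) = mu (\bigcup_m dn m).
    apply/eqP; rewrite eq_le; apply/andP; split; last first.
      apply: le_measure; rewrite ?inE//; first exact: measurable_sublevel.
      move=> x [m _]; apply: sublevelS => l; rewrite !mxE.
      by rewrite gerBl invr_ge0.
    pose N := \bigcup_(l in [set l : 'I_n | P l]) [set x | f l x = k ord0 l].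
    have mN l : P l -> measurable [set x | f l x = k ord0 l].
      move=> Pl; have := mf Pl measurableT (@measurable_set1 _ (k ord0 l)).
      by rewrite setTI.
    have mNN : measurable N by apply: fin_bigcup_measurable => // l Pl; exact: mN.
    have sub : sublevel k `<=` (\bigcup_m dn m) `|` N.
      move=> x h; have [hN|hN] := pselect (N x); [by right|left].
      have lt l : P l -> f l x < k ord0 l.
        move=> Pl; rewrite lt_neqAle h// andbT; apply/eqP => e; apply: hN.
        by exists l.
      have [m hm] : exists m, forall l, P l -> f l x <= k ord0 l - m.+1%:R^-1.
        have : \forall m \near \oo, forall l, P l -> f l x <= k ord0 l - m.+1%:R^-1.
          apply: filter_forall => l; case: (boolP (P l)) => Pl; last by near=> m.
          have e0 : 0 < k ord0 l - f l x by rewrite subr_gt0 lt.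
          near=> m => _; rewrite lerBrDl -lerBrDr ltW//; near: m.
          exact: (near_infty_natSinv_lt (PosNum e0)).
        by case=> m _ hm; exists m; apply: hm => /=.
      by exists m => // l Pl; rewrite !mxE; exact: hm.
    apply: le_trans (le_measure _ _ _ sub) _; rewrite ?inE//;
      [exact: measurable_sublevel|exact: measurableU|].
    apply: le_trans (measureU2 _ _ _) _ => //.
    rewrite [X in (_ + X)%E](_ : _ = 0) ?adde0//.
    apply/eqP; rewrite eq_le measure_ge0 andbT.
    have -> : N = \big[setU/set0]_(l <- index_enum 'I_n | P l) [set x | f l x = k ord0 l].
      by rewrite -bigcup_seq_cond; apply: eq_bigcupl; split=> l /=; rewrite mem_index_enum.
    set B := \big[_/_]_(_ | _) _.
    suff [_ h] : measurable B /\ mu B = 0 by move: (lexx (mu B)); rewrite {2}h.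
    apply: (big_ind (fun A => measurable A /\ mu A = 0)) => //.
      move=> A C [mA A0] [mC C0]; split; first exact: measurableU.
      by rewrite measureU0.
    by move=> l Pl; split; [exact: mN|exact: null].
  apply: nondecreasing_cvg_mu => //.
  - by move=> m; exact: measurable_sublevel.
  - move=> a b ab; apply/subsetPset; apply: sublevelS => l; rewrite !mxE lerD2l.
    by rewrite lerN2 lef_pV2 ?posrE// ler_nat ltnS.
have cup' : fine (mu (up m)) @[m --> \oo] --> fine (mu (sublevel k)).
  by apply: fine_cvg; rewrite fineK.
have cdn' : fine (mu (dn m)) @[m --> \oo] --> fine (mu (sublevel k)).
  by apply: fine_cvg; rewrite fineK.
have nF : Filter (nbhs k) by exact: nbhs_filter.
rewrite /continuous_at; apply/(@cvgrPdist_le _ _ _ _ nF) => e e0.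
move/cvgrPdist_le : cup' => /(_ e e0) [m1 _ h1].
move/cvgrPdist_le : cdn' => /(_ e e0) [m2 _ h2].
pose m := maxn m1 m2.
have {}h1 := h1 m (leq_maxl _ _); have {}h2 := h2 m (leq_maxr _ _).
have m0 : 0 < m.+1%:R^-1 :> R by rewrite invr_gt0.
apply/nbhs_ballP; exists m.+1%:R^-1 => //= k' kk'.
have kl l : `|k ord0 l - k' ord0 l| < m.+1%:R^-1 by case: kk' => _ /(_ ord0 l).
have a1 : fine (mu (sublevel k')) <= fine (mu (up m)).
  apply: fine_le; [exact: fn|exact: fn|]; apply: le_measure; rewrite ?inE; [exact: measurable_sublevel..|].
  by apply: sublevelS => l; rewrite !mxE; have := kl l; rewrite ltr_distl => /andP[hl _]; rewrite -lerBlDr ltW.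
have a2 : fine (mu (dn m)) <= fine (mu (sublevel k')).
  apply: fine_le; [exact: fn|exact: fn|]; apply: le_measure; rewrite ?inE; [exact: measurable_sublevel..|].
  by apply: sublevelS => l; rewrite !mxE; have := kl l; rewrite ltr_distl => /andP[_ hl]; rewrite lerBlDr ltW.
move: h1 h2; rewrite !ler_distl => /andP[? ?] /andP[? ?]; apply/andP; split; lra.
Unshelve. all: by end_near.
Qed.

End sublevel.

(** * The derivative of the measure in one of the bounds *)

Section slice.
Context d (T : measurableType d) (R : realType).
Variable mu : {sigma_finite_measure set T -> \bar R}.
Local Notation RR := (measurableTypeR R).

(** The measure below the height [s] is the integral of the slice measures up to [s], so this is the
    fundamental theorem of calculus at a point where the slice measure is continuous. Finiteness up
    to [s0 + 1] makes the slice measure integrable on a half-line that has [s0] in its interior. *)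
Lemma is_derive_measure_slice (E : set (T * RR)) (s0 : R) :
  measurable E ->
  (forall u, mu (ysection E u) < +oo)%E ->
  ((mu \x lebesgue_measure) (E `&` [set z | z.2 <= s0 + 1]%R) < +oo)%E ->
  {for s0, continuous (fun u : R => fine (mu (ysection E u)))} ->
  is_derive s0 (1 : R) (fun s : R => fine
      ((mu \x lebesgue_measure) (E `&` [set z | z.2 <= s]%R))%E)
    (fine (mu (ysection E s0))).
Proof.
move=> mE fin finE cG.
pose G (u : R) := fine (mu (ysection E u)).
have mEs s : measurable (E `&` [set z : T * RR | z.2 <= s]%R).
  apply: measurableI => //.
  rewrite (_ : [set _ | _] = setT `&` snd @^-1` `]-oo, s]); last first.
    by rewrite setTI; apply/seteqP; split=> z /=; rewrite in_itv.
  by apply: measurable_snd => //; exact: measurable_itv.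
have muE s : ((mu \x lebesgue_measure) (E `&` [set z | z.2 <= s]%R) =
    \int[lebesgue_measure]_(u in `]-oo, s]) (G u)%:E)%E.
  rewrite product_measureE// [RHS]integral_mkcond; apply: eq_integral => u _.
  rewrite patchE; case: ifPn; rewrite ?inE/= ?in_itv/= => us.
    rewrite /G fineK ?ge0_fin_numE//; congr (mu _).
    by apply/seteqP; split=> x; rewrite /ysection /= !inE; [case|split].
  rewrite (_ : ysection _ _ = set0) ?measure0//.
  apply/seteqP; split=> x //; rewrite /ysection /= !inE => -[_ /=] h.
  by case/negP: us; rewrite inE /= in_itv.
have intG : (@lebesgue_measure R).-integrable [set` `]-oo, s0 + 1]] (EFin \o G).
  apply/integrableP; split.
    apply/measurable_EFinP; apply: (measurable_funTS).
    apply: (measurableT_comp (f := fine)) => //; exact: measurable_fun_ysection.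
  under eq_integral do rewrite /= ger0_norm ?fine_ge0//.
  by rewrite -muE.
have s01 : s0 < s0 + 1 by rewrite ltrDl.
have [dF F'] := @continuous_FTC1 R G -oo%O s0 (s0 + 1) s01 intG (ltNyr _) cG.
have E1 : (fun s : R => fine ((mu \x lebesgue_measure) (E `&` [set z | z.2 <= s]%R))%E) =
    (fun s => \int[lebesgue_measure]_(t in [set` `]-oo, s]]) G t).
  by apply/funext => s; rewrite muE.
rewrite E1; split; [exact: dF|rewrite -derive1E; exact: F'].
Qed.

Variables (n : nat) (f : 'I_n -> T -> R) (c : 'I_n -> R) (Q : pred 'I_n) (j : 'I_n).
Hypothesis Qj : Q j.
Hypothesis mf : forall l, measurable_fun setT (f l).
Hypothesis fj0 : forall x, f j x = 0.
Hypothesis cj1 : c j = 1.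

Let F l (z : T * RR) : R := f l z.1 + c l * z.2.
Let muT : {measure set (T * RR) -> \bar R} := (mu \x lebesgue_measure)%E.
Let Phi k := fine (muT (sublevel F Q k)).
Let psi k := fine (mu (sublevel f [pred l | Q l & l != j] k)).

(** The hypotheses on [f j] and [c j] say that constraint [j] bounds the height alone. Changing
    [k_j] moves this ceiling, and on the ceiling, where the height is [k_j], the other constraints
    read [f l <= k_l - k_j * c l]. *)
Lemma is_derive_measure_sublevel (k : 'rV[R]_n) :
  (forall k, muT (sublevel F Q k) < +oo)%E ->
  (forall k, mu (sublevel f [pred l | Q l & l != j] k) < +oo)%E ->
  {for k - k ord0 j *: \row_l c l, continuous psi} ->
  is_derive k (delta_mx ord0 j) Phi (psi (k - k ord0 j *: \row_l c l)).
Proof.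
move=> finF finf cpsi.
have mF l : measurable_fun setT (F l).
  apply: measurable_funD; first by apply: (measurableT_comp (f := f l)).
  by apply: measurable_funM => //.
(* The body without its ceiling: it does not change with [k_j]. *)
pose E := sublevel F [pred l | Q l & l != j] k.
have mE : measurable E by apply: measurable_sublevel => l _; exact: mF.
have yE u : ysection E u = sublevel f [pred l | Q l & l != j] (k - u *: \row_l c l).
  apply/seteqP; rewrite /ysection; split=> x /=; rewrite inE => h l lj; have := h l lj;
    rewrite /F !mxE /= lerBrDr mulrC; exact.
have EPhi s : E `&` [set z | z.2 <= k ord0 j + s] =
    sublevel F Q (k + s *: delta_mx ord0 j).
  apply/seteqP; split=> z.
    move=> [h hj] l Ql; rewrite !mxE /=; have [->|lj] := eqVneq l j.
      by rewrite /F fj0 cj1 add0r mul1r mulr1.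
    by rewrite mulr0 addr0; apply: h; rewrite /= Ql.
  move=> h; split.
    by move=> l /andP[Ql /negPf lj]; have := h l Ql; rewrite !mxE /= lj mulr0 addr0.
  by have := h j Qj; rewrite !mxE /= eqxx mulr1 /F fj0 cj1 add0r mul1r.
apply: is_derive_lineP.
have key : is_derive (k ord0 j) (1 : R) (fun s : R => fine
      ((mu \x lebesgue_measure) (E `&` [set z | z.2 <= s]%R))%E)
      (fine (mu (ysection E (k ord0 j)))).
  apply: is_derive_measure_slice => //.
  - by move=> u; rewrite yE.
  - by rewrite -[X in (X < _)%E]/(muT _) EPhi; exact: finF.
  - have -> : (fun u : R => fine (mu (ysection E u))) =
        psi \o (fun u : R => k - u *: \row_l c l).
      by apply/funext => u /=; rewrite yE.
    apply: continuous_comp => //.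
    apply: continuousB; first exact: cst_continuous.
    exact: scalel_continuous.
rewrite /psi -yE.
have -> : (fun s : R => Phi (k + s *: delta_mx ord0 j)) =
   (fun s : R => fine ((mu \x lebesgue_measure) (E `&` [set z | z.2 <= s]%R))%E) \o shift (k ord0 j).
  apply/funext => s /=; rewrite [s + _]addrC.
  by rewrite -[X in _ = fine X]/(muT (E `&` [set z | z.2 <= k ord0 j + s])) EPhi.
have key0 : is_derive (shift (k ord0 j) 0) (1 : R) (fun s : R => fine
      ((mu \x lebesgue_measure) (E `&` [set z | z.2 <= s]%R))%E)
      (fine (mu (ysection E (k ord0 j)))) by rewrite /= add0r.
have := is_derive1_comp key0 (is_derive_shift 0 1 (k ord0 j)).
by rewrite mulr1.
Qed.

End slice.

(** * Continuous partial derivatives *)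

Lemma is_derive_line (R : numFieldType) (V W : normedModType R) (F : V -> W)
    (x v : V) (s : R) (d : W) :
  is_derive (x + s *: v) v F d ->
  is_derive s (1 : R) (fun s : R => F (x + s *: v)) d.
Proof.
have E : (fun h : R => h^-1 *: ((F \o shift (x + s *: v)) (h *: v) - F (x + s *: v))) =
  (fun h : R => h^-1 *: (((fun s : R => F (x + s *: v)) \o shift s) (h *: (1 : R))
      - F (x + s *: v))).
  apply/funext => h /=; have -> : h *: (1 : R) = h by rewrite /GRing.scale /= mulr1.
  by rewrite scalerDl addrCA.
by case=> d1 d2; split; move: d1 d2; rewrite ?/derivable ?/derive E.
Qed.

Lemma MVT_from0 (R : realType) (g dg : R -> R) (b : R) :
  (forall s : R, `|s| <= `|b| -> is_derive s (1 : R) g (dg s)) ->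
  exists2 c, `|c| <= `|b| & g b - g 0 = dg c * b.
Proof.
move=> dgP.
have cg s : `|s| <= `|b| -> {for s, continuous g}.
  by move=> /dgP[h _]; apply/differentiable_continuous/derivable1_diffP.
have [b0|b0] := leP 0 b.
  have sb s : s \in `[0, b] -> `|s| <= `|b|.
    by rewrite in_itv /= => /andP[s0 sb]; rewrite !ger0_norm.
  have [||c cb ->] := @MVT_segment R g dg 0 b b0.
  - by move=> s sb'; apply/dgP/sb; exact: subset_itv_oo_cc.
  - by apply: continuous_in_subspaceT => s; rewrite inE => /sb; exact: cg.
  - by exists c; [exact: sb|rewrite subr0].
have sb s : s \in `[b, 0] -> `|s| <= `|b|.
  by rewrite in_itv /= => /andP[bs s0]; rewrite !ler0_norm ?lerN2// ltW.
have [||c cb E] := @MVT_segment R g dg b 0 (ltW b0).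
- by move=> s sb'; apply/dgP/sb; exact: subset_itv_oo_cc.
- by apply: continuous_in_subspaceT => s; rewrite inE => /sb; exact: cg.
- by exists c; [exact: sb|rewrite -opprB E; ring].
Qed.

Lemma differentiable_littleo (R : numFieldType) (V W : normedModType R) (f : V -> W)
    (df : {linear V -> W}) (x : V) :
  continuous df ->
  (forall e : R, 0 < e -> \forall h \near (0 : V),
     `|f (h + x) - f x - df h| <= e * `|h|) ->
  differentiable f x.
Proof.
move=> cdf H.
have E : f \o shift x = cst (f x) + df +o_ (0 : V) id.
  apply: eqaddoE; apply/eqaddoP => e e0; have := H e e0; apply: filterS => h /=.
  by rewrite opprD addrA.
have dE := diff_unique cdf E.
by apply/diff_locallyP; split; rewrite dE.
Qed.

Section continuous_partials.
Context {R : realType} {n : nat}.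

Lemma ball_row (x y : 'rV[R]_n) (e : R) :
  0 < e -> (forall i, `|x ord0 i - y ord0 i| < e) -> ball x e y.
Proof. by move=> e0 h; split=> // i j; rewrite ord1; exact: h. Qed.

Lemma entry_le_norm (x : 'rV[R]_n) i : `|x ord0 i| <= `|x|.
Proof.
rewrite leNgt; apply/negP => h.
have : ball (0 : 'rV[R]_n) `|x ord0 i| x by rewrite -ball_normE /ball_ /= sub0r normrN.
by case=> _ /(_ ord0 i); rewrite /ball /= mxE sub0r normrN ltxx.
Qed.

(** The passage from [x] to [x + v] changes one coordinate at a time, and the mean value theorem is
    applied to each move. *)
Lemma differentiable_continuous_partials (f : 'rV[R]_n -> R) (x : 'rV[R]_n) :
  (forall i, \forall y \near x, derivable f y (delta_mx ord0 i)) ->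
  (forall i, {for x, continuous (partial i f)}) ->
  differentiable f x.
Proof.
move=> df cf.
pose a := \col_i partial i f x.
have lin : linear (fun v : 'rV[R]_n => (v *m a) ord0 ord0).
  by move=> c u v; rewrite mulmxDl -scalemxAl !mxE.
pose A0 := GRing.isLinear.Build R _ _ _ (fun v : 'rV[R]_n => (v *m a) ord0 ord0) lin.
pose A : {linear 'rV[R]_n -> R} := HB.pack (fun v : 'rV[R]_n => (v *m a) ord0 ord0) A0.
have AE v : A v = \sum_i v ord0 i * partial i f x.
  by rewrite /A /= !mxE; apply: eq_bigr => i _; rewrite mxE.
apply: (@differentiable_littleo _ _ _ f A).
  have -> : (A : 'rV[R]_n -> R) = fun v : 'rV[R]_n => \sum_i v ord0 i * partial i f x.
    by apply/funext => v; exact: AE.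
  have cA i : continuous (fun v : 'rV[R]_n => v ord0 i * partial i f x : R).
    move=> v; apply: differentiable_continuous.
    by apply: differentiableM; first exact: differentiable_coord.
  apply: continuous_big => [|i _]; first exact: add_continuous.
  exact: cA.
move=> e e0.
(* The [n] moves contribute at most [n * e'], which is below [e]; the successor keeps the divisor
   nonzero for [n = 0]. *)
pose e' := e / n.+1%:R.
have e'0 : 0 < e' by rewrite divr_gt0.
have nF : Filter (nbhs x) by exact: nbhs_filter.
have : \forall y \near x, forall i, derivable f y (delta_mx ord0 i) /\
    `|partial i f x - partial i f y| < e'.
  apply: (@filter_forall _ 'I_n (fun i y => derivable f y (delta_mx ord0 i) /\
    `|partial i f x - partial i f y| < e') _ nF) => i.
  have := cf i; rewrite /continuous_at => /(@cvgrPdist_lt _ _ _ _ nF) /(_ _ e'0).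
  by move: (df i); apply: filterS2.
move=> /nbhs_ballP[d /= d0 H].
apply/nbhs_ballP; exists d => //= v [_ vd].
have vd' i : `|v ord0 i| < d by have := vd ord0 i; rewrite /ball /= mxE sub0r normrN.
(* The first [k] coordinates of [v], completed by zeros. *)
pose w k := \row_(i < n) (if (i < k)%N then v ord0 i else 0).
have step (k : 'I_n) :
   `|f (x + w k.+1) - f (x + w k) - v ord0 k * partial k f x| <= e' * `|v|.
  have wS s : x + w k + s *: delta_mx ord0 k = x + (w k + s *: delta_mx ord0 k).
    by rewrite addrA.
  have inb s : `|s| <= `|v ord0 k| -> ball x d (x + w k + s *: delta_mx ord0 k).
    move=> sv; apply: ball_row => // i; rewrite !mxE /= opprD addrA opprD addrA subrr sub0r -opprD normrN.
    have [->|ik] := eqVneq i k; first by rewrite ltnn add0r mulr1 (le_lt_trans sv).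
    by rewrite mulr0 addr0; case: ifP => _; rewrite ?normr0.
  have wE : x + w k.+1 = x + w k + v ord0 k *: delta_mx ord0 k.
    apply/rowP => i; rewrite !mxE /= -addrA; congr (_ + _).
    have [->|ik] := eqVneq i k; first by rewrite ltnSn ltnn add0r mulr1.
    by rewrite mulr0 addr0 ltnS leq_eqVlt -[(i == k :> nat)]/(i == k) (negPf ik).
  have [s|c cv] := @MVT_from0 R (fun s => f (x + w k + s *: delta_mx ord0 k))
      (fun s => partial k f (x + w k + s *: delta_mx ord0 k)) (v ord0 k).
    by move=> /inb/H /(_ k) [dk _]; apply: is_derive_line; apply: derivableP.
  rewrite /= scale0r addr0 -wE => ->.
  rewrite mulrC -mulrBr normrM mulrC; apply: ler_pM => //; last exact: entry_le_norm.
  by have [_ /ltW] := H _ (inb c cv) k; rewrite distrC.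
have tele : f (v + x) - f x - A v =
    \sum_(k < n) (f (x + w k.+1) - f (x + w k) - v ord0 k * partial k f x).
  rewrite sumrB -AE -(big_mkord xpredT (fun k => f (x + w k.+1) - f (x + w k))).
  rewrite telescope_sumr//; congr (f _ - f _ - _).
    by rewrite addrC; congr (_ + _); apply/rowP => i; rewrite mxE ltn_ord.
  by rewrite [w 0%N](_ : _ = 0) ?addr0//; apply/rowP => i; rewrite !mxE.
rewrite tele; apply: le_trans (ler_norm_sum _ _ _) _.
apply: le_trans (ler_sum _ (fun k _ => step k)) _.
rewrite sumr_const card_ord -mulr_natl mulrA; apply: ler_wpM2r => //.
by rewrite /e' mulrCA ger_pMr// ler_pdivrMr// mul1r ler_nat.
Qed.

End continuous_partials.

(** * Differentiation rules and the derivative of a dihedral angle *)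

Section calculus.
Context {R : realType} {V : normedModType R}.

Lemma near_eq_differentiable (f g : V -> R) (x : V) :
  (\forall y \near x, f y = g y) -> differentiable f x -> differentiable g x.
Proof.
move=> fg df; have cdf : continuous ('d f x) by exact: diff_continuous.
apply: (differentiable_littleo cdf) => e e0.
have fgx : f x = g x by exact: nbhs_singleton fg.
have near0 : \forall h \near (0 : V), f (h + x) = g (h + x).
  by move: fg; rewrite (near_shift (0 : V)) => fg; apply: filterS fg => h /=; rewrite subr0.
have /eqaddoP/(_ e e0) := diff_locally df.
apply: filterS2 near0 => h <- /=; rewrite -fgx => hh.
by rewrite -addrA -opprD.
Qed.

Lemma is_derive_bigsum (I : Type) (s : seq I) (P : pred I) (f : I -> V -> R)
    (df : I -> R) (x v : V) :
  (forall i, P i -> is_derive x v (f i) (df i)) ->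
  is_derive x v (fun y => \sum_(i <- s | P i) f i y) (\sum_(i <- s | P i) df i).
Proof.
move=> h; elim: s => [|i s IH].
  rewrite big_nil (_ : (fun y => _) = cst 0); first exact: is_derive_cst.
  by apply/funext => y; rewrite big_nil.
rewrite big_cons; case: (boolP (P i)) => Pi.
  rewrite (_ : (fun y => _) = f i + (fun y => \sum_(j <- s | P j) f j y)).
    by apply: is_deriveD; exact: h.
  by apply/funext => y; rewrite big_cons Pi.
rewrite (_ : (fun y => _) = (fun y => \sum_(j <- s | P j) f j y))//.
by apply/funext => y; rewrite big_cons (negPf Pi).
Qed.

Lemma differentiable_bigsum (I : Type) (s : seq I) (P : pred I) (f : I -> V -> R)
    (x : V) :
  (forall i, P i -> differentiable (f i) x) ->
  differentiable (fun y => \sum_(i <- s | P i) f i y) x.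
Proof.
move=> h; elim: s => [|i s IH].
  rewrite (_ : (fun y => _) = cst 0); first exact: differentiable_cst.
  by apply/funext => y; rewrite big_nil.
case: (boolP (P i)) => Pi.
  rewrite (_ : (fun y => _) = f i + (fun y => \sum_(j <- s | P j) f j y)).
    by apply: differentiableD; first exact: h.
  by apply/funext => y; rewrite big_cons Pi.
rewrite (_ : (fun y => _) = (fun y => \sum_(j <- s | P j) f j y))//.
by apply/funext => y; rewrite big_cons (negPf Pi).
Qed.

Lemma is_derive_comp1 (g : R -> R) (f : V -> R) (x v : V) (dg df : R) :
  is_derive (f x) (1 : R) g dg -> is_derive x v f df ->
  is_derive x v (g \o f) (dg * df).
Proof.
move=> hg hf; apply: is_derive_lineP.
have h0 : is_derive (0 : R) (1 : R) (fun s : R => f (x + s *: v)) df.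
  by apply: is_derive_line; rewrite scale0r addr0.
apply: (@is_derive1_comp _ g (fun s : R => f (x + s *: v))) => //.
by rewrite scale0r addr0.
Qed.

Lemma differentiable_comp1 (g : R -> R) (f : V -> R) (x : V) :
  derivable g (f x) 1 -> differentiable f x -> differentiable (g \o f) x.
Proof. by move=> /derivable1_diffP hg hf; exact: differentiable_comp. Qed.

(* The dihedral angle between two faces of a tetrahedron, in terms of the cofactors
   [x], [y], [z] of its Gram matrix. *)
Definition cofactor_angle (x y z : R) : R := acos (- z / Num.sqrt (x * y)).

Section angle.
Variables (x y z : V -> R) (r : V).
Hypotheses (x0 : 0 < x r) (y0 : 0 < y r) (zxy : z r ^+ 2 < x r * y r).

Let q := x r * y r.
Let q0 : 0 < q. Proof. exact: mulr_gt0. Qed.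
Let sq0 : 0 < Num.sqrt q. Proof. by rewrite sqrtr_gt0. Qed.

Let c := - z r / Num.sqrt q.

Let c2 : c ^+ 2 = z r ^+ 2 / q.
Proof. by rewrite /c expr_div_n sqrrN sqr_sqrtr// ltW. Qed.

Let c1 : -1 < c < 1.
Proof.
rewrite -ltr_norml -(@ltr_pXn2r _ 2%N)// ?nnegrE//.
by rewrite expr1n real_normK ?num_real// c2 ltr_pdivrMr// mul1r.
Qed.

Let sinE : Num.sqrt (1 - c ^+ 2) = Num.sqrt (q - z r ^+ 2) / Num.sqrt q.
Proof.
rewrite c2 -sqrtrV ?ltW// -sqrtrM; last by rewrite subr_ge0 ltW.
by congr Num.sqrt; rewrite mulrBl mulfV ?gt_eqF.
Qed.

Lemma differentiable_cofactor_angle :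
  differentiable x r -> differentiable y r -> differentiable z r ->
  differentiable (fun s => cofactor_angle (x s) (y s) (z s)) r.
Proof.
move=> dx dy dz.
have dq : differentiable (fun s => x s * y s) r by exact: differentiableM.
have ds : differentiable (Num.sqrt \o (fun s => x s * y s)) r.
  apply: differentiable_comp1 => //.
  by have [] := is_derive1_sqrt q0.
have dsV : differentiable (fun s => (Num.sqrt (x s * y s))^-1) r.
  by apply: (differentiableV ds); rewrite gt_eqF.
have dc : differentiable (fun s => - z s / Num.sqrt (x s * y s)) r.
  by apply: differentiableM => //; exact: differentiableN.
apply: (@differentiable_comp1 (@acos R) (fun s => - z s / Num.sqrt (x s * y s))) => //.
Qed.

(** The root [Num.sqrt (x * y)] cancels against the one in the sine, so the only root left is that
    of [x * y - z ^+ 2]. For a tetrahedron this radicand factors, see [lateral_sub] and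
    [base_sub]. *)
Lemma is_derive_cofactor_angle (v : V) (dx dy dz : R) :
  is_derive r v x dx -> is_derive r v y dy -> is_derive r v z dz ->
  is_derive r v (fun s => cofactor_angle (x s) (y s) (z s))
    ((dz - z r / 2 * (dx / x r + dy / y r)) / Num.sqrt (q - z r ^+ 2)).
Proof.
move=> hx hy hz.
have hq : is_derive r v (fun s => x s * y s) (x r * dy + y r * dx).
  exact: (is_deriveM hx hy).
have hsV : is_derive r v (fun s => (Num.sqrt (x s * y s))^-1)
    ((- (Num.sqrt q) ^- 2 *: (2 * Num.sqrt q)^-1) * (x r * dy + y r * dx)).
  apply: (@is_derive_comp1 (fun t => (Num.sqrt t)^-1)) hq.
  by apply: is_deriveV; [rewrite gt_eqF|exact: is_derive1_sqrt].
have hc : is_derive r v (fun s => - z s / Num.sqrt (x s * y s))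
   (- z r *: ((- (Num.sqrt q) ^- 2 *: (2 * Num.sqrt q)^-1) * (x r * dy + y r * dx))
     + (Num.sqrt q)^-1 *: (- dz)).
  exact: (is_deriveM (is_deriveN hz) hsV).
apply: (is_derive_eq (is_derive_comp1 (is_derive1_acos c1) hc)).
rewrite sinE invf_div /GRing.scale /= -!exprVn.
have qE : Num.sqrt q ^+ 2 = x r * y r by rewrite sqr_sqrtr// ltW.
set sn := Num.sqrt (q - _).
have sn0 : sn != 0 by rewrite gt_eqF// sqrtr_gt0 subr_gt0.
have -> : (Num.sqrt q)^-1 ^+ 2 = (x r * y r)^-1 by rewrite exprVn qE.
have sne : Num.sqrt q != 0 by rewrite gt_eqF.
field.
by rewrite sn0 sne !gt_eqF.
Qed.

End angle.
End calculus.

(** * Tetrahedra with given edge lengths *)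

Section dot.
Context {R : realType}.
Implicit Types x y z : 'rV[R]_3.

Lemma dotE x y : dot x y = x ord0 0 * y ord0 0 + x ord0 1 * y ord0 1 + x ord0 2%:R * y ord0 2%:R.
Proof.
rewrite /dot !big_ord_recr big_ord0 /= add0r.
by congr (_ * _ + _ * _ + _ * _); congr (_ _ _); apply: val_inj.
Qed.

Lemma dotC x y : dot x y = dot y x.
Proof. by rewrite /dot; apply: eq_bigr => k _; rewrite mulrC. Qed.

Lemma dotDl x y z : dot (x + y) z = dot x z + dot y z.
Proof. by rewrite /dot -big_split; apply: eq_bigr => k _; rewrite mxE mulrDl. Qed.

Lemma dotZl (c : R) x y : dot (c *: x) y = c * dot x y.
Proof. by rewrite /dot mulr_sumr; apply: eq_bigr => k _; rewrite mxE mulrA. Qed.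

Lemma dotNl x y : dot (- x) y = - dot x y.
Proof. by rewrite -scaleN1r dotZl mulN1r. Qed.

Lemma dotBl x y z : dot (x - y) z = dot x z - dot y z.
Proof. by rewrite dotDl dotNl. Qed.

Lemma dotDr x y z : dot x (y + z) = dot x y + dot x z.
Proof. by rewrite dotC dotDl !(dotC x). Qed.

Lemma dotZr (c : R) x y : dot x (c *: y) = c * dot x y.
Proof. by rewrite dotC dotZl dotC. Qed.

Lemma dotBr x y z : dot x (y - z) = dot x y - dot x z.
Proof. by rewrite dotC dotBl !(dotC x). Qed.

Lemma dotNr x y : dot x (- y) = - dot x y.
Proof. by rewrite dotC dotNl dotC. Qed.

Lemma dot0l x : dot 0 x = 0.
Proof. by rewrite -(scale0r 0) dotZl mul0r. Qed.

Lemma dot0r x : dot x 0 = 0.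
Proof. by rewrite dotC dot0l. Qed.

Lemma dotxx_ge0 x : 0 <= dot x x.
Proof. by apply: sumr_ge0 => k _; rewrite -expr2 sqr_ge0. Qed.

Lemma dotxx_eq0 x : (dot x x == 0) = (x == 0).
Proof.
apply/idP/eqP => [|->]; last by rewrite dot0l.
rewrite psumr_eq0 => [/allP h|k _]; last by rewrite -expr2 sqr_ge0.
apply/rowP => k; rewrite mxE; apply/eqP.
by have := h k (mem_index_enum k); rewrite -expr2 sqrf_eq0.
Qed.

Lemma dotxx_gt0 x : (0 < dot x x) = (x != 0).
Proof. by rewrite lt_def dotxx_ge0 andbT dotxx_eq0. Qed.

Lemma enorm_ge0 x : 0 <= enorm x.
Proof. exact: sqrtr_ge0. Qed.

Lemma sqr_enorm x : enorm x ^+ 2 = dot x x.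
Proof. by rewrite sqr_sqrtr// dotxx_ge0. Qed.

Lemma enorm_gt0 x : (0 < enorm x) = (x != 0).
Proof. by rewrite sqrtr_gt0 dotxx_gt0. Qed.

Lemma enorm_sqr x (c : R) : 0 <= c -> dot x x = c ^+ 2 -> enorm x = c.
Proof. by move=> c0 h; rewrite /enorm h sqrtr_sqr ger0_norm. Qed.

Lemma enormBC x y : enorm (x - y) = enorm (y - x).
Proof. by rewrite /enorm -opprB dotNl dotNr opprK. Qed.

Lemma dot_orth e x y : dot e e != 0 ->
  dot (x - (dot x e / dot e e) *: e) (y - (dot y e / dot e e) *: e) =
  (dot e e * dot x y - dot x e * dot y e) / dot e e.
Proof. by move=> ee; rewrite dotBl !dotBr !dotZl !dotZr (dotC e y); field. Qed.

(** The dot products of the projections orthogonal to [e] are Gram determinants of order two divided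
    by [dot e e]; this divisor cancels in the cosine. *)
Lemma dihedralE (a b c d : 'rV[R]_3) :
  let e := b - a in let w := c - a in let w' := d - a in
  b != a ->
  dihedral a b c d = cofactor_angle (dot e e * dot w w - dot w e ^+ 2)
    (dot e e * dot w' w' - dot w' e ^+ 2) (dot w e * dot w' e - dot e e * dot w w').
Proof.
move=> e w w' ba.
have ee : dot e e != 0 by rewrite dotxx_eq0 subr_eq0.
have ee0 : 0 < dot e e by rewrite dotxx_gt0 subr_eq0.
rewrite /dihedral -/e -/w -/w' /=.
pose o x := x - (dot x e / dot e e) *: e.
have orthE x y : dot (o x) (o y) = (dot e e * dot x y - dot x e * dot y e) / dot e e.
  exact: dot_orth.
rewrite -/(o w) -/(o w') /angle /enorm !orthE -!expr2 /cofactor_angle opprB.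
have o0 x : 0 <= (dot e e * dot x x - dot x e ^+ 2) / dot e e.
  by rewrite expr2 -orthE dotxx_ge0.
congr acos.
rewrite -sqrtrM// mulrACA -invfM -expr2 sqrtrM; last first.
  have o0' x : 0 <= dot e e * dot x x - dot x e ^+ 2.
    by have := o0 x; rewrite (pmulr_lge0 _ _) ?invr_gt0.
  exact: mulr_ge0.
rewrite sqrtrV ?sqr_ge0// sqrtr_sqr gtr0_norm// invfM invrK.
by rewrite mulrACA mulVf// mulr1.
Qed.

End dot.

Section tetrahedra.
Context {R : realType}.

(** Cholesky factorization: the three leading principal minors are positive, so a matrix with the
    given products exists in triangular form. *)
Lemma gram_realization (a b c d e f : R) : 0 < a -> 0 < a * b - d ^+ 2 ->
  0 < a * b * c + 2 * d * e * f - a * f ^+ 2 - b * e ^+ 2 - c * d ^+ 2 ->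
  exists x y z : 'rV[R]_3, [/\ dot x x = a, dot y y = b & dot z z = c] /\
    [/\ dot x y = d, dot x z = e & dot y z = f].
Proof.
move=> a0 m0 D0; set m := a * b - d ^+ 2 in m0; set D := (X in 0 < X) in D0.
pose mk (u v w : R) : 'rV[R]_3 := \row_k [:: u; v; w]`_k.
have dmk u v w u' v' w' : dot (mk u v w) (mk u' v' w') = u * u' + v * v' + w * w'.
  by rewrite dotE !mxE.
have [sa sm sD] : [/\ Num.sqrt a ^+ 2 = a, Num.sqrt m ^+ 2 = m & Num.sqrt D ^+ 2 = D].
  by split; rewrite sqr_sqrtr// ltW.
have [na nm] : Num.sqrt a != 0 /\ Num.sqrt m != 0.
  by split; rewrite gt_eqF// sqrtr_gt0.
exists (mk (Num.sqrt a) 0 0), (mk (d / Num.sqrt a) (Num.sqrt m / Num.sqrt a) 0),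
  (mk (e / Num.sqrt a) ((a * f - d * e) / (Num.sqrt m * Num.sqrt a))
      (Num.sqrt D / Num.sqrt m)).
rewrite !dmk.
have mE : m = a * b - d ^+ 2 by [].
have DE : D = a * b * c + 2 * d * e * f - a * f ^+ 2 - b * e ^+ 2 - c * d ^+ 2 by [].
clearbody m D.
move: sa sm sD na nm; set A := Num.sqrt a; set M := Num.sqrt m; set S := Num.sqrt D.
clearbody A M S => sa sm sD na nm; subst a.
have nA2 : A ^+ 2 != 0 by rewrite expf_neq0.
have bE : b = (M ^+ 2 + d ^+ 2) / A ^+ 2 by rewrite sm mE; field.
have cE : c = (S ^+ 2 - 2 * d * e * f + A ^+ 2 * f ^+ 2 + b * e ^+ 2) / M ^+ 2.
  rewrite sD DE sm mE; field.
  by rewrite -mE -sm expf_neq0.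
split; split; rewrite ?cE ?bE; field; by rewrite ?na ?nm.
Qed.

End tetrahedra.

Section three_sets.
Local Open Scope set_scope.
Context {n : nat} {R : realType}.
Implicit Types (t : {set 'I_n}) (i j k : 'I_n).

Lemma triangleP t i j : #|t| = 3%N -> i \in t -> j \in t -> i != j ->
  exists2 k, t = [set i; j; k] & [/\ k != i, k != j & k \in t].
Proof.
move=> t3 it jt ij.
have : #|t :\ i :\ j| = 1%N.
  have := cardsD1 j (t :\ i); have := cardsD1 i t.
  by rewrite it t3 !inE jt eq_sym ij /= !add1n => -[<-] [<-].
move=> /eqP/cards1P[k tk]; have : k \in t :\ i :\ j by rewrite tk set11.
rewrite !inE => /and3P[kj ki kt]; exists k => //.
apply/setP => l; rewrite !inE; have := congr1 (fun A : {set 'I_n} => l \in A) tk; rewrite !inE.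
have [->|li] := eqVneq l i; first by rewrite it.
by have [->|lj] := eqVneq l j; first by rewrite jt.
Qed.

Lemma triangleD2 i j k : i != j -> k != i -> k != j ->
  [set i; j; k] :\ i :\ j = [set k].
Proof.
move=> ij ki kj; apply/setP => l; rewrite !inE.
have [->|lj] := eqVneq l j; first by rewrite /= (negPf (_ : j != k)) // eq_sym.
have [->|li] := eqVneq l i; first by rewrite /= (negPf (_ : i != k)) // eq_sym.
by [].
Qed.

(** The pairs in the definition of [omega] are ordered by index. Symmetry of the angle makes the
    surviving term independent of which index is the smaller one. *)
Lemma sum_pair_lt (F : 'I_n -> 'I_n -> R) j k : j != k -> F j k = F k j ->
  \sum_(a in [set j; k]) \sum_(b in [set j; k] | (a < b)%N) F a b = F j k.
Proof.
move=> jk Fjk.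
have S (G : 'I_n -> R) (Q : pred 'I_n) : \sum_(a in [set j; k] | Q a) G a =
    (if Q j then G j else 0) + (if Q k then G k else 0).
  by rewrite big_mkcondr big_setU1 /= ?inE// big_set1.
have S1 (G : 'I_n -> R) : \sum_(a in [set j; k]) G a = G j + G k.
  by rewrite big_setU1 /= ?inE// big_set1.
rewrite S1 !S !ltnn add0r addr0 -Fjk.
case: (ltngtP j k) => [_|_|/val_inj e]; rewrite ?addr0 ?add0r//.
by rewrite e eqxx in jk.
Qed.

Lemma sum_triangle_lt (F : 'I_n -> 'I_n -> R) i j k :
  i != j -> k != i -> k != j -> (forall a b, F a b = F b a) ->
  \sum_(a in [set i; j; k]) \sum_(b in [set i; j; k] | (a < b)%N) F a b =
  F i j + F i k + F j k.
Proof.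
move=> ij ki kj FC.
have S1 (G : 'I_n -> R) : \sum_(a in [set i; j; k]) G a = G i + G j + G k.
  rewrite finset.setUC big_setU1 /= ?inE ?negb_or ?ki// big_setU1 /= ?inE// big_set1.
  by rewrite addrC.
have S (G : 'I_n -> R) (Q : pred 'I_n) : \sum_(a in [set i; j; k] | Q a) G a =
    (if Q i then G i else 0) + (if Q j then G j else 0) + (if Q k then G k else 0).
  by rewrite big_mkcondr S1.
have H (a b : 'I_n) : a != b -> (if (a < b)%N then F a b else 0) + (if (b < a)%N then F b a else 0) = F a b.
  move=> ab; rewrite (FC b a); case: (ltngtP a b) => [_|_|/val_inj e]; rewrite ?addr0 ?add0r//.
  by rewrite e eqxx in ab.
rewrite S1 !S !ltnn -[in RHS](H i j)// -[in RHS](H i k) 1?eq_sym// -[in RHS](H j k) 1?eq_sym//.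
by ring.
Qed.

End three_sets.

(** * The Gram matrix of a tetrahedron as a function of its edge lengths *)

Section gram.
Local Open Scope set_scope.
Context {R : realType} {n : nat} (p : 'I_n -> 'rV[R]_3).
Implicit Types (r : 'rV[R]_n) (t : {set 'I_n}) (i j k : 'I_n).

(** Law of cosines: the dot product of two lateral edge vectors issuing from the apex. *)
Definition gram r i j : R := (r ord0 i ^+ 2 + r ord0 j ^+ 2 - ell p i j ^+ 2) / 2.

Definition minor2 r i j : R := gram r i i * gram r j j - gram r i j ^+ 2.

(** For the base vertices [x], [y], [z] of indices [i], [j], [k] this is the dot product of
    [cross z x] and [cross x y], as [minor2 r i j] is that of [cross x y] with itself: the cofactors
    of the Gram matrix are the products of the doubled area vectors of the lateral faces. *)
Definition cof r i j k : R := gram r i j * gram r i k - gram r j k * gram r i i.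

(** The squared volume of the tetrahedron, times 36. *)
Definition gram_det r i j k : R :=
  gram r i i * gram r j j * gram r k k + 2 * gram r i j * gram r i k * gram r j k
  - gram r i i * gram r j k ^+ 2 - gram r j j * gram r i k ^+ 2
  - gram r k k * gram r i j ^+ 2.

(** The area vectors of the four faces sum to zero, so that of the base is minus the sum of the
    lateral ones. Its products with a lateral area vector and with itself are a negated row sum and
    the full sum of the cofactors. *)
Definition base_cof r i j k : R := - (minor2 r i j + cof r i j k + cof r j i k).

Definition base_minor r i j k : R :=
  minor2 r i j + minor2 r i k + minor2 r j k + 2 * (cof r i j k + cof r j i k + cof r k i j).

Definition lateral_angle i j k r : R :=
  cofactor_angle (minor2 r i j) (minor2 r i k) (cof r i j k).

Definition base_angle i j k r : R :=
  cofactor_angle (base_minor r i j k) (minor2 r i j) (base_cof r i j k).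

Lemma ellC i j : ell p i j = ell p j i.
Proof. exact: enormBC. Qed.

Lemma ellii i : ell p i i = 0.
Proof. by rewrite /ell subrr /enorm dot0l sqrtr0. Qed.

Lemma gramC r i j : gram r i j = gram r j i.
Proof. by rewrite /gram ellC [r ord0 i ^+ 2 + _]addrC. Qed.

Lemma gramii r i : gram r i i = r ord0 i ^+ 2.
Proof. by rewrite /gram ellii; field. Qed.

Lemma minor2C r i j : minor2 r i j = minor2 r j i.
Proof. by rewrite /minor2 gramC mulrC. Qed.

Lemma cofC r i j k : cof r i j k = cof r i k j.
Proof. by rewrite /cof mulrC (gramC r j k). Qed.

Lemma base_cofC r i j k : base_cof r i j k = base_cof r j i k.
Proof. by rewrite /base_cof minor2C; ring. Qed.

Lemma base_minorC r i j k : base_minor r i j k = base_minor r j i k.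
Proof. by rewrite /base_minor (minor2C r i j) (cofC r k i j); ring. Qed.

Lemma edge_sqr r i j : gram r i i + gram r j j - 2 * gram r i j = ell p i j ^+ 2.
Proof. by rewrite !gramii /gram; field. Qed.

(** Jacobi's identity: a minor of order two of the adjugate is the determinant times the
    complementary entry. The entry is the squared length of the edge at which the angle is taken;
    [base_sub] is the analogue for the base edges. *)
Lemma lateral_sub r i j k : minor2 r i j * minor2 r i k - cof r i j k ^+ 2 =
  gram_det r i j k * gram r i i.
Proof. by rewrite /minor2 /cof /gram_det; ring. Qed.

Lemma base_sub r i j k : base_minor r i j k * minor2 r i j - base_cof r i j k ^+ 2 =
  gram_det r i j k * ell p i j ^+ 2.
Proof.
rewrite -(edge_sqr r) /base_minor /base_cof /minor2 /cof /gram_det.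
rewrite (gramC r j i) (gramC r k i) (gramC r k j).
move: (gram r i i) (gram r j j) (gram r k k) (gram r i j) (gram r i k) (gram r j k) => a b c d e f.
by ring.
Qed.

Definition nondegenerate r i j k : Prop :=
  [/\ 0 < r ord0 i, 0 < r ord0 j, 0 < r ord0 k &
   [/\ 0 < minor2 r i j, 0 < minor2 r i k, 0 < minor2 r j k & 0 < gram_det r i j k]].

(** [gram_realization] shows that a tetrahedron with these lengths exists, so the choice is not the
    default value; polarization then determines all products whichever realization was chosen. *)
Lemma tetrahedron_dot r i j k : i != j -> k != i -> k != j ->
  nondegenerate r i j k ->
  forall a b, a \in [set i; j; k] -> b \in [set i; j; k] ->
    dot (row a (tetrahedron p r [set i; j; k])) (row b (tetrahedron p r [set i; j; k]))
    = gram r a b.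
Proof.
move=> ij ki kj [ri rj rk [mij mik mjk D]].
set t := [set i; j; k].
set S := [set q : 'M[R]_(n, 3) |
    (forall i, i \in t -> enorm (row i q) = r ord0 i) /\
    (forall i j, i \in t -> j \in t -> enorm (row i q - row j q) = ell p i j)]%classic.
suff [q Sq] : exists q, S q.
  have [h1 h2] : S (tetrahedron p r t) by apply: (xgetPex 0); exists q.
  move=> a b ta tb; set q' := tetrahedron p r t in h1 h2 *.
  have := sqr_enorm (row a q' - row b q'); rewrite h2//.
  rewrite dotBl !dotBr -!sqr_enorm !h1// (dotC (row b q')) /gram => ->.
  by field.
have [x [y [z [[xx yy zz] [xy xz yz]]]]] : exists x y z : 'rV[R]_3,
    [/\ dot x x = gram r i i, dot y y = gram r j j & dot z z = gram r k k] /\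
    [/\ dot x y = gram r i j, dot x z = gram r i k & dot y z = gram r j k].
  by apply: gram_realization => //; rewrite gramii exprn_gt0.
pose q := \matrix_(l < n) (if l == i then x else if l == j then y else z).
have qi : row i q = x by rewrite rowK eqxx.
have qj : row j q = y by rewrite rowK (negPf (_ : j != i)) ?eqxx// eq_sym.
have qk : row k q = z by rewrite rowK (negPf ki) (negPf kj).
have dq a b : a \in t -> b \in t -> dot (row a q) (row b q) = gram r a b.
  rewrite !inE -!orbA => /or3P[] /eqP-> /or3P[] /eqP->; rewrite ?qi ?qj ?qk//;
  by rewrite dotC gramC.
exists q; split=> [a ta|a b ta tb].
  apply: enorm_sqr; last by rewrite dq// gramii.
  by move: ta; rewrite !inE -!orbA => /or3P[] /eqP->; rewrite ltW.
apply: enorm_sqr; first exact: enorm_ge0.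
by rewrite dotBl !dotBr !dq// -(edge_sqr r) (gramC r b a); ring.
Qed.

Lemma dihedral_lateral r i j k : i != j -> k != i -> k != j ->
  nondegenerate r i j k -> let q := tetrahedron p r [set i; j; k] in
  dihedral 0 (row i q) (row j q) (row k q) = lateral_angle i j k r.
Proof.
move=> ij ki kj nd q.
have dq : forall a b, a \in [set i; j; k] -> b \in [set i; j; k] ->
    dot (row a q) (row b q) = gram r a b by exact: tetrahedron_dot.
have [it jt kt] : [/\ i \in [set i; j; k], j \in [set i; j; k] & k \in [set i; j; k]].
  by rewrite !inE !eqxx !orbT.
rewrite dihedralE; last first.
  by rewrite -dotxx_gt0 dq// gramii exprn_gt0//; case: nd.
rewrite !subr0 !dq// /lateral_angle /minor2 /cof (gramC r j i) (gramC r k i).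
by congr cofactor_angle; ring.
Qed.

Lemma dihedral_base r i j k : p i != p j -> i != j -> k != i -> k != j ->
  nondegenerate r i j k -> let q := tetrahedron p r [set i; j; k] in
  dihedral (row i q) (row j q) (row k q) 0 = base_angle i j k r.
Proof.
move=> pij ij ki kj nd q.
have dq : forall a b, a \in [set i; j; k] -> b \in [set i; j; k] ->
    dot (row a q) (row b q) = gram r a b by exact: tetrahedron_dot.
have [it jt kt] : [/\ i \in [set i; j; k], j \in [set i; j; k] & k \in [set i; j; k]].
  by rewrite !inE !eqxx !orbT.
rewrite dihedralE; last first.
  rewrite -subr_eq0 -dotxx_gt0 dotBl !dotBr !dq//.
  rewrite (_ : _ - _ = gram r i i + gram r j j - 2 * gram r i j).
    by rewrite edge_sqr exprn_gt0// enorm_gt0 subr_eq0.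
  by rewrite (gramC r j i); ring.
rewrite !sub0r !dotBl !dotBr !dotNl !dotNr !dq//.
rewrite /base_angle /base_minor /base_cof /minor2 /cof.
rewrite (gramC r j i) (gramC r k i) (gramC r k j).
move: (gram r i i) (gram r j j) (gram r k k) (gram r i j) (gram r i k) (gram r j k) => a b c d e f.
by congr cofactor_angle; ring.
Qed.

End gram.

Lemma derive_partials (R : realType) (n : nat) (f : 'rV[R]_n -> R) (x v : 'rV[R]_n) :
  differentiable f x -> 'D_v f x = \sum_l v ord0 l * partial l f x.
Proof.
move=> df; rewrite deriveE// [in LHS](row_sum_delta v) linear_sum.
by apply: eq_bigr => l _; rewrite linearZ /partial deriveE.
Qed.

Lemma differentiable_sqr (R : realType) (V : normedModType R) (f : V -> R) (x : V) :
  differentiable f x -> differentiable (fun y => f y ^+ 2) x.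
Proof. by move=> df; exact: (differentiableM df df). Qed.

(** * Derivatives of the cofactors and of the dihedral angles *)

Section gram_derivatives.
Context {R : realType} {n : nat} (p : 'I_n -> 'rV[R]_3).
Hypothesis p_inj : injective p.
Implicit Types (r v : 'rV[R]_n) (i j k : 'I_n).
Local Notation gram := (gram p).
Local Notation minor2 := (minor2 p).
Local Notation cof := (cof p).
Local Notation gram_det := (gram_det p).
Local Notation base_minor := (base_minor p).
Local Notation base_cof := (base_cof p).

Lemma is_derive_coord r v i : is_derive r v (fun r : 'rV[R]_n => r ord0 i : R) (v ord0 i).
Proof.
apply: is_derive_lineP.
rewrite (_ : (fun s : R => _) = cst (r ord0 i) + (fun s : R => s * v ord0 i)).
  have : is_derive (0 : R) (1 : R) (fun s : R => s * v ord0 i) (v ord0 i).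
    have -> : (fun s : R => s * v ord0 i) = (id : R -> R) * cst (v ord0 i) by [].
    apply: is_derive_eq.
    by rewrite /GRing.scale /= mul0r add0r mulr1.
  move=> h; apply: (is_derive_eq (is_deriveD (is_derive_cst _ _ _) h)).
  by rewrite add0r.
by apply/funext => s; rewrite !mxE.
Qed.

Definition dgram r v i j : R := r ord0 i * v ord0 i + r ord0 j * v ord0 j.

Lemma is_derive_gram r v i j : is_derive r v (fun r => gram r i j) (dgram r v i j).
Proof.
have hi := is_derive_coord r v i; have hj := is_derive_coord r v j.
have h := is_deriveM (is_deriveB (is_deriveD (is_deriveM hi hi) (is_deriveM hj hj))
  (is_derive_cst (ell p i j ^+ 2) r v)) (is_derive_cst (2^-1 : R) r v).
apply: (is_derive_eq h).
by rewrite /dgram /GRing.scale /=; field.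
Qed.

Definition dminor2 r v i j : R :=
  dgram r v i i * gram r j j + gram r i i * dgram r v j j - 2 * gram r i j * dgram r v i j.

Lemma is_derive_minor2 r v i j : is_derive r v (fun r => minor2 r i j) (dminor2 r v i j).
Proof.
have hii := is_derive_gram r v i i; have hjj := is_derive_gram r v j j.
have hij := is_derive_gram r v i j.
apply: (is_derive_eq (is_deriveB (is_deriveM hii hjj) (is_deriveM hij hij))).
by rewrite /dminor2 /GRing.scale /=; ring.
Qed.

Definition dcof r v i j k : R :=
  dgram r v i j * gram r i k + gram r i j * dgram r v i k
  - dgram r v j k * gram r i i - gram r j k * dgram r v i i.

Lemma is_derive_cof r v i j k : is_derive r v (fun r => cof r i j k) (dcof r v i j k).
Proof.
have hij := is_derive_gram r v i j; have hik := is_derive_gram r v i k.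
have hjk := is_derive_gram r v j k; have hii := is_derive_gram r v i i.
apply: (is_derive_eq (is_deriveB (is_deriveM hij hik) (is_deriveM hjk hii))).
by rewrite /dcof /GRing.scale /=; ring.
Qed.

Definition dbase_cof r v i j k : R := - (dminor2 r v i j + dcof r v i j k + dcof r v j i k).

Lemma is_derive_base_cof r v i j k :
  is_derive r v (fun r => base_cof r i j k) (dbase_cof r v i j k).
Proof.
exact: (is_deriveN (is_deriveD (is_deriveD (is_derive_minor2 r v i j)
  (is_derive_cof r v i j k)) (is_derive_cof r v j i k))).
Qed.

Definition dbase_minor r v i j k : R :=
  dminor2 r v i j + dminor2 r v i k + dminor2 r v j k
  + 2 * (dcof r v i j k + dcof r v j i k + dcof r v k i j).

Lemma is_derive_base_minor r v i j k :
  is_derive r v (fun r => base_minor r i j k) (dbase_minor r v i j k).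
Proof.
have h := is_deriveM (is_derive_cst (2 : R) r v) (is_deriveD (is_deriveD (is_derive_cof r v i j k)
  (is_derive_cof r v j i k)) (is_derive_cof r v k i j)).
apply: (is_derive_eq (is_deriveD (is_deriveD (is_deriveD (is_derive_minor2 r v i j)
  (is_derive_minor2 r v i k)) (is_derive_minor2 r v j k)) h)).
by rewrite /dbase_minor /GRing.scale /= mulr0 addr0.
Qed.

Lemma differentiable_gram r i j : differentiable (fun r => gram r i j) r.
Proof.
have hi := differentiable_coord r ord0 i; have hj := differentiable_coord r ord0 j.
apply: differentiableM => //; apply: differentiableB => //.
by apply: differentiableD; exact: differentiable_sqr.
Qed.

Lemma differentiable_minor2 r i j : differentiable (fun r => minor2 r i j) r.
Proof.
have h a b := differentiable_gram r a b.
apply: differentiableB; [exact: differentiableM|].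
exact: differentiable_sqr.
Qed.

Lemma differentiable_cof r i j k : differentiable (fun r => cof r i j k) r.
Proof.
have h a b := differentiable_gram r a b.
by apply: differentiableB; apply: differentiableM.
Qed.

Lemma differentiable_base_cof r i j k : differentiable (fun r => base_cof r i j k) r.
Proof.
apply: differentiableN; apply: differentiableD; last exact: differentiable_cof.
by apply: differentiableD; [exact: differentiable_minor2|exact: differentiable_cof].
Qed.

Lemma differentiable_base_minor r i j k : differentiable (fun r => base_minor r i j k) r.
Proof.
apply: differentiableD.
  apply: differentiableD; last exact: differentiable_minor2.
  by apply: differentiableD; exact: differentiable_minor2.
apply: differentiableM; first exact: differentiable_cst.
apply: differentiableD; last exact: differentiable_cof.
by apply: differentiableD; exact: differentiable_cof.
Qed.

Lemma differentiable_gram_det r i j k : differentiable (fun r => gram_det r i j k) r.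
Proof.
have h a b := differentiable_gram r a b.
have h2 a b : differentiable (fun r => gram r a b ^+ 2) r.
  exact: differentiable_sqr.
apply: differentiableB; last exact: differentiableM.
apply: differentiableB; last exact: differentiableM.
apply: differentiableB; last exact: differentiableM.
apply: differentiableD; first by apply: differentiableM => //; exact: differentiableM.
by apply: differentiableM => //; apply: differentiableM => //; exact: differentiableM.
Qed.

Section nondegenerate.
Variables (r : 'rV[R]_n) (i j k : 'I_n).
Hypothesis nd : nondegenerate p r i j k.

Let det0 : 0 < gram_det r i j k. Proof. by case: nd => _ _ _ []. Qed.
Let gii : 0 < gram r i i. Proof. by rewrite gramii exprn_gt0//; case: nd. Qed.
Let m0 : 0 < minor2 r i j. Proof. by case: nd => _ _ _ []. Qed.

Let lat0 : cof r i j k ^+ 2 < minor2 r i j * minor2 r i k.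
Proof. by rewrite -subr_gt0 lateral_sub mulr_gt0. Qed.

Lemma lateral_sqrt : Num.sqrt (minor2 r i j * minor2 r i k - cof r i j k ^+ 2) =
  Num.sqrt (gram_det r i j k) * r ord0 i.
Proof.
rewrite lateral_sub gramii sqrtrM; last exact: ltW.
by rewrite sqrtr_sqr gtr0_norm//; case: nd.
Qed.

Lemma differentiable_lateral_angle : differentiable (lateral_angle p i j k) r.
Proof.
case: nd => _ _ _ [mij mik _ _].
apply: differentiable_cofactor_angle => //; [exact: differentiable_minor2..|].
exact: differentiable_cof.
Qed.

Definition dlateral v : R :=
  (dcof r v i j k - cof r i j k / 2 *
    (dminor2 r v i j / minor2 r i j + dminor2 r v i k / minor2 r i k))
  / Num.sqrt (gram_det r i j k) / r ord0 i.

Lemma is_derive_lateral_angle v : is_derive r v (lateral_angle p i j k) (dlateral v).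
Proof.
case: (nd) => _ _ _ [mij mik _ _].
have h := @is_derive_cofactor_angle _ _ (fun r => minor2 r i j) (fun r => minor2 r i k)
  (fun r => cof r i j k) r mij mik lat0 v _ _ _ (is_derive_minor2 r v i j)
  (is_derive_minor2 r v i k) (is_derive_cof r v i j k).
apply: (@is_derive_eq _ _ _ (lateral_angle p i j k) _ _ _ _ h).
by rewrite lateral_sqrt invfM mulrA.
Qed.

Hypothesis ij : i != j.

Let ell0 : 0 < ell p i j.
Proof. by rewrite enorm_gt0 subr_eq0 (inj_eq p_inj). Qed.

Let base0 : base_cof r i j k ^+ 2 < base_minor r i j k * minor2 r i j.
Proof. by rewrite -subr_gt0 base_sub mulr_gt0// exprn_gt0. Qed.

Lemma base_minor_gt0 : 0 < base_minor r i j k.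
Proof.
by rewrite -(pmulr_lgt0 _ m0); apply: le_lt_trans base0; exact: sqr_ge0.
Qed.

Lemma differentiable_base_angle : differentiable (base_angle p i j k) r.
Proof.
apply: differentiable_cofactor_angle => //; first exact: base_minor_gt0.
- exact: differentiable_base_minor.
- exact: differentiable_minor2.
- exact: differentiable_base_cof.
Qed.

Definition dbase v : R :=
  (dbase_cof r v i j k - base_cof r i j k / 2 *
    (dbase_minor r v i j k / base_minor r i j k + dminor2 r v i j / minor2 r i j))
  / Num.sqrt (gram_det r i j k) / ell p i j.

Lemma is_derive_base_angle v : is_derive r v (base_angle p i j k) (dbase v).
Proof.
have h := @is_derive_cofactor_angle _ _ (fun r => base_minor r i j k)
  (fun r => minor2 r i j) (fun r => base_cof r i j k) r base_minor_gt0 m0 base0 v _ _ _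
  (is_derive_base_minor r v i j k) (is_derive_minor2 r v i j) (is_derive_base_cof r v i j k).
apply: (@is_derive_eq _ _ _ (base_angle p i j k) _ _ _ _ h).
rewrite base_sub sqrtrM; last exact: ltW.
by rewrite sqrtr_sqr gtr0_norm// invfM mulrA.
Qed.

End nondegenerate.
End gram_derivatives.

(** * Derivatives of the Hilbert-Einstein functional *)

Section schlaefli.
Local Open Scope set_scope.
Context {R : realType} {n : nat} (p : 'I_n -> 'rV[R]_3).
Hypothesis p_inj : injective p.
Implicit Types (r v : 'rV[R]_n) (i j k : 'I_n) (t : {set 'I_n}).
Local Notation gram := (gram p).
Local Notation minor2 := (minor2 p).
Local Notation cof := (cof p).
Local Notation gram_det := (gram_det p).
Local Notation base_minor := (base_minor p).
Local Notation base_cof := (base_cof p).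

Lemma gram_detC r i j k : gram_det r j i k = gram_det r i j k.
Proof.
rewrite /gram_det (gramC p r j i).
move: (gram r i i) (gram r j j) (gram r k k) (gram r i j) (gram r i k) (gram r j k) => a b c d e f.
by ring.
Qed.

Lemma gram_detA r i j k : gram_det r j k i = gram_det r i j k.
Proof.
rewrite /gram_det (gramC p r j i) (gramC p r k i).
move: (gram r i i) (gram r j j) (gram r k k) (gram r i j) (gram r i k) (gram r j k) => a b c d e f.
by ring.
Qed.

Lemma dgramC r v i j : dgram r v i j = dgram r v j i.
Proof. exact: addrC. Qed.

Lemma dminor2C r v i j : dminor2 p r v i j = dminor2 p r v j i.
Proof. by rewrite /dminor2 gramC dgramC; ring. Qed.

Lemma dcofC r v i j k : dcof p r v i j k = dcof p r v i k j.
Proof. by rewrite /dcof (gramC p r j k) (dgramC r v j k); ring. Qed.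

(** Multiplied by the length of its edge, each of the six derivatives is a rational expression over
    the same root [Num.sqrt (gram_det p r i j k)]. The numerators cancel identically, even with the
    cofactors and their derivatives regarded as independent variables. *)
Lemma schlaefli r v i j k : i != j -> k != i -> k != j -> nondegenerate p r i j k ->
  r ord0 i * dlateral p r i j k v + r ord0 j * dlateral p r j i k v
  + r ord0 k * dlateral p r k i j v + ell p i j * dbase p r i j k v
  + ell p i k * dbase p r i k j v + ell p j k * dbase p r j k i v = 0.
Proof.
move=> ij ki kj nd.
have [ri rj rk [mij mik mjk D0]] := nd.
have M0 := base_minor_gt0 p_inj nd ij.
have e0 a b : a != b -> ell p a b != 0.
  by move=> ab; rewrite gt_eqF// enorm_gt0 subr_eq0 (inj_eq p_inj).
have canc (a b c : R) : a != 0 -> a * (b / c / a) = b / c.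
  by move=> a0; rewrite mulrC divfK.
have [nri nrj nrk] : [/\ r ord0 i != 0, r ord0 j != 0 & r ord0 k != 0] by rewrite !gt_eqF.
have [eij eik ejk] : [/\ ell p i j != 0, ell p i k != 0 & ell p j k != 0].
  by split; apply: e0 => //; rewrite eq_sym.
have D1 := gram_detC r i j k.
have D2 : gram_det r k i j = gram_det r i j k by rewrite -[LHS]gram_detA gram_detA.
have D3 : gram_det r i k j = gram_det r i j k by rewrite -[LHS]gram_detC.
have D4 := gram_detA r i j k.
rewrite /dlateral /dbase !canc// D1 D2 D3 D4 -!mulrDl.
set X := (X in X / _).
suff -> : X = 0 by rewrite mul0r.
rewrite {}/X /dbase_cof /dbase_minor /base_cof.
have -> : base_minor r i k j = base_minor r i j k.
  by rewrite /base_minor (minor2C p r k j) (cofC p r i k j); ring.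
have -> : base_minor r j k i = base_minor r i j k.
  by rewrite /base_minor (minor2C p r j i) (minor2C p r k i) (cofC p r j k i) (cofC p r k j i); ring.
rewrite (minor2C p r j i) (minor2C p r k i) (minor2C p r k j) (cofC p r i k j) (cofC p r j k i) (cofC p r k j i).
rewrite (dminor2C r v j i) (dminor2C r v k i) (dminor2C r v k j) (dcofC r v i k j) (dcofC r v j k i) (dcofC r v k j i).
move: M0 mij mik mjk; rewrite /base_minor.
move: (minor2 r i j) (minor2 r i k) (minor2 r j k) (cof r i j k) (cof r j i k) (cof r k i j).
move: (dminor2 p r v i j) (dminor2 p r v i k) (dminor2 p r v j k) (dcof p r v i j k)
  (dcof p r v j i k) (dcof p r v k i j).
move=> dx dy dz da db dc x y z a b c M0 x0 y0 z0.
by field; rewrite !gt_eqF.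
Qed.

Lemma dlateral_far r v i j k : v ord0 i = 0 -> v ord0 j = 0 -> v ord0 k = 0 ->
  dlateral p r i j k v = 0.
Proof.
move=> vi vj vk; rewrite /dlateral /dcof /dminor2 /dgram vi vj vk.
by rewrite !(mulr0, mul0r, addr0, subr0).
Qed.

(** With only [r_j] varying, [minor2 r i k] is constant and drops out of the result. What remains is
    symmetric in [i] and [j], unlike the angle itself, which sits at the edge of [i]. *)
Lemma dlateral_delta r i j k : i != j -> k != i -> k != j -> nondegenerate p r i j k ->
  dlateral p r i j k (delta_mx ord0 j) =
  r ord0 i * r ord0 j * base_cof r i j k / (Num.sqrt (gram_det r i j k) * minor2 r i j).
Proof.
move=> ij ki kj [ri rj rk [mij mik mjk D0]].
have dE a b : dgram r (delta_mx ord0 j) a b =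
    (if a == j then r ord0 j else 0) + (if b == j then r ord0 j else 0).
  rewrite /dgram !mxE /=; congr (_ + _); case: eqP => [->|_]; rewrite ?mulr1 ?mulr0//.
have S0 : 0 < Num.sqrt (gram_det r i j k) by rewrite sqrtr_gt0.
rewrite /dlateral /dcof /dminor2 !dE eqxx (negPf ij) (negPf kj) /base_cof.
move: mij mik S0; rewrite /minor2 /cof.
rewrite (gramC p r j i) !gramii.
move: (Num.sqrt _) (gram r i j) (gram r i k) (gram r j k) ri rj rk.
move: (r ord0 i) (r ord0 j) (r ord0 k).
move=> a b c S d e f a0 b0 c0 m0 m1 S0.
rewrite !(add0r, addr0, mul0r, mulr0, subr0).
have [na nS nm] : [/\ a != 0, S != 0 & a ^+ 2 * b ^+ 2 - d ^+ 2 != 0] by rewrite !gt_eqF.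
by field; rewrite !exprMn nS na nm gt_eqF.
Qed.

(** The direction is, up to sign, the velocity of the lateral lengths at [i], [j], [k], scaled by
    [r_i], when the apex moves with unit speed along the edge towards the vertex [i]. The planes of
    the two faces at this edge stay fixed, hence so does the angle. *)
Lemma dlateral_axial r i j k : (forall l, 0 < r ord0 l) -> nondegenerate p r i j k ->
  dlateral p r i j k (\row_l (gram r i l / r ord0 l)) = 0.
Proof.
move=> r0 [_ _ _ [mij mik mjk D0]].
have dE a b : dgram r (\row_l (gram r i l / r ord0 l)) a b = gram r i a + gram r i b.
  by rewrite /dgram !mxE !(mulrC (r ord0 _)) !divfK// gt_eqF.
rewrite /dlateral; suff -> : dcof p r (\row_l (gram r i l / r ord0 l)) i j k - cof r i j k / 2 *
    (dminor2 p r (\row_l (gram r i l / r ord0 l)) i j / minor2 r i j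
    + dminor2 p r (\row_l (gram r i l / r ord0 l)) i k / minor2 r i k) = 0.
  by rewrite !mul0r.
rewrite /dcof /dminor2 !dE; move: mij mik; rewrite /minor2 /cof => mij mik.
by field; rewrite !gt_eqF.
Qed.

End schlaefli.

(** * Summation over the tetrahedra of the warped polyhedron *)

Section HE_derivatives.
Local Open Scope set_scope.
Context {R : realType} {n : nat} (p : 'I_n -> 'rV[R]_3) (T : {set {set 'I_n}}).
Hypothesis p_inj : injective p.
Hypothesis T3 : forall t, t \in T -> #|t| = 3%N.
Implicit Types (r v : 'rV[R]_n) (i j k : 'I_n) (t : {set 'I_n}).

Definition all_nondegenerate r : Prop := forall i j k, [set i; j; k] \in T ->
  i != j -> k != i -> k != j -> nondegenerate p r i j k.

(** Chosen tetrahedra need not depend continuously on [r]. This explicit sum agrees with [omega]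
    wherever all tetrahedra are nondegenerate, which is an open condition, so the derivatives agree
    there as well. *)
Definition omega_gram i r : R :=
  \sum_(t in T | i \in t) \sum_(j in t :\ i) \sum_(k in t :\ i | (j < k)%N)
    lateral_angle p i j k r.

Definition theta_gram i j r : R :=
  \sum_(t in T | (i \in t) && (j \in t)) \sum_(k in t :\ i :\ j) base_angle p i j k r.

Lemma triangle_nondegenerate r t i j k : all_nondegenerate r -> t \in T ->
  i \in t -> j \in t -> k \in t -> i != j -> k != i -> k != j ->
  t = [set i; j; k] /\ nondegenerate p r i j k.
Proof.
move=> gr tT it jt kt ij ki kj.
have [l tE [li lj lt]] := triangleP (T3 tT) it jt ij.
move: kt; rewrite tE !inE (negPf ki) (negPf kj) /= => /eqP ->.
by split=> //; apply: gr => //; rewrite -tE.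
Qed.

Lemma omegaE r i : all_nondegenerate r -> omega p T r i = omega_gram i r.
Proof.
move=> gr; apply: eq_bigr => t /andP[tT it].
apply: eq_bigr => j; rewrite !inE => /andP[ji jt].
apply: eq_bigr => k; rewrite !inE => /andP[/andP[ki kt] jk].
have kj : k != j by apply: contraTneq jk => ->; rewrite ltnn.
have ij : i != j by rewrite eq_sym.
have [tE nd] := triangle_nondegenerate gr tT it jt kt ij ki kj.
by rewrite tE dihedral_lateral.
Qed.

Lemma thetaE r i j : all_nondegenerate r -> i != j -> theta p T r i j = theta_gram i j r.
Proof.
move=> gr ij; apply: eq_bigr => t /and3P[tT it jt].
apply: eq_bigr => k; rewrite !inE => /and3P[kj ki kt].
have [tE nd] := triangle_nondegenerate gr tT it jt kt ij ki kj.
by rewrite tE dihedral_base// (inj_eq p_inj).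
Qed.

Definition kappa_gram i r : R := 2 * pi - omega_gram i r.

Definition HE_gram r : R :=
  \sum_i r ord0 i * kappa_gram i r +
  \sum_i \sum_(j | is_edge T i j && (i < j)%N) ell p i j * (pi - theta_gram i j r).

Lemma HEE r : all_nondegenerate r -> HE p T r = HE_gram r.
Proof.
move=> gr; congr (_ + _).
  by apply: eq_bigr => i _; rewrite /kappa omegaE.
apply: eq_bigr => i _; apply: eq_bigr => j /andP[/andP[ij _] _].
by rewrite /lambda thetaE.
Qed.

Lemma all_nondegenerate_near r : all_nondegenerate r ->
  \forall s \near r, all_nondegenerate s.
Proof.
move=> gr; have nF : Filter (nbhs r) by exact: nbhs_filter.
have pos (f : 'rV[R]_n -> R) : differentiable f r -> 0 < f r -> \forall s \near r, 0 < f s.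
  move=> /differentiable_continuous cf f0.
  exact: (@cvgr_gt _ _ _ nF f _ cf 0 f0).
have : \forall s \near r, forall x : 'I_n * 'I_n * 'I_n,
    [set x.1.1; x.1.2; x.2] \in T -> x.1.1 != x.1.2 -> x.2 != x.1.1 -> x.2 != x.1.2 ->
    nondegenerate p s x.1.1 x.1.2 x.2.
  apply: (@filter_forall _ _ (fun x s => [set x.1.1; x.1.2; x.2] \in T -> x.1.1 != x.1.2 ->
    x.2 != x.1.1 -> x.2 != x.1.2 -> nondegenerate p s x.1.1 x.1.2 x.2) _ nF) => -[[i j] k] /=.
  case: (boolP ([set i; j; k] \in T)) => tT; last by near=> s.
  case: (eqVneq i j) => ij; first by near=> s.
  case: (eqVneq k i) => ki; first by near=> s.
  case: (eqVneq k j) => kj; first by near=> s.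
  have [ri rj rk [mij mik mjk D0]] := gr i j k tT ij ki kj.
  near=> s => _ _ _ _; split; [near: s..|split; near: s].
  - by apply: pos => //; exact: differentiable_coord.
  - by apply: pos => //; exact: differentiable_coord.
  - by apply: pos => //; exact: differentiable_coord.
  - by apply: pos => //; exact: differentiable_minor2.
  - by apply: pos => //; exact: differentiable_minor2.
  - by apply: pos => //; exact: differentiable_minor2.
  - by apply: pos => //; exact: differentiable_gram_det.
by apply: filterS => s h i j k; exact: (h (i, j, k)).
Unshelve. all: by end_near.
Qed.

Lemma differentiable_omega_gram r i : all_nondegenerate r ->
  differentiable (omega_gram i) r.
Proof.
move=> gr; apply: differentiable_bigsum => t /andP[tT it].
apply: differentiable_bigsum => j; rewrite !inE => /andP[ji jt].
apply: differentiable_bigsum => k; rewrite !inE => /andP[/andP[ki kt] jk].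
have kj : k != j by apply: contraTneq jk => ->; rewrite ltnn.
have ij : i != j by rewrite eq_sym.
by have [_ nd] := triangle_nondegenerate gr tT it jt kt ij ki kj; exact: differentiable_lateral_angle.
Qed.

Lemma differentiable_theta_gram r i j : all_nondegenerate r -> i != j ->
  differentiable (theta_gram i j) r.
Proof.
move=> gr ij; apply: differentiable_bigsum => t /and3P[tT it jt].
apply: differentiable_bigsum => k; rewrite !inE => /and3P[kj ki kt].
by have [_ nd] := triangle_nondegenerate gr tT it jt kt ij ki kj; exact: differentiable_base_angle.
Qed.

Lemma differentiable_kappa_gram r i : all_nondegenerate r -> differentiable (kappa_gram i) r.
Proof.
move=> gr; apply: differentiableB; first exact: differentiable_cst.
exact: differentiable_omega_gram.
Qed.

Lemma differentiable_HE_gram r : all_nondegenerate r -> differentiable HE_gram r.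
Proof.
move=> gr; apply: differentiableD.
  apply: differentiable_bigsum => i _; apply: differentiableM; first exact: differentiable_coord.
  exact: differentiable_kappa_gram.
apply: differentiable_bigsum => i _; apply: differentiable_bigsum => j /andP[/andP[ij _] _].
apply: differentiableM; first exact: differentiable_cst.
apply: differentiableB; first exact: differentiable_cst.
exact: differentiable_theta_gram.
Qed.

Definition domega r v i : R :=
  \sum_(t in T | i \in t) \sum_(j in t :\ i) \sum_(k in t :\ i | (j < k)%N)
    dlateral p r i j k v.

Definition dtheta r v i j : R :=
  \sum_(t in T | (i \in t) && (j \in t)) \sum_(k in t :\ i :\ j) dbase p r i j k v.

Lemma is_derive_omega_gram r v i : all_nondegenerate r ->
  is_derive r v (omega_gram i) (domega r v i).
Proof.
move=> gr; apply: is_derive_bigsum => t /andP[tT it].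
apply: is_derive_bigsum => j; rewrite !inE => /andP[ji jt].
apply: is_derive_bigsum => k; rewrite !inE => /andP[/andP[ki kt] jk].
have kj : k != j by apply: contraTneq jk => ->; rewrite ltnn.
have ij : i != j by rewrite eq_sym.
by have [_ nd] := triangle_nondegenerate gr tT it jt kt ij ki kj; exact: is_derive_lateral_angle.
Qed.

Lemma is_derive_theta_gram r v i j : all_nondegenerate r -> i != j ->
  is_derive r v (theta_gram i j) (dtheta r v i j).
Proof.
move=> gr ij; apply: is_derive_bigsum => t /and3P[tT it jt].
apply: is_derive_bigsum => k; rewrite !inE => /and3P[kj ki kt].
by have [_ nd] := triangle_nondegenerate gr tT it jt kt ij ki kj; exact: is_derive_base_angle.
Qed.

Lemma is_derive_kappa_gram r v i : all_nondegenerate r ->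
  is_derive r v (kappa_gram i) (- domega r v i).
Proof.
move=> gr; apply: (is_derive_eq (is_deriveB (is_derive_cst (2 * pi : R) r v)
  (is_derive_omega_gram v i gr))).
by rewrite sub0r.
Qed.

Lemma dlateralC r v i j k : dlateral p r i j k v = dlateral p r i k j v.
Proof.
rewrite /dlateral (dcofC p r v i k j) (cofC p r i k j).
rewrite (_ : gram_det p r i k j = gram_det p r i j k); last first.
  by rewrite -(gram_detA p r i k j) gram_detC gram_detA.
by rewrite [dminor2 p r v i k / _ + _]addrC.
Qed.

Lemma dbaseC r v i j k : dbase p r i j k v = dbase p r j i k v.
Proof.
rewrite /dbase /dbase_cof /dbase_minor (base_cofC p r i j k) (base_minorC p r i j k).
rewrite (minor2C p r i j) (dminor2C p r v i j) (gram_detC p r j i k) (ellC p i j).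
rewrite (dcofC p r v k i j).
congr ((_ - _ * (_ / _ + _)) / _ / _); first by rewrite addrAC.
by rewrite [dminor2 p r v j i + _ + _]addrAC [dcof p r v i j k + _]addrC.
Qed.

Lemma triangle_triple t : t \in T ->
  exists i j k, [/\ t = [set i; j; k], i != j, k != i & k != j].
Proof.
move=> tT; have /card_gt1P[i [j [it jt ij]]] : (1 < #|t|)%N by rewrite T3.
by have [k tE [ki kj _]] := triangleP (T3 tT) it jt ij; exists i, j, k.
Qed.

(** Exchanging the sums groups the terms by tetrahedron, and each group vanishes by [schlaefli]. The
    conditions [j < k] and [i < j] only select one representative of each unordered pair. *)
Lemma schlaefli_sum r v : all_nondegenerate r ->
  \sum_i r ord0 i * domega r v i +
  \sum_i \sum_(j | is_edge T i j && (i < j)%N) ell p i j * dtheta r v i j = 0.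
Proof.
move=> gr.
under eq_bigr do rewrite /domega mulr_sumr.
rewrite (exchange_big_dep (mem T)) /=; last by move=> i t _ /andP[].
rewrite [X in _ + X](_ : _ = \sum_(t in T) \sum_(i in t) \sum_(j in t | (i < j)%N)
    ell p i j * \sum_(k in t :\ i :\ j) dbase p r i j k v).
  rewrite -big_split big1 // => t tT /=.
  have [i [j [k [tE ij ki kj]]]] := triangle_triple tT.
  have nd : nondegenerate p r i j k by apply: gr => //; rewrite -tE.
  have [ti tj tk] : [/\ t :\ i = [set j; k], t :\ j = [set i; k] & t :\ k = [set i; j]].
    split; apply/setP => l; rewrite tE !inE.
    - have [->|li] := eqVneq l i; last by [].
      by rewrite (negPf ij) eq_sym (negPf ki).
    - have [->|lj] := eqVneq l j; last by rewrite orbF.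
      by rewrite eq_sym (negPf ij) eq_sym (negPf kj).
    - have [->|lk] := eqVneq l k; last by rewrite orbF.
      by rewrite (negPf ki) (negPf kj).
  have S1 (G : 'I_n -> R) : \sum_(a in t) G a = G i + G j + G k.
    rewrite tE finset.setUC big_setU1 /= ?inE ?negb_or ?ki// big_setU1 /= ?inE// big_set1.
    by rewrite addrC.
  rewrite (eq_bigl (mem t)) /=; last by move=> a; rewrite tT.
  rewrite S1 ti tj tk !sum_pair_lt 1?eq_sym//; try exact: dlateralC; last by rewrite eq_sym.
  rewrite [X in _ + X](_ : _ = \sum_(a in t) \sum_(b in t | (a < b)%N)
    (fun a b => ell p a b * \sum_(c in t :\ a :\ b) dbase p r a b c v) a b)//.
  rewrite tE sum_triangle_lt//; last first.
    move=> a b; rewrite ellC; congr (_ * _).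
    by apply: eq_big => c; [rewrite !inE andbCA|move=> _; exact: dbaseC].
  have jki : [set i; j; k] :\ j :\ k = [set i].
    by rewrite -tE tj; apply/setP => l; rewrite !inE; have [->|] := eqVneq l k; rewrite ?orbF//= (negPf ki).
  have ikj : [set i; j; k] :\ i :\ k = [set j].
    by rewrite -tE ti; apply/setP => l; rewrite !inE; have [->|] := eqVneq l k; rewrite ?orbF//= (negPf kj).
  rewrite triangleD2// jki ikj !big_set1.
  rewrite -(schlaefli p_inj v ij ki kj nd).
  by rewrite !addrA.
rewrite (eq_bigr (fun i => \sum_(t in T | i \in t) \sum_(j in t | (i < j)%N)
    ell p i j * \sum_(k in t :\ i :\ j) dbase p r i j k v)).
  rewrite (exchange_big_dep (mem T)) /=; last by move=> i t _ /andP[].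
  by apply: eq_bigr => t tT; apply: eq_bigl => i; rewrite tT.
move=> i _; under eq_bigr do rewrite /dtheta mulr_sumr.
rewrite (exchange_big_dep (fun t => (t \in T) && (i \in t))) /=; last first.
  by move=> j t _ /and3P[-> ->].
apply: eq_bigr => t /andP[tT it]; apply: eq_bigl => j.
rewrite tT it /= andbC; case: (boolP (j \in t)) => //= jt.
case: (ltnP i j) => //= ij; rewrite ?andbF// andbT.
rewrite /is_edge; apply/andP; split; first by apply: contraTneq ij => ->; rewrite ltnn.
by apply/existsP; exists t; rewrite tT it jt.
Qed.

Lemma is_derive_HE_gram r v : all_nondegenerate r ->
  is_derive r v HE_gram (\sum_i v ord0 i * kappa_gram i r).
Proof.
move=> gr.
have h1 : is_derive r v (fun r : 'rV[R]_n => \sum_i r ord0 i * kappa_gram i r)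
    (\sum_i (r ord0 i *: - domega r v i + kappa_gram i r *: v ord0 i)).
  apply: is_derive_bigsum => i _.
  exact: (is_deriveM (is_derive_coord r v i) (is_derive_kappa_gram v i gr)).
have h2 : is_derive r v (fun r : 'rV[R]_n =>
      \sum_i \sum_(j | is_edge T i j && (i < j)%N) ell p i j * (pi - theta_gram i j r))
    (\sum_i \sum_(j | is_edge T i j && (i < j)%N) (ell p i j * (- dtheta r v i j))).
  apply: is_derive_bigsum => i _; apply: is_derive_bigsum => j /andP[/andP[ij _] _].
  have h := is_deriveM (is_derive_cst (ell p i j) r v)
    (is_deriveB (is_derive_cst (pi : R) r v) (is_derive_theta_gram v gr ij)).
  apply: (is_derive_eq h).
  by rewrite /GRing.scale /= mulr0 addr0 sub0r.
apply: (is_derive_eq (is_deriveD h1 h2)).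
rewrite big_split /= -addrA [X in _ + X]addrC addrA.
have := schlaefli_sum v gr.
under [X in _ -> _ + X + _ = _]eq_bigr do under eq_bigr do rewrite mulrN.
under [X in _ -> _ + X + _ = _]eq_bigr do rewrite sumrN.
under [X in _ -> X + _ + _ = _]eq_bigr do rewrite /GRing.scale /= mulrN.
rewrite !sumrN -opprD => ->; rewrite oppr0 add0r.
by apply: eq_bigr => i _; rewrite /GRing.scale /= mulrC.
Qed.

Lemma partial_HE_gram r i : all_nondegenerate r -> partial i HE_gram r = kappa_gram i r.
Proof.
move=> gr; rewrite /partial; have [_ ->] := is_derive_HE_gram (delta_mx ord0 i) gr.
rewrite (bigD1 i) //= mxE !eqxx mul1r big1 ?addr0// => j ji.
by rewrite mxE (negPf ji) andbF mul0r.
Qed.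

Lemma partial_HE r i : all_nondegenerate r ->
  \forall s \near r, kappa_gram i s = partial i (HE p T) s.
Proof.
move=> gr; have := all_nondegenerate_near gr; apply: filterS => s gs.
rewrite -partial_HE_gram//; apply: near_eq_derive.
by apply: filterS (all_nondegenerate_near gs) => u gu; rewrite HEE.
Qed.

Lemma twice_differentiable_HE r : all_nondegenerate r -> twice_differentiable (HE p T) r.
Proof.
move=> gr; split=> [|i]; last first.
  exact: near_eq_differentiable (partial_HE i gr) (differentiable_kappa_gram i gr).
apply: filterS (all_nondegenerate_near gr) => s gs.
apply: near_eq_differentiable (differentiable_HE_gram gs).
by apply: filterS (all_nondegenerate_near gs) => u gu; rewrite HEE.
Qed.

Lemma partial2_HE r i j : all_nondegenerate r ->
  partial i (partial j (HE p T)) r = - domega r (delta_mx ord0 i) j.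
Proof.
move=> gr; have [_ <-] := is_derive_kappa_gram (delta_mx ord0 i) j gr.
by apply/esym/near_eq_derive; exact: partial_HE.
Qed.

Lemma partial2_HE_offdiag r i j : all_nondegenerate r -> j != i ->
  partial i (partial j (HE p T)) r =
  - \sum_(t in T | (j \in t) && (i \in t)) \sum_(k in t :\ j :\ i)
     r ord0 j * r ord0 i * base_cof p r j i k /
     (Num.sqrt (gram_det p r j i k) * minor2 p r j i).
Proof.
move=> gr ji; rewrite partial2_HE// /domega; congr (- _).
rewrite [RHS](eq_bigl (fun t => (t \in T) && (j \in t) && (i \in t))); last by move=> t; rewrite andbA.
rewrite [RHS]big_mkcondr; apply: eq_bigr => t /andP[tT jt].
(* The angles of a tetrahedron that does not contain the vertex [i] do not involve [r_i]. *)
case: ifPn => it; last first.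
  rewrite big1 // => a; rewrite !inE => /andP[aj at_].
  rewrite big1 // => b; rewrite !inE => /andP[/andP[bj bt] ab].
  have ne c : c \in t -> (delta_mx ord0 i : 'rV[R]_n) ord0 c = 0.
    move=> ct; rewrite mxE /=; case: eqP => [ci|_]; rewrite ?andbF//.
    by rewrite -ci ct in it.
  by apply: dlateral_far; exact: ne.
have [k tE [kj ki kt]] := triangleP (T3 tT) jt it ji.
have nd : nondegenerate p r j i k by apply: gr => //; rewrite -tE.
rewrite tE triangleD2// big_set1 (_ : [set j; i; k] :\ j = [set i; k]); last first.
  apply/setP => l; rewrite !inE; have [->|lj] := eqVneq l j; last by [].
  by rewrite (negPf ji) eq_sym (negPf kj).
rewrite sum_pair_lt 1?eq_sym//; last exact: dlateralC.
by rewrite dlateral_delta.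
Qed.

Lemma partial2_HE_axial r i : all_nondegenerate r -> (forall l, 0 < r ord0 l) ->
  \sum_l gram p r i l / r ord0 l * partial l (partial i (HE p T)) r = 0.
Proof.
move=> gr r0.
have dk := twice_differentiable_HE gr; have [_ /(_ i) dki] := dk.
pose v : 'rV[R]_n := \row_l (gram p r i l / r ord0 l).
rewrite (eq_bigr (fun l => v ord0 l * partial l (partial i (HE p T)) r)); last first.
  by move=> l _; rewrite mxE.
rewrite -derive_partials//.
have -> : 'D_v (partial i (HE p T)) r = - domega r v i.
  have [_ <-] := is_derive_kappa_gram v i gr.
  by apply/esym/near_eq_derive; exact: partial_HE.
apply/eqP; rewrite oppr_eq0; apply/eqP.
rewrite /domega big1// => t /andP[tT it].
rewrite big1// => j; rewrite !inE => /andP[ji jt].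
rewrite big1// => k; rewrite !inE => /andP[/andP[ki kt] jk].
have kj : k != j by apply: contraTneq jk => ->; rewrite ltnn.
have ij : i != j by rewrite eq_sym.
have [_ nd] := triangle_nondegenerate gr tT it jt kt ij ki kj.
exact: dlateral_axial.
Qed.

End HE_derivatives.

(** * Convex polytopes and their triangulated boundary *)

Section cross.
Context {R : realType}.
Implicit Types x y z w : 'rV[R]_3.

Definition cross x y : 'rV[R]_3 := \row_k
  [:: x ord0 1 * y ord0 2%:R - x ord0 2%:R * y ord0 1;
      x ord0 2%:R * y ord0 0 - x ord0 0 * y ord0 2%:R;
      x ord0 0 * y ord0 1 - x ord0 1 * y ord0 0]`_k.

Definition triple x y z : R := dot (cross x y) z.

Lemma row3P x y : x ord0 0 = y ord0 0 -> x ord0 1 = y ord0 1 ->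
  x ord0 2%:R = y ord0 2%:R -> x = y.
Proof.
move=> h0 h1 h2; apply/rowP => -[[|[|[|//]]] k3].
- by move: h0; congr (x _ _ = y _ _); apply: val_inj.
- by move: h1; congr (x _ _ = y _ _); apply: val_inj.
- by move: h2; congr (x _ _ = y _ _); apply: val_inj.
Qed.

Lemma tripleE x y z : triple x y z =
  x ord0 0 * (y ord0 1 * z ord0 2%:R - y ord0 2%:R * z ord0 1)
  - x ord0 1 * (y ord0 0 * z ord0 2%:R - y ord0 2%:R * z ord0 0)
  + x ord0 2%:R * (y ord0 0 * z ord0 1 - y ord0 1 * z ord0 0).
Proof. by rewrite /triple dotE !mxE /=; ring. Qed.

Lemma tripleA x y z : triple y z x = triple x y z.
Proof. by rewrite !tripleE; ring. Qed.

Lemma triplexx x y : triple x x y = 0.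
Proof. by rewrite tripleE; ring. Qed.

Lemma triplexyx x y : triple x y x = 0.
Proof. by rewrite tripleE; ring. Qed.

Lemma triplexyy x y : triple x y y = 0.
Proof. by rewrite tripleE; ring. Qed.

Lemma crossxx x : cross x x = 0.
Proof. by apply: row3P; rewrite !mxE /=; ring. Qed.

Lemma crossZl (c : R) x y : cross (c *: x) y = c *: cross x y.
Proof. by apply: row3P; rewrite !mxE /=; ring. Qed.

Lemma crossDl x y z : cross (x + y) z = cross x z + cross y z.
Proof. by apply: row3P; rewrite !mxE /=; ring. Qed.

Lemma crossC x y : cross y x = - cross x y.
Proof. by apply: row3P; rewrite !mxE /=; ring. Qed.

Lemma cross0l x : cross 0 x = 0.
Proof. by rewrite -{1}(scale0r (0 : 'rV[R]_3)) crossZl scale0r. Qed.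

Lemma dot_cross x y z w :
  dot (cross x y) (cross z w) = dot x z * dot y w - dot x w * dot y z.
Proof. by rewrite !dotE !mxE /=; ring. Qed.

Lemma cramer x y z w : triple x y z != 0 ->
  w = (triple w y z / triple x y z) *: x + (triple x w z / triple x y z) *: y
    + (triple x y w / triple x y z) *: z.
Proof.
move=> D0; apply: row3P; rewrite !mxE; move: D0; rewrite !tripleE => D0; field; exact: D0.
Qed.

Lemma cross_eq0_trans x y w : x != 0 -> cross x y = 0 -> exists c, y = c *: x.
Proof.
move=> x0 h; exists (dot x y / dot x x).
have : dot x x *: y = dot x y *: x + cross (cross x y) x.
  by apply: row3P; rewrite !mxE /= !dotE; ring.
rewrite h cross0l addr0 => e.
rewrite mulrC -scalerA -e scalerA mulVf ?scale1r// dotxx_eq0//.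
Qed.

Lemma row_free_cross x y : cross x y != 0 -> row_free (col_mx x y).
Proof.
move=> xy0; apply: inj_row_free => w.
rewrite -[w](hsubmxK (w : 'rV_(1 + 1))) mul_row_col => h.
set u := lsubmx _ in h *; set v := rsubmx _ in h *.
have uE : u *m x = u ord0 ord0 *: x.
  by rewrite [u in LHS]mx11_scalar mul_scalar_mx.
have vE : v *m y = v ord0 ord0 *: y.
  by rewrite [v in LHS]mx11_scalar mul_scalar_mx.
rewrite uE vE in h.
have v0 : v ord0 ord0 = 0.
  have : cross x (u ord0 ord0 *: x + v ord0 ord0 *: y) = v ord0 ord0 *: cross x y.
    by apply: row3P; rewrite !mxE /=; ring.
  rewrite h crossC cross0l oppr0 => /esym/eqP.
  by rewrite scaler_eq0 (negPf xy0) orbF => /eqP.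
have u0 : u ord0 ord0 = 0.
  have : cross (u ord0 ord0 *: x + v ord0 ord0 *: y) y = u ord0 ord0 *: cross x y.
    by apply: row3P; rewrite !mxE /=; ring.
  rewrite h cross0l => /esym/eqP.
  by rewrite scaler_eq0 (negPf xy0) orbF => /eqP.
apply/rowP => k; rewrite !mxE; case: splitP => l _; rewrite !ord1 -/u -/v; [exact: u0|exact: v0].
Qed.

End cross.

(** * Small perturbations into general position *)

Section generic_vectors.
Context {R : realType}.

(** The [size q] points [e / 2], [e / 3], ... are too many to be roots. *)
Lemma small_non_root (q : {poly R}) (e : R) : q != 0 -> 0 < e ->
  exists2 s, 0 < s < e & ~~ root q s.
Proof.
move=> q0 e0; apply: contrapT => H.
have all_root s : 0 < s < e -> root q s.
  by move=> hs; apply: contrapT => /negP hr; apply: H; exists s.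
pose rs := [seq e / k.+2%:R | k <- iota 0 (size q)].
have := @max_poly_roots _ q rs q0; rewrite size_map size_iota ltnn.
have -> : all (root q) rs.
  apply/allP => _ /mapP[k _ ->]; apply: all_root.
  rewrite divr_gt0//= ltr_pdivrMr// ltr_pMr// ltr1n//.
have -> : uniq rs.
  rewrite map_inj_uniq ?iota_uniq// => a b /(mulfI (lt0r_neq0 e0)) /invr_inj /eqP.
  by rewrite eqr_nat => /eqP[].
by move=> /(_ isT isT).
Qed.

(** The point is moved along the moment curve [(s, s ^+ 2, s ^+ 3)]. For [w != 0] the product with
    [w] is then a nonzero polynomial in [s], and [s] only has to avoid the roots of finitely many of
    them; [s < 1] keeps the higher powers below [e]. *)
Lemma generic_near (W : seq 'rV[R]_3) (x : 'rV[R]_3) (e : R) :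
  0 < e -> (forall w, w \in W -> w != 0) ->
  exists2 y, ball x e y & forall w, w \in W -> dot w y != 0.
Proof.
move=> e0 W0.
pose qw (w : 'rV[R]_3) : {poly R} :=
  Poly [:: dot w x; w ord0 0; w ord0 1; w ord0 2%:R].
have qw0 w : w != 0 -> qw w != 0.
  apply: contra_neq => h; apply: row3P; rewrite mxE.
  - by have := coef_Poly [:: dot w x; w ord0 0; w ord0 1; w ord0 2%:R] 1; rewrite -/(qw w) h coef0.
  - by have := coef_Poly [:: dot w x; w ord0 0; w ord0 1; w ord0 2%:R] 2; rewrite -/(qw w) h coef0.
  - by have := coef_Poly [:: dot w x; w ord0 0; w ord0 1; w ord0 2%:R] 3; rewrite -/(qw w) h coef0.
pose q := \prod_(w <- W) qw w.
have q0 : q != 0.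
  by rewrite /q prodf_seq_neq0; apply/allP => w wW /=; apply: qw0; exact: W0.
have m0 : 0 < Num.min e 1 by rewrite lt_min e0 ltr01.
have [s /andP[s0]] := small_non_root q0 m0.
rewrite lt_min => /andP[se s1] rs.
exists (x + \row_k [:: s; s ^+ 2; s ^+ 3]`_k).
  apply: ball_row => // k; rewrite !mxE opprD addrA subrr sub0r normrN.
  case: k => -[|[|[|//]]] k3 /=; rewrite ger0_norm ?exprn_ge0// ?ltW//.
  - by apply: le_lt_trans se; rewrite expr2 ger_pMr// ltW.
  - by apply: le_lt_trans se; rewrite exprS ger_pMr// exprn_ile1// ltW.
move=> w wW; apply: contraNneq rs => h.
rewrite /q /root horner_prod prodf_seq_eq0; apply/hasP; exists w => //=.
rewrite /qw horner_Poly /=; apply/eqP; rewrite -[RHS]h.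
by rewrite dotDr (dotE w (\row__ _)) !mxE /=; ring.
Qed.

End generic_vectors.

Section convex.
Context {R : realType}.
Implicit Types (x y z : 'rV[R]_3) (C : set 'rV[R]_3).

Lemma convex_setP C : convex_set C <->
  forall x y s, 0 <= s <= 1 -> C x -> C y -> C (s *: x + (1 - s) *: y).
Proof.
split=> [h x y s s01 Cx Cy|h x y s].
  have := h x y (Itv01 (proj1 (andP s01)) (proj2 (andP s01))).
  by rewrite !inE; apply.
rewrite !inE => Cx Cy.
by apply: (h x y s%:num) => //; rewrite ge0 le1.
Qed.

(** Dividing by the total weight only at the end allows an induction that splits off one point and
    leaves the other coefficients alone. *)
Lemma convex_comb (C : set 'rV[R]_3) (I : eqType) (r : seq I) (c : I -> R) (f : I -> 'rV[R]_3) :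
  convex_set C -> (forall i, i \in r -> 0 <= c i) ->
  (forall i, i \in r -> c i != 0 -> C (f i)) ->
  0 < \sum_(i <- r) c i -> C ((\sum_(i <- r) c i)^-1 *: \sum_(i <- r) c i *: f i).
Proof.
move=> /convex_setP cC; elim: r => [|i r IH] c0 Cf.
  by rewrite big_nil ltxx.
have ci0 : 0 <= c i by apply: c0; rewrite mem_head.
have cr0 j : j \in r -> 0 <= c j by move=> jr; apply: c0; rewrite in_cons jr orbT.
have Cr j : j \in r -> c j != 0 -> C (f j) by move=> jr; apply: Cf; rewrite in_cons jr orbT.
rewrite !big_cons => S0.
have [ciE|ci] := eqVneq (c i) 0.
  by move: S0; rewrite ciE scale0r !add0r; exact: IH.
have Cfi : C (f i) by apply: Cf => //; rewrite mem_head.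
have Sr0 : 0 <= \sum_(j <- r) c j by rewrite big_seq sumr_ge0.
have [SrE|Sr] := eqVneq (\sum_(j <- r) c j) 0.
  have -> : \sum_(j <- r) c j *: f j = 0.
    rewrite big_seq big1 // => j jr.
    move: SrE => /eqP; rewrite big_seq psumr_eq0// => /allP/(_ j jr).
    by rewrite jr /= => /eqP ->; rewrite scale0r.
  by rewrite SrE !addr0 scalerA mulVf// scale1r.
have Srp : 0 < \sum_(j <- r) c j by rewrite lt_neqAle eq_sym Sr.
have := cC _ _ (c i / (c i + \sum_(j <- r) c j)) _ Cfi (IH cr0 Cr Srp).
set S := \sum_(j <- r) c j in Sr Srp Sr0 S0 *; set V := \sum_(j <- r) _.
have -> : (c i / (c i + S)) *: f i + (1 - c i / (c i + S)) *: (S^-1 *: V) =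
   (c i + S)^-1 *: (c i *: f i + V).
  rewrite scalerDr !scalerA mulrC; congr (_ + _ *: _).
  by field; rewrite Sr gt_eqF.
apply; rewrite divr_ge0//= ?ler_pdivrMr// ?mul1r ?lerDl// ltW//.
Qed.

Lemma conv_hull_sub C (A : set 'rV[R]_3) : convex_set C -> A `<=` C -> conv_hull A `<=` C.
Proof. by move=> cC AC x; apply. Qed.

Lemma sub_conv_hull (A : set 'rV[R]_3) : A `<=` conv_hull A.
Proof. by move=> x Ax C [_ sAC]; exact: sAC. Qed.

Lemma conv_hull_finite (I : finType) (f : I -> 'rV[R]_3) (D : {set I}) x :
  conv_hull (f @` [set` D]) x <->
  exists c : I -> R, [/\ forall i, 0 <= c i, forall i, i \notin D -> c i = 0,
    \sum_i c i = 1 & x = \sum_i c i *: f i].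
Proof.
split=> [|[c [c0 cD c1 ->]]].
  apply: (@conv_hull_sub [set x | exists c : I -> R, [/\ forall i, 0 <= c i,
     forall i, i \notin D -> c i = 0, \sum_i c i = 1 & x = \sum_i c i *: f i]]).
    apply/convex_setP => y z s /andP[s0 s1] [c [c0 cD c1 ->]] [d [d0 dD d1 ->]].
    exists (fun i => s * c i + (1 - s) * d i); split.
    - by move=> i; rewrite addr_ge0// mulr_ge0// subr_ge0.
    - by move=> i iD; rewrite cD// dD// !mulr0 addr0.
    - by rewrite big_split /= -!mulr_sumr c1 d1 !mulr1 addrC subrK.
    - rewrite !scaler_sumr -big_split; apply: eq_bigr => i _.
      by rewrite /= !scalerA -scalerDl.
  move=> _ [i iD <-]; exists (fun j => (j == i)%:R); split.
  - by move=> j; rewrite ler0n.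
  - by move=> j; apply: contraNeq; rewrite pnatr_eq0 eqb0 negbK => /eqP ->.
  - by rewrite (bigD1 i)//= eqxx big1 ?addr0// => j /negPf ->.
  - by rewrite (bigD1 i)//= eqxx scale1r big1 ?addr0// => j /negPf ->; rewrite scale0r.
move=> C [cC sAC].
have := @convex_comb C I (index_enum I) c f cC.
rewrite c1 invr1 scale1r; apply=> // i _ ci; apply: sAC; exists i => //=.
by apply: contraNT ci => /cD ->.
Qed.

Lemma convex_halfspace (f : 'rV[R]_3) (b : R) : convex_set [set x | dot f x <= b].
Proof.
apply/convex_setP => x y s /andP[s0 s1] /= fx fy.
rewrite dotDr !dotZr.
have : s * dot f x <= s * b by exact: ler_wpM2l.
have : (1 - s) * dot f y <= (1 - s) * b by apply: ler_wpM2l => //; rewrite subr_ge0.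
by lra.
Qed.

(** Serves to pass from the generators to their hull: if a linear form has a unique maximizer among
    the generators, it has the same unique maximizer on the hull. *)
Lemma convex_pointed_halfspace (f z : 'rV[R]_3) :
  convex_set [set x | x = z \/ dot f x < dot f z].
Proof.
apply/convex_setP => x y s /andP[s0 s1] /=.
have [-> _ hy|ns0] := eqVneq s 0; first by rewrite scale0r add0r subr0 scale1r.
have [-> hx _|ns1] := eqVneq s 1; first by rewrite subrr scale0r addr0 scale1r.
have sp : 0 < s by rewrite lt_neqAle eq_sym ns0.
have sp1 : 0 < 1 - s by rewrite subr_gt0 lt_neqAle ns1.
have tot (t : R) : t = s * t + (1 - s) * t by ring.
move=> [->|hx] [->|hy].
- by left; rewrite -scalerDl addrC subrK scale1r.
- by right; rewrite dotDr !dotZr [ltRHS]tot ltrD2l ltr_pM2l.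
- by right; rewrite dotDr !dotZr [ltRHS]tot ltrD2r ltr_pM2l.
- by right; rewrite dotDr !dotZr [ltRHS]tot ltrD// ltr_pM2l.
Qed.

End convex.

(** * Facets and vertices of a polytope in generic directions *)

Section polytope.
Context {R : realType} {m : nat} (a : 'I_m -> 'rV[R]_3).
Let P := conv_hull (a @` [set` [set: 'I_m]%SET]).
Hypothesis P0 : interior P 0.
Implicit Types (x y f : 'rV[R]_3) (c : 'I_m -> R).

Let Pa i : P (a i).
Proof. by apply: sub_conv_hull; exists i => //=; rewrite inE. Qed.

Let PP x : P x <-> exists c, [/\ forall i, 0 <= c i, \sum_i c i = 1 & x = \sum_i c i *: a i].
Proof.
split=> [/conv_hull_finite[c [c0 _ c1 xE]]|[c [c0 c1 xE]]]; first by exists c.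
by apply/conv_hull_finite; exists c; split=> // i; rewrite inE.
Qed.

Lemma interior_scale x : exists2 s : R, 0 < s & P (s *: x).
Proof.
have /nbhs_ballP[e /= e0 he] := P0.
exists (e / (2 * (`|x| + 1))).
  by rewrite divr_gt0// mulr_gt0// ltr_wpDl.
apply: he; rewrite -ball_normE /ball_ /= sub0r normrN normrZ ger0_norm; last first.
  by rewrite divr_ge0 ?ltW// mulr_ge0// addr_ge0.
rewrite mulrAC ltr_pdivrMr; last by rewrite mulr_gt0// ltr_wpDl.
by rewrite ltr_pM2l//; have : 0 <= `|x| by []; lra.
Qed.

Lemma cone_representation x : exists c, (forall i, 0 <= c i) /\ x = \sum_i c i *: a i.
Proof.
have [s s0 /PP[c [c0 _ xE]]] := interior_scale x.
exists (fun i => s^-1 * c i); split=> [i|]; first by rewrite mulr_ge0// invr_ge0 ltW.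
rewrite -[LHS](scalerK (lt0r_neq0 s0)) xE scaler_sumr.
by apply: eq_bigr => i _; rewrite scalerA.
Qed.

(* A representation with minimal total weight uses only vertices of a facet. *)
Lemma min_representation x : exists c, [/\ forall i, 0 <= c i, x = \sum_i c i *: a i &
  forall c', (forall i, 0 <= c' i) -> x = \sum_i c' i *: a i -> \sum_i c i <= \sum_i c' i].
Proof.
have [c0 [c0_ge0 xc0]] := cone_representation x.
(* A representation of total weight at most [M] has all coefficients in [[0, M]], so the minimum is
   sought on a compact set. *)
pose M := \sum_i c0 i.
pose K := [set c : 'rV[R]_m | (forall i, `[0, M]%classic (c ord0 i)) /\
   x = \sum_i c ord0 i *: a i].
have K0 : K (\row_i c0 i).
  split=> [i|]; last by rewrite xc0; apply: eq_bigr => i _; rewrite mxE.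
  rewrite /= in_itv /= mxE c0_ge0 /M (bigD1 i)//= lerDl sumr_ge0//.
have cF : continuous (fun c : 'rV[R]_m => \sum_i c ord0 i *: a i).
  apply: continuous_big => [|i _]; first exact: add_continuous.
  move=> c; have h : continuous (fun k : R => k *: a i) by exact: scalel_continuous.
  by apply: (@continuous_comp _ _ _ (fun c : 'rV[R]_m => c ord0 i) (fun k : R => k *: a i));
    [exact: coord_continuous|exact: h].
have cK : compact K.
  have -> : K = [set c : 'rV[R]_m | forall i, `[0, M]%classic (c ord0 i)] `&`
      ((fun c : 'rV[R]_m => \sum_i c ord0 i *: a i) @^-1` [set x]).
    by apply/seteqP; split=> c [h1 h2]; split.
  apply: compact_closedI.
    apply: (@rV_compact _ _ (fun=> `[0, M]%classic)) => i; exact: segment_compact.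
  apply: closed_comp; first by move=> c _; exact: cF.
  exact/accessible_closed_set1/hausdorff_accessible/norm_hausdorff.
have [c [Kc1 Kc2] cmin] : exists2 c, K c & forall t, K t ->
    \sum_i c ord0 i <= \sum_i t ord0 i.
  have cS : {within K, continuous (fun c : 'rV[R]_m => \sum_i c ord0 i)}.
    apply: continuous_subspaceT.
    apply: continuous_big => [|i _]; first exact: add_continuous.
    exact: coord_continuous.
  have [|c Kc h] := @EVT_min_rV R m _ K _ cK cS; first by exists (\row_i c0 i).
  by exists c; [rewrite inE in Kc|move=> t Kt; apply: h; rewrite inE].
exists (fun i => c ord0 i); split=> //.
  by move=> i; have := Kc1 i; rewrite /= in_itv /= => /andP[].
move=> c' c'0 xc'.
have [cM|cM] := lerP (\sum_i c' i) M.
  have <- : \sum_i (\row_j c' j : 'rV[R]_m) ord0 i = \sum_i c' i.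
    by apply: eq_bigr => i _; rewrite mxE.
  apply: cmin; split=> [i|].
    rewrite /= in_itv /= mxE c'0 /=; apply: le_trans cM.
    by rewrite (bigD1 i)//= lerDl sumr_ge0.
  by rewrite xc'; apply: eq_bigr => i _; rewrite mxE.
apply: le_trans (ltW cM); apply: le_trans (cmin _ K0) _.
by rewrite le_eqVlt; apply/orP; left; apply/eqP/eq_bigr => i _; rewrite mxE.
Qed.

(** Avoiding the planes spanned by two generators and the lines spanned by one forces every
    representation of a nonzero [x] to involve three linearly independent generators. *)
Definition generic x : Prop :=
  (forall i j, cross (a i) (a j) != 0 -> triple (a i) (a j) x != 0) /\
  (forall i, a i != 0 -> cross (a i) x != 0).

Lemma generic_ball x (e : R) : 0 < e -> exists2 y, ball x e y & generic y.
Proof.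
move=> e0.
(* The vector condition [cross (a i) x != 0] is enforced by a scalar one: for [a i != 0] some
   coordinate vector [d] has [cross d (a i) != 0], and [x] is kept off the plane orthogonal to
   it. *)
pose E : seq 'rV[R]_3 := [seq delta_mx ord0 k | k : 'I_3].
pose W := [seq w <- [seq cross (a i) (a j) | i <- enum 'I_m, j <- enum 'I_m] ++
   [seq cross d (a i) | d <- E, i <- enum 'I_m] | w != 0].
have [w|y xy Wy] := @generic_near R W x e e0.
  by rewrite mem_filter => /andP[].
exists y => //; split=> [i j ij|i ai].
  apply: Wy; rewrite mem_filter ij mem_cat; apply/orP; left.
  by apply/allpairsP; exists (i, j); rewrite /= !mem_enum.
apply/negP => /eqP h.
have [k dk] : exists k : 'I_3, cross (delta_mx ord0 k) (a i) != 0.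
  apply: contrapT => H.
  have D k : cross (delta_mx ord0 k) (a i) = 0.
    by apply/eqP; apply: contrapT => /negP hk; apply: H; exists k.
  move/negP: ai; apply; apply/eqP; apply: row3P; rewrite [RHS]mxE.
  - by have /rowP/(_ 2%:R) := D 1; rewrite !mxE /= => /eqP; rewrite mul0r sub0r mul1r oppr_eq0 => /eqP.
  - by have /rowP/(_ 2%:R) := D 0; rewrite !mxE /= => /eqP; rewrite mul0r subr0 mul1r => /eqP.
  - by have /rowP/(_ 0) := D 1; rewrite !mxE /= => /eqP; rewrite mul0r subr0 mul1r => /eqP.
have := Wy (cross (delta_mx ord0 k) (a i)).
rewrite -/(triple _ _ _) -tripleA /triple h dot0l eqxx => W0; apply: notF; apply: W0.
  rewrite mem_filter dk mem_cat; apply/orP; right.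
  apply/allpairsP; exists (delta_mx ord0 k, i); rewrite /= mem_enum; split=> //.
  by apply/mapP; exists k => //; rewrite mem_enum.
Qed.

Lemma sum_dot (I : Type) (r : seq I) (Q : pred I) (F : I -> 'rV[R]_3) x :
  dot (\sum_(i <- r | Q i) F i) x = \sum_(i <- r | Q i) dot (F i) x.
Proof.
elim/big_rec2: _ => [|i u v _ <-]; first exact: dot0l.
exact: dotDl.
Qed.

Lemma sum_cross (I : Type) (r : seq I) (Q : pred I) (F : I -> 'rV[R]_3) x :
  cross (\sum_(i <- r | Q i) F i) x = \sum_(i <- r | Q i) cross (F i) x.
Proof.
elim/big_rec2: _ => [|i u v _ <-]; first exact: cross0l.
exact: crossDl.
Qed.

Lemma generic_support x c : x != 0 -> generic x -> x = \sum_i c i *: a i ->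
  exists i j k, [/\ c i != 0, c j != 0, c k != 0 & triple (a i) (a j) (a k) != 0].
Proof.
move=> x0 [g1 g2] xE; apply: contrapT => H.
have H1 i j k : c i != 0 -> c j != 0 -> c k != 0 -> triple (a i) (a j) (a k) = 0.
  by move=> ci cj ck; apply/eqP; apply: contrapT => /negP h; apply: H; exists i, j, k.
have H2 i j : c i != 0 -> c j != 0 -> cross (a i) (a j) = 0.
  move=> ci cj; apply/eqP; apply: contrapT => /negP/g1 /eqP; apply.
  rewrite /triple dotC xE sum_dot big1 // => k _; rewrite dotZl dotC -/(triple _ _ _).
  by have [->|ck] := eqVneq (c k) 0; rewrite ?mul0r// H1// mulr0.
have H3 i : c i != 0 -> a i = 0.
  move=> ci; apply/eqP; apply: contrapT => /negP/g2 /eqP; apply.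
  rewrite crossC xE sum_cross big1 ?oppr0// => k _; rewrite crossZl.
  have [->|ck] := eqVneq (c k) 0; first by rewrite scale0r.
  by rewrite crossC H2// oppr0 scaler0.
case/eqP: x0; rewrite xE big1// => i _.
by have [->|/H3 ->] := eqVneq (c i) 0; rewrite ?scale0r ?scaler0.
Qed.

Lemma dual_vector x y z : triple x y z != 0 -> exists n : 'rV[R]_3,
  [/\ dot n x = 1, dot n y = 1 & dot n z = 1].
Proof.
move=> D0; exists ((triple x y z)^-1 *: (cross y z + cross z x + cross x y)).
have E u : dot ((triple x y z)^-1 *: (cross y z + cross z x + cross x y)) u =
    (triple x y z)^-1 * (triple y z u + triple z x u + triple x y u).
  by rewrite dotZl !dotDl.
split; rewrite E ?triplexyx ?triplexx ?triplexyy.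
- by rewrite !addr0 (tripleA x y z) mulVf.
- by rewrite add0r addr0 -(tripleA z x y) mulVf.
- by rewrite !add0r mulVf.
Qed.

(** Linear programming duality. Three independent generators in the support of a minimal
    representation determine [n]. Minimality gives [dot n (a l) <= 1], with equality on the support,
    which is complementary slackness; so the ray of [x] leaves the polytope through the facet with
    normal [n]. *)
Lemma generic_facet x : x != 0 -> generic x -> exists n : 'rV[R]_3,
  [/\ forall i, dot n (a i) <= 1, 0 < dot n x, P ((dot n x)^-1 *: x) &
    exists i j k, [/\ dot n (a i) = 1, dot n (a j) = 1, dot n (a k) = 1 &
      triple (a i) (a j) (a k) != 0]].
Proof.
move=> x0 gx; have [c [c0 xE cmin]] := min_representation x.
have [i [j [k [ci cj ck D0]]]] := generic_support x0 gx xE.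
have [n [ni nj nk]] := dual_vector D0.
have pos u : c u != 0 -> 0 < c u by move=> cu; rewrite lt_neqAle eq_sym cu c0.
have ij : i != j by apply: contra_neq D0 => ->; rewrite triplexx.
have ik : i != k by apply: contra_neq D0 => ->; rewrite triplexyx.
have jk : j != k by apply: contra_neq D0 => ->; rewrite triplexyy.
(* Moving the coefficients along the linear relation between [a l] and the basis
   [a i], [a j], [a k] changes their sum at the rate [1 - dot n (a l)]. *)
have move_coef l (s : R) : (0 < s \/ c l != 0) -> 0 <= s * (1 - dot n (a l)).
  move=> sl.
  pose al := triple (a l) (a j) (a k) / triple (a i) (a j) (a k).
  pose be := triple (a i) (a l) (a k) / triple (a i) (a j) (a k).
  pose ga := triple (a i) (a j) (a l) / triple (a i) (a j) (a k).
  have lE : a l = al *: a i + be *: a j + ga *: a k by exact: cramer.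
  have nl : dot n (a l) = al + be + ga by rewrite lE !dotDr !dotZr ni nj nk !mulr1.
  pose K := 1 + `|s| * (1 + `|al| + `|be| + `|ga|).
  have K0 : 0 < K by rewrite ltr_wpDr// mulr_ge0// !addr_ge0.
  (* If [c l = 0], then [s] is positive and the coefficient at [l] only grows, so any positive
     number may stand for it in the bound on [e]. *)
  pose cl := if c l == 0 then 1 else c l.
  have cl0 : 0 < cl by rewrite /cl; case: eqVneq => // /pos.
  pose e := Num.min (Num.min (c i) (c j)) (Num.min (c k) cl) / K.
  have m0 : 0 < Num.min (Num.min (c i) (c j)) (Num.min (c k) cl) by rewrite !lt_min !pos// cl0.
  have e0 : 0 < e by rewrite divr_gt0.
  have small (u g : R) : Num.min (Num.min (c i) (c j)) (Num.min (c k) cl) <= u ->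
     `|s| * `|g| <= K -> 0 <= u + e * (s * g).
    move=> mu gK; have : `|e * (s * g)| <= u.
      rewrite normrM (gtr0_norm e0) normrM; apply: (@le_trans _ _ (e * K)).
        by rewrite ler_pM2l.
      by rewrite /e divfK ?gt_eqF.
    by rewrite ler_norml => /andP[h _]; lra.
  pose c' u := c u + e * (s * ((u == l)%:R - al * (u == i)%:R - be * (u == j)%:R - ga * (u == k)%:R)).
  have sumd (F : 'I_m -> 'rV[R]_3) v : \sum_u (u == v)%:R *: F u = F v.
    by rewrite (bigD1 v)//= eqxx scale1r big1 ?addr0// => u /negPf ->; rewrite scale0r.
  have sumd1 v : \sum_(u < m) (u == v)%:R = 1 :> R.
    by rewrite (bigD1 v)//= eqxx big1 ?addr0// => u /negPf ->.
  have c'E : \sum_u c' u *: a u = x.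
    transitivity (\sum_u c u *: a u + (e * s) *: (\sum_u (u == l)%:R *: a u
       - al *: \sum_u (u == i)%:R *: a u - be *: \sum_u (u == j)%:R *: a u
       - ga *: \sum_u (u == k)%:R *: a u)); last first.
      rewrite !sumd -xE [X in _ *: X](_ : _ = 0) ?scaler0 ?addr0//.
      by rewrite [a l in LHS]lE; apply/rowP => z; rewrite !mxE; ring.
    rewrite !scaler_sumr -!sumrB scaler_sumr -big_split; apply: eq_bigr => u _ /=.
    by apply/rowP => z; rewrite !mxE /c'; ring.
  have c'S : \sum_u c' u = \sum_u c u + e * (s * (1 - dot n (a l))).
    rewrite big_split /= -!mulr_sumr !sumrB -!mulr_sumr !sumd1 nl; congr (_ + _ * (_ * _)).
    by ring.
  have c'0 u : 0 <= c' u.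
    have K1 g : `|g| <= 1 + `|al| + `|be| + `|ga| -> `|s| * `|g| <= K.
      move=> gK; apply: (@le_trans _ _ (`|s| * (1 + `|al| + `|be| + `|ga|))).
        exact: ler_wpM2l.
      by rewrite lerDr.
    have g0 : [/\ 0 <= `|al|, 0 <= `|be| & 0 <= `|ga|] by [].
    have bnd (b1 b2 b3 b4 : bool) :
        `|b1%:R - al * b2%:R - be * b3%:R - ga * b4%:R| <= 1 + `|al| + `|be| + `|ga|.
      have nb (g : R) (b : bool) : `|g * b%:R| <= `|g|.
        by case: b; rewrite ?mulr1 ?mulr0 ?normr0.
      have := nb 1 b1; have := nb al b2; have := nb be b3; have := nb ga b4.
      rewrite normr1 mul1r.
      move: (al * _) (be * _) (ga * _) (b1%:R : R) => x1 x2 x3 x4.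
      rewrite !ler_norml => /andP[? ?] /andP[? ?] /andP[? ?] /andP[? ?].
      by apply/andP; split; lra.
    have [cu|cu] := eqVneq (c u) 0; last first.
      have [uS|uS] := boolP [|| u == i, u == j, u == k | u == l].
        apply: small => //; last exact/K1/bnd.
        rewrite !ge_min; case/or4P: uS => /eqP uE; move: cu; rewrite uE => cu;
          rewrite ?lexx ?orbT//.
        by rewrite /cl (negPf cu) lexx !orbT.
      move: uS; rewrite !negb_or => /and4P[/negPf ui /negPf uj /negPf uk /negPf ul].
      by rewrite /c' ui uj uk ul !mulr0 !subr0 !mulr0 addr0.
    have [ui uj uk] : [/\ u != i, u != j & u != k].
      by split; apply/eqP => uE; move: ci cj ck; rewrite -uE cu eqxx.
    rewrite /c' cu (negPf ui) (negPf uj) (negPf uk) !mulr0 !subr0 add0r.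
    have [ul|] := eqVneq u l; last by rewrite !mulr0.
    rewrite mulr1 mulr_ge0 ?(ltW e0)//; case: sl => [/ltW//|].
    by rewrite -ul cu eqxx.
  have := cmin c' c'0 (esym c'E); rewrite c'S lerDl.
  by rewrite pmulr_rge0.
have n1 l : dot n (a l) <= 1.
  by have := move_coef l 1 (or_introl ltr01); rewrite mul1r subr_ge0.
have n1E l : c l != 0 -> dot n (a l) = 1.
  move=> cl; apply/eqP; rewrite eq_le n1 /=.
  by have := move_coef l (-1) (or_intror cl); rewrite mulN1r oppr_ge0 subr_le0.
have nx : dot n x = \sum_u c u.
  rewrite xE dotC sum_dot; apply: eq_bigr => u _; rewrite dotZl dotC.
  by have [->|/n1E ->] := eqVneq (c u) 0; rewrite ?mul0r ?mulr1.
have nx0 : 0 < dot n x.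
  rewrite nx (bigD1 i)//= ltr_pwDl ?pos// sumr_ge0//.
exists n; split=> //; last by exists i, j, k.
apply/PP; exists (fun u => (dot n x)^-1 * c u); split.
- by move=> u; rewrite mulr_ge0// invr_ge0 ltW.
- by rewrite -mulr_sumr -nx mulVf// gt_eqF.
- by rewrite {2}xE scaler_sumr; apply: eq_bigr => u _; rewrite scalerA.
Qed.

(** A small perturbation of the functional separates all distinct generators; the unique maximizer
    among them is then a vertex of the hull. *)
Lemma exposed_near x (e : R) : 0 < e -> exists2 f, ball x e f &
  exists2 u, is_face P [set a u] & forall l, dot f (a l) <= dot f (a u).
Proof.
move=> e0.
(* The first vector of the list guarantees [f != 0] even if all generators coincide. *)
pose W := [seq w <- (\row_k [:: 1; 0; 0]`_k : 'rV[R]_3) ::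
   [seq a i - a j | i <- enum 'I_m, j <- enum 'I_m] | w != 0].
have [w|f xf Wf] := @generic_near R W x e e0.
  by rewrite mem_filter => /andP[].
have f0 : f != 0.
  have : dot (\row_k [:: 1; 0; 0]`_k : 'rV[R]_3) f != 0.
    apply: Wf; rewrite mem_filter in_cons eqxx /= andbT.
    by apply/negP => /eqP/rowP/(_ 0); rewrite !mxE /= => /eqP; rewrite oner_eq0.
  by apply: contra_neq => ->; rewrite dot0r.
have [s _ /PP[c [c0 c1 _]]] := interior_scale x.
have [u0 _] : exists u0 : 'I_m, True.
  apply: contrapT => H; move: c1; rewrite big1 => [/esym/eqP|i _]; first by rewrite oner_eq0.
  by case: H; exists i.
exists f => //.
pose u := [arg max_(i > u0) dot f (a i)]%O.
have umax l : dot f (a l) <= dot f (a u).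
  by rewrite /u; case: arg_maxP => // i _ /(_ l isT).
exists u => //; exists f, (dot f (a u)); split=> //.
- move=> y Py; apply: (conv_hull_sub (@convex_halfspace R f (dot f (a u))) _ Py).
  by move=> _ [l _ <-]; exact: umax.
- apply/seteqP; split=> [_ ->|y [Py fy]]; first by split=> //; exact: Pa.
  have : [set x | x = a u \/ dot f x < dot f (a u)] y.
    apply: (conv_hull_sub _ _ Py); first exact: convex_pointed_halfspace.
    move=> _ [l _ <-] /=; have [->|lu] := eqVneq (a l) (a u); first by left.
    right; rewrite lt_neqAle umax andbT -subr_eq0 -dotBr dotC.
    apply: Wf; rewrite mem_filter subr_eq0 lu in_cons; apply/orP; right.
    by apply/allpairsP; exists (l, u); rewrite /= !mem_enum.
  by case=> //; rewrite fy ltxx.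
Qed.

End polytope.

Section continuity.
Context {R : realType}.

Lemma continuous_dot (w : 'rV[R]_3) : continuous (fun y : 'rV[R]_3 => dot w y : R).
Proof.
apply: continuous_big => [|i _]; first exact: add_continuous.
move=> y; apply: differentiable_continuous.
by apply: differentiableM; last exact: differentiable_coord.
Qed.

Lemma dot_lt_near (w x : 'rV[R]_3) (b : R) : dot w x < b -> \forall y \near x, dot w y < b.
Proof.
move=> h; have nF : Filter (nbhs x) by exact: nbhs_filter.
exact: (@cvgr_lt _ _ _ nF (fun y => dot w y) _ (@continuous_dot w x) b h).
Qed.

Lemma le_dot_norm (d y : 'rV[R]_3) : `|dot d y| <= `|d| * \sum_k `|y ord0 k|.
Proof.
apply: le_trans (ler_norm_sum _ _ _) _; rewrite mulr_sumr; apply: ler_sum => k _.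
by rewrite normrM ler_wpM2r// entry_le_norm.
Qed.

End continuity.

(** * The cones over the triangles and the edges of the polar dual *)

Section triangulated_polytope.
Context {R : realType} {n : nat} (P : set 'rV[R]_3) (p : 'I_n -> 'rV[R]_3)
  (T : {set {set 'I_n}}).
Hypotheses (P_polyhedron : is_convex_polyhedron P) (p_inj : injective p)
  (P_vertices : vertices P = range p) (P_int0 : interior P 0)
  (T_triangulation : is_triangulation P p T).
Implicit Types (i j k l : 'I_n) (t u : {set 'I_n}) (x y : 'rV[R]_3).

Lemma polyhedron_hull : exists m (a : 'I_m -> 'rV[R]_3),
  P = conv_hull (a @` [set` [set: 'I_m]%SET]).
Proof.
have [A [/finite_seqP[s sA] PA]] := P_polyhedron.
exists (size s), (fun i : 'I_(size s) => tnth (in_tuple s) i); rewrite PA sA; congr conv_hull.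
apply/seteqP; split=> x /=.
  by move=> xs; have /tnthP[i ->] : x \in in_tuple s by []; exists i => //=; rewrite inE.
by move=> [i _ <-]; exact: mem_tnth.
Qed.

Lemma vertex_face i : is_face P [set p i].
Proof. by have : vertices P (p i) by rewrite P_vertices; exists i. Qed.

Lemma vertex_in i : P (p i).
Proof.
have [f [b [_ _ E]]] := vertex_face i.
have : [set p i] (p i) by []. by rewrite E => -[].
Qed.

Lemma vertex_exposed i : exists f, forall y, P y -> y != p i -> dot f y < dot f (p i).
Proof.
have [f [b [_ fb E]]] := vertex_face i; exists f => y Py yi.
have : [set p i] (p i) by []; rewrite E => -[_ fi].
rewrite [dot f (p i)]fi lt_neqAle fb// andbT.
apply: contra_neqN yi => /eqP h; apply/eqP.
have : [set p i] y by rewrite E; split => //; rewrite /plane /= h fi.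
by move=> ->.
Qed.

(** The generators of [P] need not be vertices. A functional [f] close to [x] attains its maximum
    over the generators at a vertex, hence [dot x] exceeds 1 on the generators by at most an
    arbitrarily small error. *)
Lemma polar_vertices x : (forall i, dot x (p i) <= 1) -> forall y, P y -> dot x y <= 1.
Proof.
move=> xp; have [m [a PE]] := polyhedron_hull.
have P0 : interior (conv_hull (a @` [set` [set: 'I_m]%SET])) 0 by rewrite -PE.
suff al (l : 'I_m) : dot x (a l) <= 1.
  move=> y; rewrite PE => Py.
  apply: (conv_hull_sub (@convex_halfspace R x 1) _ Py).
  by move=> _ [l _ <-]; exact: al.
apply/ler_addgt0Pr => e e0.
pose K : R := 1 + \sum_l \sum_k `|a l ord0 k|.
have Ks0 : 0 <= \sum_l \sum_k `|a l ord0 k|.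
  by apply: sumr_ge0 => i _; apply: sumr_ge0.
have K0 : 0 < K by rewrite ltr_wpDr.
have d0 : 0 < e / (2 * K) by rewrite divr_gt0// mulr_gt0.
have [f xf [u fu fmax]] := exposed_near P0 x d0.
have Kl (v : 'I_m) : `|dot (x - f) (a v)| <= e / 2.
  apply: le_trans (le_dot_norm _ _) _.
  have h1 : `|x - f| <= e / (2 * K) by apply: ltW; move: xf; rewrite -ball_normE.
  have h2 : \sum_k `|a v ord0 k| <= K.
    apply: (@le_trans _ _ (\sum_l \sum_k `|a l ord0 k|)); last by rewrite lerDr.
    by rewrite (bigD1 v)//= lerDl; apply: sumr_ge0 => i _; apply: sumr_ge0.
  apply: (@le_trans _ _ (e / (2 * K) * K)); first by apply: ler_pM => //; exact: sumr_ge0.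
  by rewrite le_eqVlt; apply/orP; left; apply/eqP; field; rewrite gt_eqF.
have [i ui] : exists i, a u = p i.
  have : vertices P (a u) by rewrite /vertices /= PE.
  by rewrite P_vertices => -[i _ <-]; exists i.
have := Kl l; have := Kl u; rewrite !dotBl !ler_norml => /andP[u1 u2] /andP[l1 l2].
by have := fmax l; have := xp i; rewrite -ui; lra.
Qed.

(** Since [0] is interior, the supporting value is positive and can be scaled to 1; then [m] is the
    point of the polar dual that corresponds to [F]. *)
Lemma facet_normal F : is_facet P F -> exists m : 'rV[R]_3,
  (forall y, P y -> dot m y <= 1) /\ F = P `&` plane m 1.
Proof.
move=> [[f [b [f0 fb FE]]] _].
have b0 : 0 < b.
  have [m [a PE]] := polyhedron_hull.
  have P0 : interior (conv_hull (a @` [set` [set: 'I_m]%SET])) 0 by rewrite -PE.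
  have [s s0] := interior_scale P0 f; rewrite -PE => /fb; rewrite dotZr.
  by apply: lt_le_trans; rewrite mulr_gt0// dotxx_gt0.
exists (b^-1 *: f); split=> [y /fb fy|].
  by rewrite dotZl ler_pdivrMl// mulr1.
rewrite FE; apply/seteqP; split=> y [Py]; rewrite /plane /= dotZl => h; split=> //.
  by rewrite h mulVf// gt_eqF.
by rewrite -[LHS](mulVKf (lt0r_neq0 b0)) h mulr1.
Qed.

Lemma triangle_card t : t \in T -> #|t| = 3%N.
Proof. by have [h _ _] := T_triangulation => /h[]. Qed.

Lemma in_hull_of t i : i \in t -> hull_of p t (p i).
Proof. by move=> it; apply: sub_conv_hull; exists i. Qed.

Lemma triangle_normal t : t \in T -> exists m : 'rV[R]_3,
  [/\ forall y, P y -> dot m y <= 1, forall i, i \in t -> dot m (p i) = 1 &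
    forall y, hull_of p t y -> P y].
Proof.
have [h _ _] := T_triangulation => /h[_ [F [/facet_normal[m [m1 FE]] tF]]].
exists m; split=> // [i it|y /tF]; last by rewrite FE => -[].
by have := tF _ (in_hull_of it); rewrite FE => -[_].
Qed.

Lemma not_collinear i j k (al be ga : R) : i != j -> k != i -> k != j ->
  al + be + ga = 0 -> al *: p i + be *: p j + ga *: p k = 0 -> al = 0.
Proof.
(* The vertex whose coefficient differs in sign from both others would lie on the
   segment between them. *)
have ends a b c (x y : R) : a != b -> c != b -> 0 <= x -> 0 <= y -> 0 < x + y ->
    (x + y) *: p b = x *: p a + y *: p c -> False.
  move=> ab cb x0 y0 xy0 E; have [f fb] := vertex_exposed b.
  have fa := fb _ (vertex_in a) (contra_neq (@p_inj _ _) ab).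
  have fc := fb _ (vertex_in c) (contra_neq (@p_inj _ _) cb).
  have := congr1 (dot f) E; rewrite dotDr !dotZr.
  have [x00|x0'] := eqVneq x 0.
    have : 0 < y by move: xy0; rewrite x00 add0r.
    move=> yp; have : y * dot f (p c) < y * dot f (p b) by rewrite ltr_pM2l.
    by rewrite x00; lra.
  have xp : 0 < x by rewrite lt_neqAle eq_sym x0'.
  have : x * dot f (p a) < x * dot f (p b) by rewrite ltr_pM2l.
  have : y * dot f (p c) <= y * dot f (p b) by rewrite ler_wpM2l// ltW.
  by move=> ? ? ?; lra.
move=> ij ki kj s0 E.
apply/eqP; apply: contrapT => /negP al0.
have ji : j != i by rewrite eq_sym.
have ik : i != k by rewrite eq_sym.
have jk : j != k by rewrite eq_sym.
have coord v : al * p i ord0 v + be * p j ord0 v + ga * p k ord0 v = 0.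
  by have /rowP/(_ v) := E; rewrite !mxE.
have [a0|a0] := leP 0 al; have [b0|b0] := leP 0 be; have [g0|g0] := leP 0 ga.
- by move/negP: al0; apply; apply/eqP; lra.
- apply: (@ends i k j al be) => //; first by rewrite lt_neqAle eq_sym; apply/andP; split; [apply/eqP|]; lra.
  apply/rowP => v; rewrite !mxE; apply/esym/eqP; rewrite -subr_eq0 -(coord v); apply/eqP; have gE : ga = - (al + be) by lra.
  by rewrite gE; ring.
- apply: (@ends i j k al ga) => //; first by lra.
  apply/rowP => v; rewrite !mxE; apply/esym/eqP; rewrite -subr_eq0 -(coord v); apply/eqP; have gE : be = - (al + ga) by lra.
  by rewrite gE; ring.
- have ap : 0 < al by rewrite lt_neqAle eq_sym al0.
  apply: (@ends j i k (- be) (- ga)) => //; [lra|lra|lra|].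
  apply/rowP => v; rewrite !mxE; apply/eqP; rewrite -subr_eq0 -(coord v); apply/eqP; have gE : al = - be - ga by lra.
  by rewrite gE; ring.
- apply: (@ends j i k be ga) => //; first by lra.
  apply/rowP => v; rewrite !mxE; apply/esym/eqP; rewrite -subr_eq0 -(coord v); apply/eqP; have gE : al = - be - ga by lra.
  by rewrite gE; ring.
- apply: (@ends i j k (- al) (- ga)) => //; [lra|lra|lra|].
  apply/rowP => v; rewrite !mxE; apply/eqP; rewrite -subr_eq0 -(coord v); apply/eqP; have gE : be = - al - ga by lra.
  by rewrite gE; ring.
- apply: (@ends i k j (- al) (- be)) => //; [lra|lra|lra|]. 
  apply/rowP => v; rewrite !mxE; apply/eqP; rewrite -subr_eq0 -(coord v); apply/eqP; have gE : ga = - al - be by lra.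
  by rewrite gE; ring.
- by lra.
Qed.


Lemma vertex_neq0 i : p i != 0.
Proof.
apply/eqP => pi0; have [f fP] := vertex_exposed i.
have [m [a PE]] := polyhedron_hull.
have P0 : interior (conv_hull (a @` [set` [set: 'I_m]%SET])) 0 by rewrite -PE.
have [x x0 fx] : exists2 x, x != 0 & 0 <= dot f x.
  have [f0|f0] := eqVneq f 0; last by exists f; rewrite ?dotxx_ge0.
  exists (const_mx 1); last by rewrite f0 dot0l.
  by apply/eqP => /rowP/(_ 0)/eqP; rewrite !mxE oner_eq0.
have [s s0] := interior_scale P0 x; rewrite -PE => /fP.
rewrite pi0 dot0r scaler_eq0 (negPf x0) orbF gt_eqF// => /(_ isT).
by rewrite dotZr ltNge mulr_ge0// ltW.
Qed.

Lemma cross_neq0 (m : 'rV[R]_3) i j : i != j -> dot m (p i) = 1 -> dot m (p j) = 1 ->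
  cross (p i) (p j) != 0.
Proof.
move=> ij mi mj; apply/eqP => /(cross_eq0_trans (0 : 'rV[R]_3) (vertex_neq0 i))[c jE].
move: mj; rewrite jE dotZr mi mulr1 => c1; move: jE; rewrite c1 scale1r.
by move/p_inj => ji; rewrite ji eqxx in ij.
Qed.

(** On a plane that misses the origin, linear dependence is affine dependence, which [not_collinear]
    excludes for three vertices. *)
Lemma triple_neq0 (m : 'rV[R]_3) i j k : i != j -> k != i -> k != j ->
  dot m (p i) = 1 -> dot m (p j) = 1 -> dot m (p k) = 1 -> triple (p i) (p j) (p k) != 0.
Proof.
move=> ij ki kj mi mj mk; apply/eqP => D0.
have w0 := cross_neq0 ij mi mj; set w := cross _ _ in w0.
have W0 : triple (p i) (p j) w != 0 by rewrite dotxx_eq0.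
have := cramer (p k) W0; rewrite D0 mul0r scale0r addr0.
move: (_ / _) (_ / _) => y x kE.
have xy : x + y = 1 by move: mk; rewrite kE dotDr !dotZr mi mj !mulr1.
suff : - 1 = 0 :> R by move/eqP; rewrite oppr_eq0 oner_eq0.
apply: (@not_collinear k i j (-1) x y ki); rewrite 1?eq_sym//.
  by rewrite -addrA xy addNr.
by rewrite scaleN1r {1}kE -!addrA addNr.
Qed.

Lemma triangle_triple_neq0 t i j k : t \in T -> i \in t -> j \in t -> k \in t ->
  i != j -> k != i -> k != j -> triple (p i) (p j) (p k) != 0.
Proof.
move=> /triangle_normal[m [_ m1 _]] it jt kt ij ki kj.
by apply: (@triple_neq0 m); rewrite ?m1.
Qed.

(** The cone with apex [0] over the simplex [t]. Cones turn statements about the boundary of [P]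
    into statements about open neighborhoods in space; [t] may have fewer than three elements, as
    the intersection of two triangles does. *)
Definition cone t x := exists c : 'I_n -> R,
  [/\ forall i, 0 <= c i, forall i, i \notin t -> c i = 0 & x = \sum_i c i *: p i].

Lemma cone_coef t i j k (c : 'I_n -> R) : i \in t -> j \in t -> k \in t ->
    [&& i != j, k != i & k != j] -> #|t| = 3%N ->
    (forall l, l \notin t -> c l = 0) ->
  \sum_l c l *: p l = c i *: p i + c j *: p j + c k *: p k.
Proof.
move=> it jt kt /and3P[ij ki kj] t3 ct.
rewrite (bigD1 i)//= (bigD1 j) 1?eq_sym//= (bigD1 k) ?ki//= big1 ?addr0 ?addrA// => l.
case/andP => /andP[li lj] lk; rewrite ct ?scale0r//.
apply/negP; have [k' tE [k'i k'j _]] := triangleP t3 it jt ij.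
move: kt; rewrite tE !inE (negPf ki) (negPf kj) /= => /eqP <-.
by rewrite (negPf li) (negPf lj) (negPf lk).
Qed.

Lemma cone_triple t i j k (c : 'I_n -> R) : t \in T -> i \in t -> j \in t -> k \in t ->
    [&& i != j, k != i & k != j] -> (forall l, l \notin t -> c l = 0) ->
  triple (p i) (p j) (\sum_l c l *: p l) = c k * triple (p i) (p j) (p k).
Proof.
move=> tT it jt kt h ct; rewrite (cone_coef it jt kt h (triangle_card tT) ct).
rewrite /triple !dotDr !dotZr -/(triple _ _ _) -/(triple _ _ (p j)) -/(triple _ _ (p k)).
by rewrite triplexyx triplexyy !mulr0 !add0r.
Qed.

Lemma coneP t i j k x : t \in T -> i \in t -> j \in t -> k \in t ->
    [&& i != j, k != i & k != j] ->
  0 <= triple x (p j) (p k) / triple (p i) (p j) (p k) ->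
  0 <= triple (p i) x (p k) / triple (p i) (p j) (p k) ->
  0 <= triple (p i) (p j) x / triple (p i) (p j) (p k) -> cone t x.
Proof.
move=> tT it jt kt /[dup] h /and3P[ij ki kj] ci cj ck.
have D0 := triangle_triple_neq0 tT it jt kt ij ki kj.
pose c l := if l == i then triple x (p j) (p k) / triple (p i) (p j) (p k)
  else if l == j then triple (p i) x (p k) / triple (p i) (p j) (p k)
  else if l == k then triple (p i) (p j) x / triple (p i) (p j) (p k) else 0.
have ct l : l \notin t -> c l = 0.
  move=> lt; rewrite /c.
  by do 3!(case: eqP => [lE|_]; first by rewrite lE ?it ?jt ?kt in lt).
exists c; split=> //; first by move=> l; rewrite /c; do 3!case: ifP => // _.
rewrite (cone_coef it jt kt h (triangle_card tT) ct) /c !eqxx.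
by rewrite (negPf ki) (negPf kj) (eq_sym j) (negPf ij); exact: cramer.
Qed.

(** Outside the cone one of the three coordinates, a quotient of determinants, is strictly negative,
    and it remains so nearby. *)
Lemma not_cone_near t x : t \in T -> ~ cone t x -> \forall y \near x, ~ cone t y.
Proof.
move=> tT nx; have nF : Filter (nbhs x) by exact: nbhs_filter.
have [i [j [k [tE ij ki kj]]]] := triangle_triple triangle_card tT.
have [it jt kt] : [/\ i \in t, j \in t & k \in t] by rewrite tE !inE !eqxx !orbT.
have D0 := triangle_triple_neq0 tT it jt kt ij ki kj.
have out (a b c : 'I_n) : a \in t -> b \in t -> c \in t -> [&& a != b, c != a & c != b] ->
    triple (p a) (p b) x / triple (p a) (p b) (p c) < 0 -> \forall y \near x, ~ cone t y.
  move=> at' bt ct h; rewrite /triple mulrC -dotZl => /dot_lt_near.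
  apply: filterS => y + [d [d0 dt yE]]; rewrite dotZl -/(triple _ _ _) -/(triple _ _ y) yE.
  rewrite (cone_triple tT at' bt ct h dt) mulrC mulfK ?ltNge ?d0//.
  by case/and3P: h => *; exact: (triangle_triple_neq0 tT).
have [h1|h1] := lerP 0 (triple x (p j) (p k) / triple (p i) (p j) (p k)); last first.
  apply: (out j k i) => //; first by rewrite eq_sym kj ij eq_sym ki.
  by rewrite (tripleA x) (tripleA (p i)).
have [h2|h2] := lerP 0 (triple (p i) x (p k) / triple (p i) (p j) (p k)); last first.
  apply: (out k i j) => //; first by rewrite ki eq_sym kj eq_sym ij.
  by rewrite -(tripleA _ _ x) -(tripleA _ _ (p j)).
have [h3|h3] := lerP 0 (triple (p i) (p j) x / triple (p i) (p j) (p k)); last first.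
  by apply: (out i j k) => //; rewrite ij ki.
by case: nx; apply: (@coneP t i j k) => //; rewrite ij ki.
Qed.

(** Otherwise the closed cones would all miss a ball around [x]. A generic point of this ball lies
    over a facet by [generic_facet], and the triangles cover that facet. *)
Lemma cone_cover x : x != 0 -> exists2 t, t \in T & cone t x.
Proof.
move=> x0; apply: contrapT => H.
have nF : Filter (nbhs x) by exact: nbhs_filter.
have nT : \forall y \near x, forall t, t \in T -> ~ cone t y.
  apply: (@filter_forall _ _ (fun t y => t \in T -> ~ cone t y) _ nF) => t.
  have [tT|tT] := boolP (t \in T); last by near=> y.
  have : ~ cone t x by move=> tx; apply: H; exists t.
  by move/(not_cone_near tT); apply: filterS.
have n0 : \forall y \near x, dot (- x) y < 0.
  by apply: dot_lt_near; rewrite dotNl oppr_lt0 dotxx_gt0.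
have [m [a PE]] := polyhedron_hull.
have P0 : interior (conv_hull (a @` [set` [set: 'I_m]%SET])) 0 by rewrite -PE.
have /nbhs_ballP[e /= e0 eT] := @filterI _ _ nF _ _ nT n0.
have [y /eT[yT y0] gy] := generic_ball a x e0.
have yn0 : y != 0 by apply: contraTneq y0 => ->; rewrite dot0r ltxx.
have [f [fa fy Py [i [j [k [fi fj fk D0]]]]]] := generic_facet P0 yn0 gy.
rewrite -PE in Py.
have fP z : P z -> dot f z <= 1.
  rewrite PE; apply: (conv_hull_sub (@convex_halfspace R f 1)) => _ [l _ <-].
  exact: fa.
have aP (l : 'I_m) : P (a l) by rewrite PE; apply: sub_conv_hull; exists l => //=; rewrite inE.
have fF : is_facet P (P `&` plane f 1).
  split; first exists f, 1; first split=> //.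
    by apply: contra_eq_neq fi => ->; rewrite dot0l eq_sym oner_eq0.
  exists (a i), (a j), (a k); split; [by split..|].
  apply: row_free_cross; apply: contra_neq D0 => D0.
  have : triple (a j - a i) (a k - a i) (a i) = triple (a i) (a j) (a k).
    by rewrite !tripleE !mxE; ring.
  by rewrite /triple D0 dot0l.
have [_ /(_ _ fF) FE _] := T_triangulation.
have : (P `&` plane f 1) ((dot f y)^-1 *: y).
  by split=> //; rewrite /plane /= dotZr mulVf// gt_eqF.
rewrite FE => -[t [tT _] /conv_hull_finite[c [c0 ct c1 yE]]].
apply: (yT t tT); exists (fun l => dot f y * c l); split.
- by move=> l; rewrite mulr_ge0// ltW.
- by move=> l /ct ->; rewrite mulr0.
- rewrite -[LHS](scalerKV (lt0r_neq0 fy)) yE scaler_sumr.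
  by apply: eq_bigr => l _; rewrite scalerA.
Unshelve. all: by end_near. Qed.

Lemma cone_sum (m x : 'rV[R]_3) t (c : 'I_n -> R) :
  (forall i, i \in t -> dot m (p i) = 1) -> (forall i, i \notin t -> c i = 0) ->
  x = \sum_i c i *: p i -> dot m x = \sum_i c i.
Proof.
move=> mt ct ->; rewrite dotC sum_dot; apply: eq_bigr => i _; rewrite dotZl dotC.
by have [/mt ->|/ct ->] := boolP (i \in t); rewrite ?mulr1 ?mul0r.
Qed.

(** The normals of [t] and [u] are at most 1 on [P], so each of the two total weights bounds the
    other. Being equal, they scale [x] to one point of both triangles, which lies in the hull of the
    common vertices. *)
Lemma coneI t u x : t \in T -> u \in T -> cone t x -> cone u x ->
  cone (t :&: u)%SET x.
Proof.
move=> tT uT [c [c0 ct xc]] [d [d0 du xd]].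
have [m [mP mt _]] := triangle_normal tT; have [m' [m'P m'u _]] := triangle_normal uT.
have cs := cone_sum mt ct xc; have ds := cone_sum m'u du xd.
have [x0|x0] := eqVneq x 0.
  exists (fun=> 0); split=> //; rewrite x0 big1// => i _; exact: scale0r.
have pos (b : 'I_n -> R) : (forall i, 0 <= b i) -> x = \sum_i b i *: p i -> 0 < \sum_i b i.
  move=> b0 xb; rewrite lt_neqAle sumr_ge0// andbT eq_sym.
  apply: contra_neq x0 => /eqP; rewrite psumr_eq0// => /allP bs.
  rewrite xb big1// => i _; have := bs i (mem_index_enum i).
  by move=> /= /eqP ->; rewrite scale0r.
have hullP (v : {set 'I_n}) (b : 'I_n -> R) : (forall i, 0 <= b i) -> (forall i, i \notin v -> b i = 0) ->
    x = \sum_i b i *: p i -> hull_of p v ((\sum_i b i)^-1 *: x).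
  move=> b0 bv xb; have bp := pos b b0 xb.
  apply/conv_hull_finite; exists (fun i => (\sum_i b i)^-1 * b i); split.
  - by move=> i; rewrite mulr_ge0// invr_ge0 ltW.
  - by move=> i /bv ->; rewrite mulr0.
  - by rewrite -mulr_sumr mulVf// gt_eqF.
  - by rewrite {1}xb scaler_sumr; apply: eq_bigr => i _; rewrite scalerA.
have tx := hullP t c c0 ct xc; have ux := hullP u d d0 du xd.
have hullP1 (v : {set 'I_n}) y : v \in T -> hull_of p v y -> P y by move=> /triangle_normal[? [_ _]]; apply.
have := mP _ (hullP1 _ _ uT ux); rewrite dotZr cs ler_pdivrMl ?pos// mulr1 => cd.
have := m'P _ (hullP1 _ _ tT tx); rewrite dotZr ds ler_pdivrMl ?pos// mulr1 => dc.
have sE : \sum_i c i = \sum_i d i by apply/eqP; rewrite eq_le cd dc.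
have [_ _ /(_ _ _ tT uT) hE] := T_triangulation.
have : (hull_of p t `&` hull_of p u) ((\sum_i c i)^-1 *: x).
  by split=> //; rewrite sE.
rewrite hE => /conv_hull_finite[b [b0 bI b1 bE]].
have sc0 := pos c c0 xc.
exists (fun i => (\sum_i c i) * b i); split.
- by move=> i; rewrite mulr_ge0// ltW.
- by move=> i /bI ->; rewrite mulr0.
- rewrite -[LHS](scalerKV (lt0r_neq0 sc0)) bE scaler_sumr.
  by apply: eq_bigr => l _; rewrite scalerA.
Qed.

Lemma cone_edge t i j (al be : R) : t \in T -> i != j -> 0 <= al -> 0 <= be ->
  (i \in t) && (j \in t) -> cone t (al *: p i + be *: p j).
Proof.
move=> tT ij a0 b0 /andP[it jt].
exists (fun l => al * (l == i)%:R + be * (l == j)%:R); split.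
- by move=> l; rewrite addr_ge0// mulr_ge0.
- move=> l lt; have li : (l == i) = false by apply: contraNF lt => /eqP ->.
  have lj : (l == j) = false by apply: contraNF lt => /eqP ->.
  by rewrite li lj !mulr0 addr0.
- rewrite (bigD1 i)//= (bigD1 j) 1?eq_sym//= big1 => [|l /andP[/negPf -> /negPf ->]].
    by rewrite !eqxx (eq_sym j) (negPf ij) !mulr0 !mulr1 !addr0 add0r.
  by rewrite !mulr0 addr0 scale0r.
Qed.

(* Two triangles on the same side of a common edge overlap near it. *)
Lemma opposite_vertex_unique t u i j k l : t \in T -> u \in T -> i != j ->
  (i \in t) && (j \in t) -> (i \in u) && (j \in u) ->
  k \in t -> k != i -> k != j -> l \in u -> l != i -> l != j ->
  0 < triple (p i) (p j) (p k) * triple (p i) (p j) (p l) -> k = l.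
Proof.
move=> tT uT ij /[dup] ijt /andP[it jt] /andP[iu ju] kt ki kj lu li lj kl.
have Dl := triangle_triple_neq0 uT iu ju lu ij li lj.
have Dk := triangle_triple_neq0 tT it jt kt ij ki kj.
have kE := cramer (p k) Dl.
set ga := _ / _ in kE; set be := _ / _ in kE; set al := _ / _ in kE.
have al0 : 0 < al.
  have := kl; rewrite -(divfK Dl (triple (p i) (p j) (p k))) -/al -mulrA -expr2.
  by rewrite pmulr_lgt0// lt_neqAle sqr_ge0 andbT eq_sym expf_neq0.
(* Small enough for the coefficients of [p i] and [p j] to stay nonnegative when
   [p i + p j + e *: p k] is expanded in the vertices of [u]. *)
pose e : R := (1 + `|be| + `|ga|)^-1.
have e0 : 0 < e by rewrite invr_gt0 -addrA ltr_wpDr// addr_ge0.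
have eb (g : R) : `|g| <= `|be| + `|ga| -> 0 <= 1 + e * g.
  move=> gb; suff : `|e * g| <= 1 by rewrite ler_norml => /andP[]; lra.
  rewrite normrM (gtr0_norm e0) ler_pdivrMl; last by rewrite -addrA ltr_wpDr// addr_ge0.
  by rewrite mulr1 -addrA ler_wpDl.
pose x := p i + p j + e *: p k.
have Dx : triple (p i) (p j) x = e * triple (p i) (p j) (p k).
  by rewrite /triple !dotDr dotZr -/(triple _ _ _) -/(triple _ _ (p j)) triplexyx triplexyy !add0r.
have pos : 0 < 1 + 1 + (e:R) by rewrite -addrA ltr_wpDl// addr_gt0.
have tx : cone t x.
  apply: (@coneP t i j k) => //; first by rewrite ij ki.
  - rewrite (_ : triple x _ _ = triple (p i) (p j) (p k)) ?divff//.
    by rewrite !tripleE !mxE; ring.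
  - rewrite (_ : triple _ x _ = triple (p i) (p j) (p k)) ?divff//.
    by rewrite !tripleE !mxE; ring.
  - by rewrite Dx mulfK// ltW.
have xE : x = (1 + e * ga) *: p i + (1 + e * be) *: p j + (e * al) *: p l.
  by rewrite /x {1}kE; apply/rowP => v; rewrite !mxE; ring.
have ux : cone u x.
  apply: (@coneP u i j l) => //; first by rewrite ij li.
  - rewrite xE (_ : triple (_ + _) _ _ = (1 + e * ga) * triple (p i) (p j) (p l)).
      by rewrite mulfK// eb// lerDr.
    by rewrite !tripleE !mxE; ring.
  - rewrite xE (_ : triple _ (_ + _) _ = (1 + e * be) * triple (p i) (p j) (p l)).
      by rewrite mulfK// eb// lerDl.
    by rewrite !tripleE !mxE; ring.
  - rewrite xE (_ : triple _ _ (_ + _) = (e * al) * triple (p i) (p j) (p l)).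
      by rewrite mulfK// mulr_ge0// ltW.
    by rewrite !tripleE !mxE; ring.
have [c [_ ctu xc]] := coneI tT uT tx ux.
apply/eqP; apply: contrapT => /negP nkl.
have ct v : v \notin t -> c v = 0 by move=> vt; apply: ctu; rewrite inE (negPf vt).
move: Dx; rewrite {1}xc (cone_triple tT it jt kt _ ct) ?ij ?ki// ctu.
  by rewrite mul0r => /esym/eqP; rewrite mulf_eq0 (negPf Dk) gt_eqF.
rewrite inE kt /=; have [u' uE _] := triangleP (triangle_card uT) iu ju ij.
move: lu; rewrite uE !inE (negPf li) (negPf lj) /= => /eqP <-.
by rewrite (negPf ki) (negPf kj) (negPf nkl).
Qed.

Lemma near_ray x (w : 'rV[R]_3) (Q : set 'rV[R]_3) :
  (\forall y \near x, Q y) -> exists2 e : R, 0 < e & Q (x + e *: w).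
Proof.
move=> /nbhs_ballP[d /= d0 dQ].
have h : 0 < 2 * (`|w| + 1) by rewrite mulr_gt0// ltr_wpDl.
exists (d / (2 * (`|w| + 1))); first by rewrite divr_gt0.
apply: dQ; rewrite -ball_normE /ball_ /= opprD addrA subrr sub0r normrN normrZ.
rewrite ger0_norm ?divr_ge0// ?ltW// mulrAC ltr_pdivrMr// ltr_pM2l//.
by have : 0 <= `|w| by []; lra.
Qed.

Lemma edge_weights t i j (al be : R) (c : 'I_n -> R) : t \in T -> i != j ->
  (i \in t) && (j \in t) -> (forall l, l \notin t -> c l = 0) ->
  al *: p i + be *: p j = \sum_l c l *: p l -> c i = al.
Proof.
move=> tT ij /andP[it jt] ct E.
have [k _ [ki kj kt]] := triangleP (triangle_card tT) it jt ij.
have D0 := triangle_triple_neq0 tT it jt kt ij ki kj.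
apply: (mulIf D0); rewrite -[in LHS](tripleA (p i)) -(cone_triple tT jt kt it _ ct).
  by rewrite -E !tripleE !mxE; ring.
by rewrite eq_sym kj ij eq_sym.
Qed.

(** From [p i + p j] a small step is made to the side given by the sign of [s]. Cones of triangles
    without the edge miss [p i + p j], hence the new point too; a cone that covers this point
    therefore contains the edge, and its third vertex lies on that side. *)
Lemma opposite_vertex_exists u i j (s : R) : u \in T -> i != j ->
  (i \in u) && (j \in u) -> s != 0 ->
  exists t k, [/\ t \in T, (i \in t) && (j \in t), k \in t,
    k != i /\ k != j & 0 < s * triple (p i) (p j) (p k)].
Proof.
move=> uT ij /[dup] iju /andP[iu ju] s0.
have [m [_ mu _]] := triangle_normal uT.
have w0 := cross_neq0 ij (mu _ iu) (mu _ ju).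
set w := cross _ _ in w0; pose x := p i + p j.
have xE : x = 1 *: p i + 1 *: p j by rewrite !scale1r.
have ux : cone u x by rewrite xE; exact: cone_edge.
have nF : Filter (nbhs x) by exact: nbhs_filter.
have nT : \forall y \near x, forall t, t \in T -> ~~ ((i \in t) && (j \in t)) -> ~ cone t y.
  apply: (@filter_forall _ _ (fun t y => t \in T -> _ -> ~ cone t y) _ nF) => t.
  have [tT|tT] := boolP (t \in T); last by near=> y.
  have [|ijt] := boolP ((i \in t) && (j \in t)); first by move=> h; apply: nearW => y _ /negP[].
  have : ~ cone t x.
    move=> /(coneI uT tT ux) [c [_ cI xc]].
    have cu l : l \notin u -> c l = 0 by move=> lu; apply: cI; rewrite inE (negPf lu).
    move: xc; rewrite xE => xc.
    have ci := edge_weights uT ij iju cu xc.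
    have cj : c j = 1.
      have ji : j != i by rewrite eq_sym.
      have jiu : (j \in u) && (i \in u) by rewrite andbC.
      by rewrite addrC in xc; exact: (edge_weights uT ji jiu cu xc).
    case/negP: ijt; apply/andP; split.
      by apply: contraT => it; have := cI i; rewrite inE (negPf it) andbF ci => /(_ isT)/eqP; rewrite oner_eq0.
    by apply: contraT => jt; have := cI j; rewrite inE (negPf jt) andbF cj => /(_ isT)/eqP; rewrite oner_eq0.
  by move/(not_cone_near tT); apply: filterS.
have [e e0 eT] := near_ray (s *: w) nT.
set y := x + _ in eT.
have wy : dot w y = e * s * dot w w.
  rewrite !dotDr !dotZr -/(triple _ _ (p i)) -/(triple _ _ (p j)) triplexyx triplexyy.
  by rewrite !add0r mulrA.
have y0 : y != 0.
  apply/eqP => y0; move/eqP: wy; rewrite y0 dot0r eq_sym !mulf_eq0 gt_eqF// (negPf s0).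
  by rewrite dotxx_eq0 (negPf w0).
have [t tT ty] := cone_cover y0.
have [ijt|ijt] := boolP ((i \in t) && (j \in t)); last by case: (eT t tT ijt ty).
have [it jt] := andP ijt.
have [k _ [ki kj kt]] := triangleP (triangle_card tT) it jt ij.
exists t, k; split=> //.
have [c [c0 ct yE]] := ty.
have := cone_triple tT it jt kt _ ct; rewrite ij ki kj -yE => /(_ isT) E.
have : 0 < c k * (s * triple (p i) (p j) (p k)).
  rewrite mulrCA -E /triple wy [in ltRHS]mulrA mulr_gt0 ?dotxx_gt0//.
  by rewrite mulrCA mulr_gt0// -expr2 lt_neqAle eq_sym sqr_ge0 expf_neq0.
have [->|ck] := eqVneq (c k) 0; first by rewrite mul0r ltxx.
by rewrite pmulr_rgt0// lt_neqAle eq_sym ck c0.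
Unshelve. all: by end_near. Qed.

(** In a cone containing [p i + p j] the total weight is at most 2, while [m] and [m'] both take the
    value 2 there. So both are 1 on all vertices of positive weight, and a third such vertex would
    force [m = m']. *)
Lemma edge_of_normals (m m' : 'rV[R]_3) i j : i != j -> m != m' ->
  (forall l, dot m (p l) <= 1) -> (forall l, dot m' (p l) <= 1) ->
  dot m (p i) = 1 -> dot m (p j) = 1 -> dot m' (p i) = 1 -> dot m' (p j) = 1 ->
  exists2 t, t \in T & (i \in t) && (j \in t).
Proof.
move=> ij mm' mP m'P mi mj m'i m'j.
pose x := p i + p j.
have mx : dot m x = 2 by rewrite dotDr mi mj.
have m'x : dot m' x = 2 by rewrite dotDr m'i m'j.
have x0 : x != 0.
  by apply/eqP => x0; move/eqP: mx; rewrite x0 dot0r eq_sym pnatr_eq0.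
have [t tT [c [c0 ct xc]]] := cone_cover x0.
exists t => //.
have [f [fP ft _]] := triangle_normal tT.
have sc : \sum_l c l <= 2.
  rewrite -(cone_sum ft ct xc) dotDr.
  by have := fP _ (vertex_in i); have := fP _ (vertex_in j); lra.
have tight (g : 'rV[R]_3) : (forall l, dot g (p l) <= 1) -> dot g x = 2 ->
    forall l, c l != 0 -> dot g (p l) = 1.
  move=> gP gx l cl; apply/eqP.
  have sg : \sum_l c l * (1 - dot g (p l)) = 0.
    apply/eqP; rewrite eq_le; apply/andP; split; last first.
      by apply: sumr_ge0 => v _; rewrite mulr_ge0// subr_ge0.
    have -> : \sum_l c l * (1 - dot g (p l)) = \sum_l c l - dot g x.
      rewrite xc dotC sum_dot -sumrB; apply: eq_bigr => v _.
      by rewrite dotZl dotC mulrBr mulr1.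
    by rewrite gx subr_le0.
  move/eqP: sg; rewrite psumr_eq0 => [/allP/(_ l (mem_index_enum l))|v _].
    by rewrite /= mulf_eq0 (negPf cl) subr_eq0 eq_sym.
  by rewrite mulr_ge0// subr_ge0.
have only l : c l != 0 -> l = i \/ l = j.
  move=> cl; have ml := tight m mP mx _ cl; have m'l := tight m' m'P m'x _ cl.
  have [->|li] := eqVneq l i; first by left.
  have [->|lj] := eqVneq l j; first by right.
  have D0 := triple_neq0 ij li lj mi mj ml.
  case/eqP: mm'; apply/eqP; rewrite -subr_eq0 -dotxx_eq0; apply/eqP.
  rewrite {2}(cramer (m - m') D0) !dotDr !dotZr !dotBl mi mj ml m'i m'j m'l.
  by rewrite !subrr !mulr0 !addr0.
have w0 := cross_neq0 ij mi mj; set w := cross _ _ in w0.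
have ww : dot w w != 0 by rewrite dotxx_eq0.
have xE : x = c i *: p i + c j *: p j.
  rewrite xc (bigD1 i)//= (bigD1 j) 1?eq_sym//= big1 ?addr0// => l /andP[li lj].
  have [->|/only[] lE] := eqVneq (c l) 0; first exact: scale0r.
    by rewrite lE eqxx in li.
  by rewrite lE eqxx in lj.
have ci : c i = 1.
  apply: (mulIf ww); have -> : c i * dot w w = triple x (p j) w.
    by rewrite xE !tripleE !dotE /w !mxE /=; ring.
  by rewrite !tripleE !dotE /w /x !mxE /=; ring.
have cj : c j = 1.
  apply: (mulIf ww); have -> : c j * dot w w = triple (p i) x w.
    by rewrite xE !tripleE !dotE /w !mxE /=; ring.
  by rewrite !tripleE !dotE /w /x !mxE /=; ring.
apply/andP; split; apply: contraT => /ct /eqP; first by rewrite ci oner_eq0.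
by rewrite cj oner_eq0.
Qed.

Lemma dual_cramer x y (z v : 'rV[R]_3) :
  triple x y z *: v = dot v x *: cross y z + dot v y *: cross z x + dot v z *: cross x y.
Proof. by apply: row3P; rewrite tripleE !dotE !mxE /=; ring. Qed.

(** Boundedness of the polar dual with an explicit constant. If it failed for [x], a multiple of [x]
    would lie in the polar dual, and the test vector [y] of [P] would contradict this. *)
Lemma polytope_bound : exists2 rho : R, 0 < rho &
  forall x, exists i, rho * \sum_k `|x ord0 k| <= dot x (p i).
Proof.
have /nbhs_ballP[e /= e0 eP] := P_int0.
have e20 : 0 < e / 2 by rewrite divr_gt0.
exists (e / 4) => [|x]; first by rewrite divr_gt0.
have S0 : 0 <= \sum_k `|x ord0 k| by exact: sumr_ge0.
have [i0 _] : exists i0 : 'I_n, True.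
  have c0 : const_mx 1 != 0 :> 'rV[R]_3.
    by apply/eqP => /rowP/(_ 0)/eqP; rewrite !mxE oner_eq0.
  have [t /(triangle_triple triangle_card)[i _] _] := cone_cover c0.
  by exists i.
have [SE|S1] := eqVneq (\sum_k `|x ord0 k|) 0.
  have x0 : x = 0.
    apply/rowP => k; rewrite mxE; apply/eqP; rewrite -normr_eq0.
    by move/eqP: SE; rewrite psumr_eq0// => /allP/(_ k (mem_index_enum k)).
  by exists i0; rewrite SE mulr0 x0 dot0l.
apply: contrapT => H.
have Sp : 0 < \sum_k `|x ord0 k| by rewrite lt_neqAle eq_sym S1.
have c0 : 0 < e / 4 * \sum_k `|x ord0 k| by rewrite mulr_gt0// divr_gt0.
have zp i : dot ((e / 4 * \sum_k `|x ord0 k|)^-1 *: x) (p i) <= 1.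
  rewrite dotZl ler_pdivrMl// mulr1 leNgt; apply/negP => h.
  by apply: H; exists i; exact: ltW.
(* The signs of the entries of [x], scaled into the ball of radius [e] contained in [P]: the product
   with [x] is [e / 2] times the sum of the absolute values, twice what the assumed failure
   allows. *)
pose y : 'rV[R]_3 := \row_k (e / 2 * Num.sg (x ord0 k)).
have Py : P y.
  apply: eP; apply: ball_row => // k; rewrite !mxE sub0r normrN normrM gtr0_norm//.
  apply: (@le_lt_trans _ _ (e / 2)); last by lra.
  rewrite ger_pMr//; case: sgrP => _; rewrite ?normr0 ?normr1 ?normrN1//.
have := polar_vertices zp Py; rewrite dotZl ler_pdivrMl// mulr1 leNgt => /negP; apply.
have -> : dot x y = e / 2 * \sum_k `|x ord0 k|.
  rewrite /dot mulr_sumr; apply: eq_bigr => k _.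
  by rewrite mxE normrEsg; ring.
by rewrite ltr_pM2r//; lra.
Qed.

Let r0 : 'rV[R]_n := \row_i enorm (p i).

Lemma polar_dual_polyhedron :
  polar_dual P = polyhedron_of (fun i => (enorm (p i))^-1 *: p i) (\row_i (enorm (p i))^-1).
Proof.
have e0 i : 0 < (enorm (p i))^-1 by rewrite invr_gt0 enorm_gt0 vertex_neq0.
apply/seteqP; split=> x /= xP.
  move=> i; rewrite dotZr mxE -[leRHS]mulr1 ler_pM2l//.
  exact/xP/vertex_in.
apply: polar_vertices => i; have := xP i.
by rewrite dotZr mxE -[leRHS]mulr1 ler_pM2l.
Qed.

Lemma gram_vertices i j : gram p r0 i j = dot (p i) (p j).
Proof.
rewrite /gram !mxE !sqr_enorm dotBl !dotBr (dotC (p j) (p i)).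
by field.
Qed.

Lemma minor2_vertices i j :
  minor2 p r0 i j = dot (cross (p i) (p j)) (cross (p i) (p j)).
Proof. by rewrite /minor2 !gram_vertices dot_cross expr2 (dotC (p j) (p i)). Qed.

Lemma gram_det_vertices i j k : gram_det p r0 i j k = triple (p i) (p j) (p k) ^+ 2.
Proof. by rewrite /gram_det !gram_vertices tripleE !dotE; ring. Qed.

Lemma all_nondegenerate_vertices : all_nondegenerate p T r0.
Proof.
move=> i j k tT ij ki kj.
have [it jt kt] : [/\ i \in [set i; j; k]%SET, j \in [set i; j; k]%SET &
    k \in [set i; j; k]%SET] by rewrite !inE !eqxx !orbT.
have D0 := triangle_triple_neq0 tT it jt kt ij ki kj.
have [m [_ m1 _]] := triangle_normal tT.
split; try by rewrite mxE enorm_gt0 vertex_neq0.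
split; last by rewrite gram_det_vertices lt_neqAle sqr_ge0 andbT eq_sym expf_neq0.
all: rewrite minor2_vertices dotxx_gt0; apply: (cross_neq0 _ (m1 _ _) (m1 _ _)) => //.
all: by rewrite eq_sym.
Qed.

(** [x] is any point on the line common to the two face planes of [Q], and the length is measured in
    units of [cross (p i) (p j)]. The two triangles on either side of the edge provide the ends of
    the segment. *)
Lemma edge_length x i j : i != j -> dot x (p i) = 1 -> dot x (p j) = 1 ->
  fine (lebesgue_measure
    [set s : R | forall l, dot (x + s *: cross (p i) (p j)) (p l) <= 1]) =
  - \sum_(t in T | (i \in t) && (j \in t)) \sum_(k in (t :\ i :\ j)%SET)
      base_cof p r0 i j k / (Num.sqrt (gram_det p r0 i j k) * minor2 p r0 i j).
Proof.
move=> ij xi xj; have w0 := cross_neq0 ij xi xj; set w := cross _ _ in w0 *.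
have ww0 : 0 < dot w w by rewrite dotxx_gt0.
set L := [set s | _].
have [[u uT iju]|noT] := pselect (exists2 u, u \in T & (i \in u) && (j \in u)); last first.
  rewrite big1 => [|t /andP[tT ijt]]; last by case: noT; exists t.
  (* Two different points of the segment are normals of two different supporting planes through
     [p i] and [p j], and then some triangle contains both vertices. So here the segment has length
     zero. *)
  have Leq s s' : L s -> L s' -> s = s'.
    move=> Ls Ls'; apply/eqP; apply: contrapT => /negP ss'; apply: noT.
    have d1 (b : R) a : dot w (p a) = 0 -> dot x (p a) = 1 -> dot (x + b *: w) (p a) = 1.
      by move=> h1 h2; rewrite dotDl dotZl h1 h2 mulr0 addr0.
    have wi : dot w (p i) = 0 by exact: triplexyx.
    have wj : dot w (p j) = 0 by exact: triplexyy.
    apply: (@edge_of_normals (x + s *: w) (x + s' *: w)) => //; try by exact: d1.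
    rewrite -subr_eq0 opprD addrACA subrr add0r -scalerBl scaler_eq0 subr_eq0.
    by rewrite (negPf ss') (negPf w0).
  rewrite oppr0; have [[s Ls]|nL] := pselect (exists s, L s).
    have -> : L = [set s] by apply/seteqP; split=> [s' /Leq/(_ Ls)//|_ ->].
    by rewrite lebesgue_measure_set1.
  have -> : L = set0 by apply/seteqP; split=> // s Ls; apply: nL; exists s.
  by rewrite measure0.
pose D k := triple (p i) (p j) (p k).
(* The points [x + tau k *: w] are the normals of the triangles
   [ijk], that is, the ends of the dual edge. *)
pose tau k := (1 - dot x (p k)) / D k.
have wD k : dot w (p k) = D k by [].
have [ta [a [taT ijta aa [ai aj]]]] := opposite_vertex_exists uT ij iju (oner_neq0 R).
rewrite mul1r -/(D a) => Da.
have n10 : - 1 != 0 :> R by rewrite oppr_eq0 oner_eq0.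
have [tb [b [tbT ijtb bb [bi bj]]]] := opposite_vertex_exists uT ij iju n10.
rewrite mulN1r oppr_gt0 -/(D b) => Db.
have tE t k : t \in T -> (i \in t) && (j \in t) -> k \in t -> k != i -> k != j ->
    t = [set i; j; k]%SET.
  move=> tT /andP[it jt] kt ki kj.
  have [k' tE' _] := triangleP (triangle_card tT) it jt ij.
  by move: kt; rewrite tE' !inE (negPf ki) (negPf kj) /= => /eqP ->.
have inner t k (G : 'I_n -> R) : t \in T -> (i \in t) && (j \in t) -> k \in t -> k != i -> k != j ->
    \sum_(l in (t :\ i :\ j)%SET) G l = G k.
  by move=> tT ijt kt ki kj; rewrite (tE t k tT)// triangleD2// big_set1.
have tab : tb != ta.
  apply/eqP => ab; move: bb; rewrite ab (tE ta a)// !inE (negPf bi) (negPf bj) /= => /eqP bE.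
  by move: Da; rewrite -bE ltNge ltW.
rewrite (bigD1 ta) ?taT//= (bigD1 tb) ?tbT ?ijtb//= [X in _ + (_ + X)]big1 ?addr0; last first.
  move=> t /andP[/andP[/andP[tT ijt] tta] ttb]; have [it jt] := andP ijt.
  have [k tE' [ki kj kt]] := triangleP (triangle_card tT) it jt ij.
  have := triangle_triple_neq0 tT it jt kt ij ki kj; rewrite -/(D k).
  case: (ltgtP (D k) 0) => // Dk _.
    have kb : k = b.
      by apply: (@opposite_vertex_unique t tb i j) => //; rewrite -?/(D _) nmulr_rgt0.
    by case/eqP: ttb; rewrite tE' kb -(tE tb b).
  have ka : k = a.
    by apply: (@opposite_vertex_unique t ta i j) => //; rewrite -?/(D _) mulr_gt0.
  by case/eqP: tta; rewrite tE' ka -(tE ta a).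
rewrite (inner ta a)// (inner tb b)//.
(* [dot x w / dot w w] only shifts the origin of the line and is the same for both triangles. Since
   [D a] and [D b] have opposite signs it cancels, and [tau a - tau b] is left. *)
have term k : D k != 0 -> base_cof p r0 i j k / (Num.sqrt (gram_det p r0 i j k) * minor2 p r0 i j) =
    - (D k / `|D k|) * (dot x w / dot w w + tau k).
  move=> Dk; rewrite gram_det_vertices sqrtr_sqr minor2_vertices -/w -/(D k).
  have -> : base_cof p r0 i j k = - (D k * (dot x w) + (1 - dot x (p k)) * dot w w).
    have := congr1 (dot w) (dual_cramer (p i) (p j) (p k) x).
    rewrite !dotDr !dotZr xi xj !mul1r (dotC x w) -/(D k) => ->.
    by rewrite /base_cof minor2_vertices /cof !gram_vertices -/w /w !dot_cross !dotE; ring.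
  rewrite /tau; field; rewrite normr_eq0 Dk gt_eqF//.
have Da0 : D a != 0 by rewrite gt_eqF.
have Db0 : D b != 0 by rewrite lt_eqF.
rewrite (term a Da0) (term b Db0) (gtr0_norm Da) (ltr0_norm Db) invrN mulrN !divff//.
have normal t k : t \in T -> (i \in t) && (j \in t) -> k \in t -> k != i -> k != j -> L (tau k).
  move=> tT /andP[it jt] kt ki kj l; have [m [mP m1 _]] := triangle_normal tT.
  have D0 := triangle_triple_neq0 tT it jt kt ij ki kj.
  suff -> : x + tau k *: w = m by exact/mP/vertex_in.
  apply: (scalerI D0); rewrite [RHS]dual_cramer [LHS]dual_cramer !m1// !dotDl !dotZl xi xj.
  by rewrite [dot w (p i)]triplexyx [dot w (p j)]triplexyy !mulr0 !addr0 wD divfK// (addrC (dot x _)) subrK.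
have La := normal ta a taT ijta aa ai aj; have Lb := normal tb b tbT ijtb bb bi bj.
(* The constraints of the two opposite vertices bound [s] from above and below; that no other
   constraint cuts deeper follows from [La] and [Lb], as both ends satisfy all of them. *)
have tau_le s : L s -> tau b <= s <= tau a.
  move=> Ls; have := Ls a; have := Ls b; rewrite !dotDl !dotZl !wD /tau => h1 h2.
  by rewrite ler_pdivlMr// ler_ndivrMr//; apply/andP; split; lra.
have -> : L = `[tau b, tau a]%classic.
  apply/seteqP; split=> [s /tau_le|s]; rewrite /= in_itv//= => /andP[sb sa] l.
  have := La l; have := Lb l; rewrite !dotDl !dotZl => h1 h2.
  have [h|h] := leP 0 (dot w (p l)).
    have : s * dot w (p l) <= tau a * dot w (p l) by rewrite ler_wpM2r.
    by move=> ?; lra.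
  have : s * dot w (p l) <= tau b * dot w (p l) by rewrite ler_wnM2r// ltW.
  by move=> ?; lra.
have /andP[ab _] := tau_le _ La.
(* The two ends may coincide; this is the case of a diagonal of a face. *)
rewrite lebesgue_measure_itv /= lte_fin; move: ab; rewrite le_eqVlt => /predU1P[->|ab].
  by rewrite ltxx /=; ring.
by rewrite ab /=; ring.
Qed.

End triangulated_polytope.

(** * Derivatives of the volume *)

Section null_and_bounded_sets.
Context {R : realType}.
Local Notation RR := (measurableTypeR R).
Local Notation mu1 := (@lebesgue_measure R).
Local Notation mu2 := (@area_measure R).
Local Notation mu3 := (@area_measure R \x @lebesgue_measure R)%E.

Lemma lebesgue_measure_eq (b c : R) : b != 0 \/ c != 0 ->
  mu1 [set t : RR | b * t = c] = 0%E.
Proof.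
have [-> [/eqP//|c0]|b0 _] := eqVneq b 0.
  rewrite (_ : [set _ | _] = set0) ?measure0//.
  by apply/seteqP; split=> // t /=; rewrite mul0r => /esym/eqP; rewrite (negPf c0).
rewrite (_ : [set _ | _] = [set c / b]) ?lebesgue_measure_set1//.
by apply/seteqP; split=> t /= => [<-|->]; field.
Qed.

Lemma measurable_fun_form (a b : R) :
  measurable_fun setT (fun y : RR * RR => (a * y.1 + b * y.2 : RR)).
Proof.
by apply: measurable_realfun.measurable_funD; apply: measurable_realfun.measurable_funM.
Qed.

Lemma area_measure_line (a b c : R) : [\/ a != 0, b != 0 | c != 0] ->
  mu2 [set y : RR * RR | a * y.1 + b * y.2 = c] = 0%E.
Proof.
move=> h; set A := [set y | _].
have mA : measurable A.
  by have := measurable_fun_form a b measurableT (measurable_set1 c); rewrite setTI.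
have [b0|b0] := eqVneq b 0; last first.
  rewrite /area_measure /product_measure1 integral0_eq// => x _ /=.
  rewrite (_ : xsection A x = [set t : RR | b * t = c - a * x]).
    by rewrite lebesgue_measure_eq//; left.
  by apply/seteqP; split=> t; rewrite /xsection /= inE /A /=; lra.
rewrite /area_measure product_measureE// integral0_eq// => x _ /=.
rewrite (_ : ysection A x = [set t : RR | a * t = c]).
  by apply: lebesgue_measure_eq; case: h; [left|rewrite b0 eqxx|right].
by apply/seteqP; split=> t; rewrite /ysection /= inE /A /= b0 mul0r addr0.
Qed.

Let I (M : R) : set RR := `[- M, M]%classic.

Let mI M : measurable (I M). Proof. exact: measurable_itv. Qed.

Let IP M (x : R) : `|x| <= M -> I M x.
Proof. by rewrite /I /= in_itv /= -ler_norml. Qed.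

Lemma lebesgue_measure_segment_lty (M : R) : (mu1 (I M) < +oo)%E.
Proof. by rewrite /I lebesgue_measure_itv /=; case: ifPn => _; rewrite ?ltry// -EFinB ltry. Qed.

Lemma lebesgue_measure_bounded (A : set RR) (M : R) : measurable A ->
  (forall x, A x -> `|x| <= M) -> (mu1 A < +oo)%E.
Proof.
move=> mA AM; apply: le_lt_trans (lebesgue_measure_segment_lty M).
by apply: le_measure; rewrite ?inE// => x /AM/IP.
Qed.

Lemma area_measure_square_lty (M : R) :
  (mu2 (I M `*` I M) < +oo)%E.
Proof.
rewrite /area_measure product_measure1E; [|exact: measurable_itv..].
by apply: lte_mul_pinfty; [exact: measure_ge0|rewrite ge0_fin_numE;
  [exact: lebesgue_measure_segment_lty|exact: measure_ge0]|exact: lebesgue_measure_segment_lty].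
Qed.

Lemma area_measure_bounded (A : set (RR * RR)) (M : R) : measurable A ->
  (forall y, A y -> `|y.1| <= M /\ `|y.2| <= M) -> (mu2 A < +oo)%E.
Proof.
move=> mA AM; apply: le_lt_trans (area_measure_square_lty M).
apply: le_measure; rewrite ?inE//; first by apply: measurableX; exact: measurable_itv.
by move=> y /AM[y1 y2]; split; exact: IP.
Qed.

Lemma volume_measure_bounded (A : set (RR * RR * RR)) (M : R) : measurable A ->
  (forall y, A y -> [/\ `|y.1.1| <= M, `|y.1.2| <= M & `|y.2| <= M]) -> (mu3 A < +oo)%E.
Proof.
move=> mA AM.
apply: (@le_lt_trans _ _
    (mu3 ((I M `*` I M) `*` I M))).
  apply: le_measure; rewrite ?inE//.
    by do 2!(apply: measurableX; last exact: measurable_itv); exact: measurable_itv.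
  by move=> y /AM[y1 y2 y3]; do 2?split; exact: IP.
rewrite product_measure1E; last first.
- exact: measurable_itv.
- by apply: measurableX; exact: measurable_itv.
apply: lte_mul_pinfty; [exact: measure_ge0|rewrite ge0_fin_numE;
  [exact: area_measure_square_lty|exact: measure_ge0]|exact: lebesgue_measure_segment_lty].
Qed.

End null_and_bounded_sets.

Section near.
Context {R : realType} {n : nat}.
Implicit Types k : 'rV[R]_n.

Lemma continuous_entry l : continuous (fun k => k ord0 l : R).
Proof. exact: coord_continuous. Qed.

Lemma continuous_entry_linear l j (c : R) :
  continuous (fun k => k ord0 l - k ord0 j * c : R).
Proof.
move=> k; apply: differentiable_continuous; apply: differentiableB.
  exact: differentiable_coord.
by apply: differentiableM; [exact: differentiable_coord|exact: differentiable_cst].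
Qed.

Lemma entries_neq_near (I : finType) (Q : pred I) (phi : I -> 'rV[R]_n -> R) k :
  (forall l, Q l -> {for k, continuous (phi l)}) -> (forall l, Q l -> phi l k != 0) ->
  \forall k' \near k, forall l, Q l -> phi l k' != 0.
Proof.
move=> cphi phi0; have nF : Filter (nbhs k) by exact: nbhs_filter.
apply: (@filter_forall _ I (fun l k' => Q l -> phi l k' != 0) _ nF) => l.
have [Ql|_] := boolP (Q l); last by apply: nearW.
have := @cvgr_neq0 R R _ _ nF (phi l) _ (cphi l Ql) (phi0 l Ql).
by apply: filterS => k' + _.
Qed.

Lemma continuous_shear (c : 'rV[R]_n) j : continuous (fun k => k - k ord0 j *: c).
Proof.
move=> k; apply: differentiable_continuous; apply: differentiableB => //.
by apply: differentiableZl; exact: differentiable_coord.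
Qed.

End near.

(** * The area of a polygon as a function of its support numbers *)

Section planar.
Context {R : realType} {n : nat}.
(* [al], [be], and later [ze], are the coordinates of the vectors [nu l] in an
   orthonormal frame whose last vector is [nu i]. *)
Variables (al be : 'I_n -> R) (Q : pred 'I_n).
Local Notation RR := (measurableTypeR R).
Implicit Types (k : 'rV[R]_n) (j l : 'I_n).

Definition planar_form l (y : RR * RR) : R := al l * y.1 + be l * y.2.

Definition planar_area k : R := fine (@area_measure R (sublevel planar_form Q k)).

(** In the coordinates [t] along [(- be j, al j)] and [k_j] along the normal, the left-hand side of
    constraint [l] is [slope j l * t + k_j * proj j l]. *)
Definition slope j l : R := be l * al j - al l * be j.
Definition proj j l : R := (al l * al j + be l * be j) / (al j ^+ 2 + be j ^+ 2).

Definition slope_form j l (t : RR) : R := slope j l * t.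

(* The part of the line [al j * y1 + be j * y2 = k_j] that satisfies the other
   constraints, measured in units of [(- be j, al j)]. *)
Definition chord j k : R :=
  fine (@lebesgue_measure R (sublevel (slope_form j) [pred l | Q l & l != j]
    (k - k ord0 j *: \row_l proj j l))).

(** The vector [nu l] is parallel to [nu i], so in the plane of the face the constraint no longer
    depends on the point. *)
Definition flat l := (al l == 0) && (be l == 0).

(** Boundedness in every direction with a uniform constant; it makes the areas and chords finite for
    every vector of bounds, not only near a given one. *)
Definition spanning : Prop := exists2 rho : R, 0 < rho & forall y1 y2 : R,
  (y1 != 0) || (y2 != 0) -> exists2 l, Q l &
    rho * (`|y1| + `|y2|) <= al l * y1 + be l * y2.

Hypothesis span : spanning.

Let measurable_planar_form l : measurable_fun setT (planar_form l).
Proof. exact: measurable_fun_form. Qed.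

Let measurable_slope_form j l : measurable_fun setT (slope_form j l).
Proof. exact: measurable_realfun.measurable_funM. Qed.

Let le_sum_entries k l : k ord0 l <= \sum_l `|k ord0 l|.
Proof.
apply: le_trans (ler_norm _) _.
by rewrite (bigD1 l)//= lerDl sumr_ge0.
Qed.

Lemma planar_area_lty k : (@area_measure R (sublevel planar_form Q k) < +oo)%E.
Proof.
have [rho rho0 h] := span.
apply: (@area_measure_bounded _ _ (rho^-1 * \sum_l `|k ord0 l|)).
  exact: measurable_sublevel.
move=> -[y1 y2] yk /=.
suff H : `|y1| + `|y2| <= rho^-1 * \sum_l `|k ord0 l|.
  by split; apply: le_trans H; rewrite ?lerDl ?lerDr.
have [/h[l Ql hl]|] := boolP ((y1 != 0) || (y2 != 0)).
  rewrite ler_pdivlMl//; apply: le_trans hl _.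
  exact: le_trans (yk l Ql) (le_sum_entries k l).
rewrite negb_or !negbK => /andP[/eqP -> /eqP ->].
by rewrite normr0 addr0; apply: mulr_ge0; [by rewrite invr_ge0 ltW|exact: sumr_ge0].
Qed.

Lemma chord_lty j k : ~~ flat j ->
  (@lebesgue_measure R (sublevel (slope_form j) [pred l | Q l & l != j] k) < +oo)%E.
Proof.
move=> zj; have [rho rho0 h] := span.
have a0 : 0 < `|al j| + `|be j|.
  rewrite lt_neqAle addr_ge0// andbT eq_sym paddr_eq0// !normr_eq0 -/(flat j) zj//.
have c0 : 0 < rho * (`|al j| + `|be j|) by rewrite mulr_gt0.
apply: (@lebesgue_measure_bounded _ _
  ((rho * (`|al j| + `|be j|))^-1 * \sum_l `|k ord0 l|)).
  exact: measurable_sublevel.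
move=> t tk; have [->|t0] := eqVneq t 0.
  by rewrite normr0; apply: mulr_ge0; [by rewrite invr_ge0 ltW|exact: sumr_ge0].
have := h (- be j * t) (al j * t); rewrite !mulf_eq0 oppr_eq0 (negPf t0) !orbF.
rewrite orbC -negb_and -/(flat j) => /(_ zj)[l Ql].
have -> : al l * (- be j * t) + be l * (al j * t) = slope j l * t by rewrite /slope; ring.
rewrite !normrM normrN -mulrDl (addrC `|be j|) mulrA => hl.
(* The form [j] vanishes along its own line, so the constraint that bounds this direction is another
   one and survives the removal of [j]. *)
have lj : l != j.
  apply: contraTneq hl => ->; rewrite /slope (mulrC (be j)) subrr mul0r -ltNge.
  by rewrite mulr_gt0// normr_gt0.
rewrite ler_pdivlMl//; apply: le_trans hl _.
by apply: le_trans (le_sum_entries k l); apply: tk; rewrite /= Ql.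
Qed.

Lemma continuous_planar_area k : (forall l, Q l -> flat l -> k ord0 l != 0) ->
  {for k, continuous planar_area}.
Proof.
move=> hk; apply: continuous_measure_sublevel => //; first exact: planar_area_lty.
move=> l Ql; apply: area_measure_line.
have [z|] := boolP (flat l); first by apply: Or33; exact: hk.
by rewrite negb_and => /orP[h|h]; [exact: Or31|exact: Or32].
Qed.

Lemma continuous_chord j k : ~~ flat j ->
  (forall l, Q l -> l != j -> slope j l = 0 -> k ord0 l - k ord0 j * proj j l != 0) ->
  {for k, continuous (chord j)}.
Proof.
move=> zj hk; rewrite /chord.
apply: (@continuous_comp _ _ _ (fun k : 'rV[R]_n => k - k ord0 j *: \row_l proj j l)
  (fun k' => fine (lebesgue_measure
     (sublevel (slope_form j) [pred l | Q l & l != j] k')))).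
  exact: continuous_shear.
apply: continuous_measure_sublevel.
- by move=> l _; exact: measurable_slope_form.
- by move=> k'; exact: chord_lty.
- move=> l /= /andP[Ql lj]; apply: lebesgue_measure_eq.
  have [s0|] := eqVneq (slope j l) 0; last by left.
  by right; rewrite !mxE; exact: hk.
Qed.

Lemma is_derive_planar_area j k : Q j -> ~~ flat j ->
  (forall l, Q l -> l != j -> slope j l = 0 -> k ord0 l - k ord0 j * proj j l != 0) ->
  is_derive k (delta_mx ord0 j) planar_area (chord j k).
Proof.
move=> Qj zj hk; pose a : R := al j ^+ 2 + be j ^+ 2.
have a0 : a != 0 by rewrite paddr_eq0 ?sqr_ge0// !sqrf_eq0.
(* The axes are [(- be j, al j)] and [(al j, be j)] divided by its squared length. The determinant
   is -1, so areas are kept, and constraint [j] becomes a bound on the second coordinate alone. *)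
pose rot := affine2 (- be j) (al j / a) 0 (al j) (be j / a) 0.
have rotS : scales_measure (@area_measure R) rot `|- be j * (be j / a) - al j / a * al j|^-1.
  apply: scales_affine2; rewrite (_ : _ - _ = - 1) ?oppr_eq0 ?oner_eq0//.
  by move: a0; rewrite /a => a0; field.
move: rotS; have -> : - be j * (be j / a) - al j / a * al j = - 1.
  by move: a0; rewrite /a => a0; field.
rewrite normrN1 invr1 => -[_ rotS].
pose F l (z : RR * RR) : R := slope_form j l z.1 + proj j l * z.2.
have E l z : planar_form l (rot z) = F l z.
  rewrite /planar_form /rot /affine2 /F /slope_form /slope /proj /= -/a.
  by field.
have FE k' : sublevel F Q k' = rot @^-1` sublevel planar_form Q k'.
  by apply/seteqP; split=> z h l Ql; have := h l Ql; rewrite E.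
have muE k' : (@lebesgue_measure R \x @lebesgue_measure R)%E (sublevel F Q k') =
    @area_measure R (sublevel planar_form Q k').
  rewrite FE -[LHS]/(@area_measure R _) rotS ?mul1e//; exact: measurable_sublevel.
have -> : planar_area = (fun k' =>
    fine ((@lebesgue_measure R \x @lebesgue_measure R)%E (sublevel F Q k'))).
  by apply/funext => k'; rewrite muE.
apply: is_derive_measure_sublevel => //.
- by move=> t; rewrite /slope_form /slope (mulrC (be j)) subrr mul0r.
- by rewrite /proj -!expr2 divff.
- by move=> k'; have := planar_area_lty k'; rewrite -muE.
- by move=> k'; exact: chord_lty.
apply: continuous_measure_sublevel.
- by move=> l _; exact: measurable_slope_form.
- by move=> k'; exact: chord_lty.
- move=> l /= /andP[Ql lj]; apply: lebesgue_measure_eq.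
  have [s0|] := eqVneq (slope j l) 0; last by left.
  by right; rewrite !mxE; exact: hk.
Qed.

Lemma is_derive_planar_area_out j k : ~~ Q j ->
  is_derive k (delta_mx ord0 j) planar_area 0.
Proof.
move=> Qj; apply: is_derive_lineP.
rewrite (_ : (fun s => _) = cst (planar_area k)); first exact: is_derive_cst.
apply/funext => s; rewrite /planar_area /=; congr (fine (area_measure _)).
have E l : Q l -> (k + s *: delta_mx ord0 j) ord0 l = k ord0 l.
  move=> Ql; have lj : l != j by apply: contraNneq Qj => <-.
  by rewrite !mxE (negPf lj) andbF mulr0 addr0.
by apply/seteqP; split=> y h l Ql; have := h l Ql; rewrite E.
Qed.

(** A flat constraint reads [0 <= k_j]; as [k_j != 0], it is satisfied everywhere or nowhere,
    without change nearby. *)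
Lemma is_derive_planar_area_flat j k : Q j -> flat j -> k ord0 j != 0 ->
  is_derive k (delta_mx ord0 j) planar_area 0.
Proof.
move=> Qj /andP[/eqP aj /eqP bj] kj0; apply: is_derive_lineP.
have near0 : \forall s \near (0 : R), planar_area k = planar_area (k + s *: delta_mx ord0 j).
  have : \forall s \near (0 : R), `|s| < `|k ord0 j|.
    apply/nbhs_ballP; exists `|k ord0 j| => /=; first by rewrite normr_gt0.
    by move=> s; rewrite -ball_normE /= sub0r normrN.
  apply: filterS => s sk; congr (fine (area_measure _)).
  have sg : (0 <= k ord0 j) = (0 <= k ord0 j + s).
    move: sk; rewrite ltr_norml; have [k0|k0] := leP 0 (k ord0 j).
      by rewrite ger0_norm// => /andP[? _]; apply/esym; lra.
    by rewrite ltr0_norm// opprK => /andP[_ ?]; apply/esym/negbTE; rewrite -ltNge; lra.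
  apply/seteqP; split=> y h l Ql; have := h l Ql; rewrite !mxE /=;
    (have [->|lj] := eqVneq l j; last by rewrite mulr0 addr0);
    by rewrite mulr1 /planar_form aj bj !mul0r addr0 sg.
apply: (near_eq_is_derive near0); exact: is_derive_cst.
Qed.

Definition dplanar_area j k : R := if Q j && ~~ flat j then chord j k else 0.

(** No flat constraint is borderline, and no two lines bounding the polygon coincide. Any number of
    lines may pass through one point, so vertices of high degree in [Q] are allowed. *)
Definition regular k : Prop :=
  (forall l, Q l && flat l -> k ord0 l != 0) /\
  (forall jl : 'I_n * 'I_n, [&& Q jl.1, ~~ flat jl.1, Q jl.2, jl.2 != jl.1 &
     slope jl.1 jl.2 == 0] -> k ord0 jl.2 - k ord0 jl.1 * proj jl.1 jl.2 != 0).

Lemma regular_near k : regular k -> \forall k' \near k, regular k'.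
Proof.
have nF : Filter (nbhs k) by exact: nbhs_filter.
move=> [r1 r2]; apply: (@filterI _ _ nF).
  by apply: entries_neq_near => // l _; exact: continuous_entry.
by apply: entries_neq_near => // l _; exact: continuous_entry_linear.
Qed.

Lemma is_derive_dplanar_area j k : regular k ->
  is_derive k (delta_mx ord0 j) planar_area (dplanar_area j k).
Proof.
move=> [r1 r2]; rewrite /dplanar_area; have [Qj|Qj] := boolP (Q j); last first.
  exact: is_derive_planar_area_out.
have [fj|fj] := boolP (flat j).
  by apply: is_derive_planar_area_flat => //; apply: r1; rewrite Qj.
apply: is_derive_planar_area => // l Ql lj s0.
by apply: (r2 (j, l)); rewrite /= Qj fj Ql lj s0 eqxx.
Qed.

Lemma differentiable_planar_area k : regular k -> differentiable planar_area k.
Proof.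
move=> rk; have nF : Filter (nbhs k) by exact: nbhs_filter.
have rn := regular_near rk.
apply: differentiable_continuous_partials => j.
  by apply: filterS rn => k' rk'; have [] := is_derive_dplanar_area j rk'.
have E : \forall k' \near k, dplanar_area j k' = partial j planar_area k'.
  by apply: filterS rn => k' rk'; have [_ /esym] := is_derive_dplanar_area j rk'.
suff cd : {for k, continuous (dplanar_area j)}.
  have E0 : dplanar_area j k = partial j planar_area k by exact: nbhs_singleton E.
  suff: partial j planar_area @ k --> dplanar_area j k by rewrite E0.
  exact: (cvg_trans (@near_eq_cvg _ _ _ nF _ _ E) cd).
have [/andP[Qj fj]|nQ] := boolP (Q j && ~~ flat j); last first.
  rewrite (_ : dplanar_area j = cst 0); first exact: cst_continuous.
  by apply/funext => k'; rewrite /dplanar_area (negPf nQ).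
rewrite (_ : dplanar_area j = chord j); last first.
  by apply/funext => k'; rewrite /dplanar_area Qj fj.
apply: continuous_chord => // l Ql lj s0.
by have [_ r2] := rk; apply: (r2 (j, l)); rewrite /= Qj fj Ql lj s0 eqxx.
Qed.

End planar.

(** * The volume and its first derivatives, with a face normal as the height *)

Section spatial.
Context {R : realType} {n : nat}.
Variables (al be ze : 'I_n -> R) (i : 'I_n).
Local Notation RR := (measurableTypeR R).
Implicit Types (k : 'rV[R]_n) (j l : 'I_n).

Definition spatial_form l (z : RR * RR * RR) : R := planar_form al be l z.1 + ze l * z.2.

Definition spatial_volume k : R :=
  fine ((@area_measure R \x @lebesgue_measure R)%E (sublevel spatial_form predT k)).

Hypotheses (ali : al i = 0) (bei : be i = 0) (zei : ze i = 1).
Hypothesis span3 : exists2 rho : R, 0 < rho & forall y1 y2 y3 : R, exists l,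
  rho * (`|y1| + `|y2| + `|y3|) <= al l * y1 + be l * y2 + ze l * y3.

Lemma spanning_section : spanning al be (predC1 i).
Proof.
have [rho rho0 h] := span3; exists rho => // y1 y2 y0.
have [l hl] := h y1 y2 0; rewrite normr0 mulr0 !addr0 in hl.
exists l => //; apply/eqP => li; move: hl; rewrite li ali bei !mul0r addr0 leNgt.
rewrite mulr_gt0// lt_neqAle addr_ge0// andbT eq_sym paddr_eq0// !normr_eq0.
by rewrite negb_and.
Qed.

Lemma measurable_spatial_form l : measurable_fun setT (spatial_form l).
Proof.
apply: measurable_realfun.measurable_funD; last exact: measurable_realfun.measurable_funM.
exact: (measurableT_comp (measurable_fun_form (al l) (be l))).
Qed.

Lemma spatial_volume_lty k :
  ((@area_measure R \x @lebesgue_measure R)%E (sublevel spatial_form predT k) < +oo)%E.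
Proof.
have [rho rho0 h] := span3.
apply: (@volume_measure_bounded _ _ (rho^-1 * \sum_l `|k ord0 l|)).
  by apply: measurable_sublevel => l _; exact: measurable_spatial_form.
move=> -[[y1 y2] y3] yk /=.
suff H : `|y1| + `|y2| + `|y3| <= rho^-1 * \sum_l `|k ord0 l|.
  split; apply: le_trans H; last by rewrite lerDr addr_ge0.
    by rewrite -addrA lerDl addr_ge0.
  by rewrite addrAC lerDr addr_ge0.
have [l hl] := h y1 y2 y3; rewrite ler_pdivlMl//; apply: le_trans hl _.
apply: le_trans (yk l isT) _; apply: le_trans (ler_norm _) _.
by rewrite (bigD1 l)//= lerDl sumr_ge0.
Qed.

Lemma is_derive_spatial_volume k :
  (forall l, l != i -> flat al be l -> k ord0 l - k ord0 i * ze l != 0) ->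
  is_derive k (delta_mx ord0 i) spatial_volume
    (planar_area al be (predC1 i) (k - k ord0 i *: \row_l ze l)).
Proof.
move=> hk.
apply: (@is_derive_measure_sublevel _ _ R (@area_measure R) n (planar_form al be) ze predT i).
- by [].
- by move=> l; exact: measurable_fun_form.
- by move=> y; rewrite /planar_form ali bei !mul0r addr0.
- exact: zei.
- exact: spatial_volume_lty.
- by move=> k'; exact: (planar_area_lty spanning_section).
- apply: (continuous_planar_area spanning_section) => l li fl.
  by rewrite !mxE; exact: hk.
Qed.

End spatial.

Section frames.
Context {R : realType}.
Implicit Types x y u v w : 'rV[R]_3.
Local Notation RR := (measurableTypeR R).

Lemma orthonormal_frame w : dot w w = 1 -> exists uv : 'rV[R]_3 * 'rV[R]_3,
  [/\ dot uv.1 uv.1 = 1, dot uv.2 uv.2 = 1, dot uv.1 w = 0, dot uv.2 w = 0 &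
    cross uv.1 uv.2 = w].
Proof.
move=> ww.
have [e e0] : exists e, cross e w != 0.
  apply: contrapT => H.
  have D e : cross e w = 0 by apply/eqP; apply: contrapT => /negP h; apply: H; exists e.
  have : dot w w = 0.
    have /rowP r1 := D (\row_k [:: 1; 0; 0]`_k); have /rowP r2 := D (\row_k [:: 0; 1; 0]`_k).
    have := r1 1; have := r1 2%:R; have := r2 2%:R; rewrite !mxE /= => h0 h1 h2.
    have w0 : w ord0 0 = 0 by lra.
    have w1 : w ord0 1 = 0 by lra.
    have w2 : w ord0 2%:R = 0 by lra.
    by rewrite dotE w0 w1 w2 mul0r !addr0.
  by rewrite ww => /eqP; rewrite oner_eq0.
pose n := enorm (cross e w); have n0 : n != 0 by rewrite gt_eqF// enorm_gt0.
pose u := n^-1 *: cross e w.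
have uu : dot u u = 1.
  by rewrite dotZl dotZr -sqr_enorm -/n; field.
have uw : dot u w = 0 by rewrite dotZl -/(triple _ _ _) triplexyy mulr0.
exists (u, cross w u); split=> //=.
- by rewrite dot_cross ww uu mul1r dotC uw mul0r subr0.
- by rewrite -/(triple _ _ _) triplexyx.
- have bac x y : cross x (cross y x) = dot x x *: y - dot x y *: x.
    by apply: row3P; rewrite !mxE /= !dotE; ring.
  by rewrite bac uu uw scale1r scale0r subr0.
Qed.

Lemma frame_ext u v w x y : triple u v w != 0 ->
  dot u x = dot u y -> dot v x = dot v y -> dot w x = dot w y -> x = y.
Proof.
move=> D0 ux vx wx; apply: (scalerI D0); rewrite !dual_cramer.
by rewrite !(dotC _ u) !(dotC _ v) !(dotC _ w) ux vx wx.
Qed.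

(** A linear change of coordinates of determinant 1. For each face a frame adapted to its normal is
    used, so that this normal becomes the height. *)
Lemma Vol_spatial_volume n (nu : 'I_n -> 'rV[R]_3) u v w h : triple u v w = 1 ->
  Vol nu h = spatial_volume (fun l => dot u (nu l)) (fun l => dot v (nu l))
    (fun l => dot w (nu l)) h.
Proof.
move=> D1.
pose A : set (RR * RR * RR) := sublevel (spatial_form (fun l => nu l ord0 0)
  (fun l => nu l ord0 1) (fun l => nu l ord0 2%:R)) predT h.
have mA : measurable A.
  by apply: measurable_sublevel => l _; exact: measurable_spatial_form.
have VA : Vol nu h = fine ((@area_measure R \x @lebesgue_measure R)%E A).
  congr (fine (_ _)); apply/seteqP; split=> z; rewrite /= /polyhedron_of /A /=.
    by move=> zh l _; have := zh l; rewrite dotE !mxE /= /spatial_form /planar_form;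
      rewrite !(mulrC (nu l _ _)).
  by move=> zh l; have := zh l isT; rewrite dotE !mxE /= /spatial_form /planar_form;
      rewrite !(mulrC (nu l _ _)).
have det1 : det3 (u ord0 0) (v ord0 0) (w ord0 0) (u ord0 1) (v ord0 1) (w ord0 1)
    (u ord0 2%:R) (v ord0 2%:R) (w ord0 2%:R) = 1.
  by rewrite -D1 tripleE /det3; ring.
have := @scales_linear3 R (u ord0 0) (v ord0 0) (w ord0 0) (u ord0 1) (v ord0 1) (w ord0 1)
    (u ord0 2%:R) (v ord0 2%:R) (w ord0 2%:R).
rewrite det1 oner_eq0 normr1 invr1 => /(_ isT)[_ /(_ A mA)]; rewrite mul1e => muA.
rewrite VA /spatial_volume -muA; congr (fine (_ _)).
apply/seteqP; split=> z zh l _; have := zh l isT;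
  rewrite /linear3 /spatial_form /planar_form /= !dotE; congr (_ <= _); ring.
Qed.

End frames.

(** Yields the diagonal entries: both Hessians satisfy one and the same linear relation in each
    row. *)
Lemma sum_eq0_entry (R : realType) n (z x y : 'I_n -> R) i : z i = 1 ->
  (forall l, l != i -> x l = y l) -> \sum_l z l * x l = 0 -> \sum_l z l * y l = 0 ->
  x i = y i.
Proof.
move=> zi xy; rewrite (bigD1 i)//= zi mul1r => xE; rewrite (bigD1 i)//= zi mul1r => yE.
apply: (addIr (\sum_(l | l != i) z l * y l)); rewrite yE -[RHS]xE.
by congr (_ + _); apply: eq_bigr => l li; rewrite xy.
Qed.

(** * The Hessian of the volume at the polar dual, and the comparison *)

Section volume_derivatives.
Context {R : realType} {n : nat} (P : set 'rV[R]_3) (p : 'I_n -> 'rV[R]_3)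
  (T : {set {set 'I_n}}).
Hypotheses (P_polyhedron : is_convex_polyhedron P) (p_inj : injective p)
  (P_vertices : vertices P = range p) (P_int0 : interior P 0)
  (T_triangulation : is_triangulation P p T).
Implicit Types (i j k l : 'I_n) (h : 'rV[R]_n).

Let nu i := (enorm (p i))^-1 *: p i.
Let r0 : 'rV[R]_n := \row_i enorm (p i).
Let h0 : 'rV[R]_n := \row_i (enorm (p i))^-1.

Let rp i : 0 < enorm (p i).
Proof. by rewrite enorm_gt0 (vertex_neq0 P_polyhedron P_vertices P_int0). Qed.

Let rn0 i : enorm (p i) != 0. Proof. by rewrite gt_eqF. Qed.

Let nunu i : dot (nu i) (nu i) = 1.
Proof. by rewrite dotZl dotZr -sqr_enorm; field. Qed.

Let pE i : p i = enorm (p i) *: nu i.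
Proof. by rewrite scalerA divff// scale1r. Qed.

Lemma normals_bound : exists2 rho : R, 0 < rho &
  forall x : 'rV[R]_3, exists i, rho * \sum_k `|x ord0 k| <= dot x (nu i).
Proof.
have [rho rho0 h] := polytope_bound P_polyhedron p_inj P_vertices P_int0 T_triangulation.
pose s := 1 + \sum_i enorm (p i).
have s0 : 0 < s by rewrite ltr_wpDr// sumr_ge0// => i _; exact: ltW.
exists (rho / s) => [|x]; first by rewrite divr_gt0.
have [i hi] := h x; exists i; rewrite dotZr ler_pdivlMl//; apply: le_trans hi.
rewrite mulrA ler_wpM2r ?sumr_ge0// mulrCA ger_pMr// ler_pdivrMr// mul1r.
by rewrite /s (bigD1 i)//= addrCA lerDl addr_ge0// sumr_ge0// => l _; exact: ltW.
Qed.

Lemma normals_generic i j l (x y : R) : l != i -> l != j ->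
  nu l = x *: nu i + y *: nu j -> h0 ord0 l != x * h0 ord0 i + y * h0 ord0 j.
Proof.
move=> li lj nE; rewrite !mxE; apply/eqP => hE.
have inv0 : (enorm (p l))^-1 != 0 by rewrite invr_eq0.
have [ij|ij] := eqVneq i j.
  rewrite -ij -mulrDl -scalerDl in hE nE.
  move: nE; rewrite /nu scalerA -hE => /(scalerI inv0)/p_inj lE.
  by rewrite lE eqxx in li.
case/eqP: inv0; apply: (not_collinear p_inj P_vertices (k := j) li _ _
  (be := - (x / enorm (p i))) (ga := - (y / enorm (p j)))) => //.
- by rewrite eq_sym.
- by rewrite eq_sym.
- by rewrite hE; ring.
- by move: nE; rewrite /nu !scalerA => ->; rewrite !scaleNr -addrA -opprD subrr.
Qed.


Section fixed_frames.
Variables u v : 'I_n -> 'rV[R]_3.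
Hypothesis uvP : forall i, [/\ dot (u i) (u i) = 1, dot (v i) (v i) = 1,
  dot (u i) (nu i) = 0, dot (v i) (nu i) = 0 & cross (u i) (v i) = nu i].

Let al i l := dot (u i) (nu l).
Let be i l := dot (v i) (nu l).
Let ze i l := dot (nu i) (nu l).

Let ali i : al i i = 0. Proof. by have [_ _ + _ _] := uvP i. Qed.
Let bei i : be i i = 0. Proof. by have [_ _ _ + _] := uvP i. Qed.
Let zei i : ze i i = 1. Proof. exact: nunu. Qed.

Let det i : triple (u i) (v i) (nu i) = 1.
Proof. by rewrite /triple; have [_ _ _ _ ->] := uvP i. Qed.

Let det_neq0 i : triple (u i) (v i) (nu i) != 0.
Proof. by rewrite det oner_eq0. Qed.

Let slopeE i j l : slope (al i) (be i) j l = triple (nu i) (nu j) (nu l).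
Proof.
rewrite -tripleA /triple dotC; have [_ _ _ _ <-] := uvP i.
by rewrite dot_cross /slope /al /be; ring.
Qed.

Let dot_frame i (y1 y2 y3 : R) l :
  dot (y1 *: u i + y2 *: v i + y3 *: nu i) (nu l) =
  al i l * y1 + be i l * y2 + ze i l * y3.
Proof. by rewrite 2!dotDl (dotZl y1) (dotZl y2) (dotZl y3) /al /be /ze; ring. Qed.

Let span3 i : exists2 rho : R, 0 < rho & forall y1 y2 y3 : R, exists l,
  rho * (`|y1| + `|y2| + `|y3|) <= al i l * y1 + be i l * y2 + ze i l * y3.
Proof.
have [rho rho0 h] := normals_bound.
exists (rho / 3) => [|y1 y2 y3]; first by rewrite divr_gt0.
pose x := y1 *: u i + y2 *: v i + y3 *: nu i.
have [l hl] := h x; exists l; rewrite -dot_frame -/x; apply: le_trans hl.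
rewrite -mulrA ler_wpM2l ?(ltW rho0)// ler_pdivrMl//.
(* Entries of a unit vector are at most 1 in absolute value. The three frame coordinates together
   therefore cost the factor 3. *)
have unit (e : 'rV[R]_3) : dot e e = 1 -> `|dot x e| <= \sum_k `|x ord0 k|.
  move=> ee; apply: le_trans (ler_norm_sum _ _ _) _; apply: ler_sum => k _.
  rewrite normrM ler_piMr// -ler_sqr ?nnegrE// expr1n real_normK ?num_real//.
  by rewrite -ee /dot (bigD1 k)//= -expr2 lerDl sumr_ge0// => b _; rewrite -expr2 sqr_ge0.
have [uu vv un vn uvn] := uvP i.
have uv : dot (u i) (v i) = 0.
  have := congr1 (fun w => dot w w) uvn; rewrite dot_cross nunu uu vv (dotC (v i)).
  by move=> e; apply/eqP; rewrite -sqrf_eq0; apply/eqP; lra.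
have := unit _ uu; have := unit _ vv; have := unit _ (nunu i).
have -> : dot x (u i) = y1.
  by rewrite 2!dotDl (dotZl y1) (dotZl y2) (dotZl y3) uu (dotC (v i)) uv (dotC (nu i)) un !mulr0 !addr0 mulr1.
have -> : dot x (v i) = y2.
  by rewrite 2!dotDl (dotZl y1) (dotZl y2) (dotZl y3) vv uv (dotC (nu i)) vn !mulr0 !addr0 add0r mulr1.
have -> : dot x (nu i) = y3 by rewrite dot_frame ali bei zei !mul0r !add0r mul1r.
by move=> ? ? ?; lra.
Qed.

(** On the plane of face [i], at height [h_i], constraint [l] leaves this bound for the two planar
    coordinates. *)
Let shear i h : 'rV[R]_n := h - h ord0 i *: \row_l ze i l.
Let face i h : R := planar_area (al i) (be i) (predC1 i) (shear i h).

Let shearE i h l : shear i h ord0 l = h ord0 l - h ord0 i * ze i l.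
Proof. by rewrite !mxE. Qed.

(** Weaker than simplicity of the polyhedron: it only excludes that two face planes coincide or that
    three share a line, while any number of them may meet in a point. *)
Definition simple h : Prop := forall i, regular (al i) (be i) (predC1 i) (shear i h).

Let simple_near h : simple h -> \forall h' \near h, simple h'.
Proof.
move=> sh; have nF : Filter (nbhs h) by exact: nbhs_filter.
apply: (@filter_forall _ 'I_n (fun i h' => regular (al i) (be i) (predC1 i) (shear i h')) _ nF) => i.
exact: (@continuous_shear R n (\row_l ze i l) i h _ (regular_near (sh i))).
Qed.

Let is_derive_Vol h i : simple h -> is_derive h (delta_mx ord0 i) (Vol nu) (face i h).
Proof.
move=> sh; have -> : Vol nu = spatial_volume (al i) (be i) (ze i).
  by apply/funext => h'; exact: Vol_spatial_volume.
apply: (is_derive_spatial_volume (ali i) (bei i) (zei i) (span3 i)) => l li fl.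
have [r1 _] := sh i; have := r1 l; rewrite shearE; apply.
by rewrite /= li.
Qed.

Let partial_Vol_near h i : simple h -> \forall h' \near h, face i h' = partial i (Vol nu) h'.
Proof.
move=> /simple_near; have nF : Filter (nbhs h) by exact: nbhs_filter.
by apply: filterS => h' sh; have [_ <-] := is_derive_Vol i sh.
Qed.

Let differentiable_face i h : simple h -> differentiable (face i) h.
Proof.
move=> sh; apply: (@differentiable_comp _ _ _ _ (shear i)
  (planar_area (al i) (be i) (predC1 i))).
  apply: differentiableB => //.
  by apply: differentiableZl; exact: differentiable_coord.
apply: differentiable_planar_area; last exact: sh.
exact: (spanning_section (ali i) (bei i) (span3 i)).
Qed.

Let differentiable_partial_Vol i h : simple h -> differentiable (partial i (Vol nu)) h.
Proof.
move=> sh; apply: near_eq_differentiable (differentiable_face i sh).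
exact: partial_Vol_near.
Qed.

Let twice_differentiable_Vol_simple h : simple h -> twice_differentiable (Vol nu) h.
Proof.
move=> sh; have nF : Filter (nbhs h) by exact: nbhs_filter.
split; last by move=> i; exact: differentiable_partial_Vol.
apply: filterS (simple_near sh) => h' sh'.
have nF' : Filter (nbhs h') by exact: nbhs_filter.
apply: differentiable_continuous_partials => i.
  by apply: filterS (simple_near sh') => h'' /(is_derive_Vol i)[].
exact/differentiable_continuous/differentiable_partial_Vol.
Qed.

Let partial2_Vol_offdiag h i j : simple h -> j != i ->
  partial j (partial i (Vol nu)) h =
  dplanar_area (al i) (be i) (predC1 i) j (shear i h).
Proof.
move=> sh ji.
have -> : partial j (partial i (Vol nu)) h = partial j (face i) h.
  by apply/esym/near_eq_derive; exact: partial_Vol_near.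
have := is_derive_dplanar_area (spanning_section (ali i) (bei i) (span3 i)) j (sh i).
rewrite -{1}[shear i h]addr0 -{1}(scale0r (delta_mx ord0 j)) => /is_derive_line H.
suff : is_derive h (delta_mx ord0 j) (face i)
  (dplanar_area (al i) (be i) (predC1 i) j (shear i h)) by case.
(* Since [j != i], the height [h_i] is kept, and the bound [j] of the face moves at unit speed. *)
have E : (fun s : R => face i (h + s *: delta_mx ord0 j)) =
    (fun s : R => planar_area (al i) (be i) (predC1 i) (shear i h + s *: delta_mx ord0 j)).
  apply/funext => s; congr planar_area; apply/rowP => l.
  by rewrite !mxE (eq_sym i) (negPf ji) andbF mulr0 addr0; ring.
by rewrite -E in H; exact: (is_derive_lineP H).
Qed.

Let partial2_Vol_axial h i : simple h ->
  \sum_l ze i l * partial l (partial i (Vol nu)) h = 0.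
Proof.
move=> sh; pose z : 'rV[R]_n := \row_l ze i l.
rewrite (eq_bigr (fun l => z ord0 l * partial l (partial i (Vol nu)) h)); last first.
  by move=> l _; rewrite mxE.
rewrite -derive_partials; last exact: differentiable_partial_Vol.
have -> : 'D_z (partial i (Vol nu)) h = 'D_z (face i) h.
  by apply/esym/near_eq_derive; exact: partial_Vol_near.
suff : is_derive h z (face i) 0 by case.
(* [z] is the change of the support numbers under a translation along [nu i], and [shear i] removes
   it. *)
have E : (fun s : R => face i (h + s *: z)) = cst (face i h).
  apply/funext => s; congr planar_area; apply/rowP => l.
  by rewrite !mxE -/(ze i i) zei; ring.
have H : is_derive (0 : R) (1 : R) (fun s : R => face i (h + s *: z)) 0.
  by rewrite E; exact: is_derive_cst.
exact: (is_derive_lineP H).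
Qed.

Let simple_h0 : simple h0.
Proof.
move=> i; split=> [l /andP[/= li /andP[/eqP fa /eqP fb]]|[j l]].
  have nE : nu l = ze i l *: nu i + 0 *: nu i.
    rewrite scale0r addr0; apply: (frame_ext (det_neq0 i)); rewrite (dotZr (ze i l)).
    - by rewrite -/(al i l) fa -/(al i i) ali mulr0.
    - by rewrite -/(be i l) fb -/(be i i) bei mulr0.
    - by rewrite nunu mulr1.
  by have := normals_generic li li nE; rewrite shearE mul0r addr0 subr_eq0 mulrC.
move=> /= /and5P[ji fj li lj /eqP s0].
pose c := proj (al i) (be i) j l.
have s0' : be i l * al i j = al i l * be i j by apply/eqP; rewrite -subr_eq0; apply/eqP.
have a0 : al i j ^+ 2 + be i j ^+ 2 != 0 by rewrite paddr_eq0 ?sqr_ge0// !sqrf_eq0.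
(* Vanishing slope puts [nu l] into the span of [nu i] and [nu j]; [c] is its coefficient at
   [nu j]. *)
have nE : nu l = (ze i l - c * ze i j) *: nu i + c *: nu j.
  apply: (frame_ext (det_neq0 i)); rewrite dotDr (dotZr (_ - _)) (dotZr c) -/(al i i) -/(be i i) -/(ze i i).
  - rewrite ali mulr0 add0r -/(al i l) -/(al i j); apply: (mulIf a0).
    rewrite /c /proj mulrAC divfK//.
    have -> A B C D : (A * B + C * D) * B = A * B ^+ 2 + D * (C * B) :> R by ring.
    by rewrite s0'; ring.
  - rewrite bei mulr0 add0r -/(be i l) -/(be i j); apply: (mulIf a0).
    rewrite /c /proj mulrAC divfK//.
    have -> A B C D : (A * B + C * D) * D = C * D ^+ 2 + B * (A * D) :> R by ring.
    by rewrite -s0'; ring.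
  - by rewrite zei mulr1 -/(ze i j) subrK.
have := normals_generic li lj nE; rewrite !shearE -/c.
apply: contraNN => /eqP e; apply/eqP; move: e.
by set a := h0 _ l; set b := h0 _ i; set d := h0 _ j => e; lra.
Qed.


(** The chord is measured in units of [(- be i j, al i j)], whereas [edge_length] uses
    [cross (p i) (p j)], a vector in the same direction and longer by the factor [d]. This accounts
    for the factor [r_i * r_j]. *)
Let chord_h0 i j : j != i -> ~~ flat (al i) (be i) j ->
  chord (al i) (be i) (predC1 i) j (shear i h0) =
  - \sum_(t in T | (i \in t) && (j \in t)) \sum_(k in (t :\ i :\ j)%SET)
      r0 ord0 i * r0 ord0 j * base_cof p r0 i j k /
      (Num.sqrt (gram_det p r0 i j k) * minor2 p r0 i j).
Proof.
move=> ji fj; have ij : i != j by rewrite eq_sym.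
pose a := al i j ^+ 2 + be i j ^+ 2.
have a0 : a != 0 by rewrite paddr_eq0 ?sqr_ge0// !sqrf_eq0.
pose kj := shear i h0 ord0 j.
(* The foot of the perpendicular from the origin to the line in which the planes of the faces [i]
   and [j] meet. *)
pose x := (kj / a * al i j) *: u i + (kj / a * be i j) *: v i + h0 ord0 i *: nu i.
have xl l : dot x (nu l) = kj * proj (al i) (be i) j l + h0 ord0 i * ze i l.
  by rewrite dot_frame /proj -/a; field.
have kjE : kj = h0 ord0 j - h0 ord0 i * ze i j by exact: shearE.
have h0r l : enorm (p l) * h0 ord0 l = 1 by rewrite mxE divff.
have xi : dot x (p i) = 1.
  rewrite pE (dotZr (enorm (p i))) xl zei mulr1 /proj ali bei !mul0r addr0 mul0r mulr0 add0r.
  exact: h0r.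
have xj : dot x (p j) = 1.
  rewrite pE (dotZr (enorm (p j))) xl /proj -!expr2 -/a divff// mulr1 kjE subrK.
  exact: h0r.
pose d := enorm (p i) * enorm (p j).
have d0 : 0 < d by rewrite mulr_gt0.
have dn0 : d != 0 by rewrite gt_eqF.
have wl l : dot (cross (p i) (p j)) (nu l) = d * slope (al i) (be i) j l.
  rewrite slopeE (pE i) (pE j) crossZl crossC crossZl -scalerN -crossC scalerA.
  by rewrite (dotZl (_ * _)).
pose S := sublevel (slope_form (al i) (be i) j) [pred l | predC1 i l & l != j]
   (shear i h0 - shear i h0 ord0 j *: \row_l proj (al i) (be i) j l).
have mS : measurable S.
  by apply: measurable_sublevel => l _; exact: measurable_realfun.measurable_funM.
have Seq : [set s : R | forall l, dot (x + s *: cross (p i) (p j)) (p l) <= 1] =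
    (fun s : measurableTypeR R => (d * s + 0 : measurableTypeR R)) @^-1` S.
  have E s l : (dot (x + s *: cross (p i) (p j)) (p l) <= 1) =
      (slope (al i) (be i) j l * (d * s) <=
       shear i h0 ord0 l - kj * proj (al i) (be i) j l).
    rewrite (pE l) (dotZr (enorm (p l))) dotDl (dotZl s) wl xl shearE.
    rewrite -(h0r l) ler_pM2l// -subr_ge0 -[RHS]subr_ge0; congr (0 <= _).
    by ring.
  have SE l : (shear i h0 - shear i h0 ord0 j *: \row_l proj (al i) (be i) j l) ord0 l =
      shear i h0 ord0 l - kj * proj (al i) (be i) j l.
    rewrite mxE; congr (_ + _); rewrite mxE; congr (- _); rewrite mxE; congr (_ * _).
    by rewrite mxE.
  apply/seteqP; split=> s.
    by move=> h l _; rewrite SE /slope_form addr0 -E; exact: h.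
  (* Along this line the constraints [i] and [j] hold with equality, so their absence from the chord
     does not matter. *)
  move=> h l; rewrite E; have [->|li] := eqVneq l i.
    by rewrite slopeE triplexyx mul0r shearE zei mulr1 subrr /proj ali bei !mul0r addr0 mul0r mulr0 subr0.
  have [->|lj] := eqVneq l j.
    by rewrite slopeE triplexyy mul0r /proj -!expr2 -/a divff// mulr1 subrr.
  by have := h l; rewrite /= li lj SE /slope_form addr0 => /(_ isT).
have := edge_length P_polyhedron p_inj P_vertices P_int0 T_triangulation ij xi xj.
rewrite Seq lebesgue_measure_affine// gtr0_norm// -/r0 => lengthE.
have -> : chord (al i) (be i) (predC1 i) j (shear i h0) =
    d * fine (d^-1%:E * lebesgue_measure S)%E.
  rewrite fineM//; first by rewrite mulrA divff// mul1r.
  rewrite ge0_fin_numE//.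
  exact: (chord_lty (spanning_section (ali i) (bei i) (span3 i))).
rewrite lengthE mulrN mulr_sumr; congr (- _); apply: eq_bigr => t _.
rewrite mulr_sumr; apply: eq_bigr => k _.
by rewrite /r0 !mxE -/r0 -/d mulrA.
Qed.

Let nondeg : all_nondegenerate p T r0.
Proof. exact: (all_nondegenerate_vertices P_polyhedron p_inj P_vertices P_int0 T_triangulation). Qed.

Let T3 := triangle_card T_triangulation.

Let partial2_offdiag i j : j != i ->
  partial j (partial i (Vol nu)) h0 = partial j (partial i (HE p T)) r0.
Proof.
move=> ji; rewrite partial2_Vol_offdiag//.
rewrite (partial2_HE_offdiag p_inj T3 nondeg); last by rewrite eq_sym.
rewrite /dplanar_area /= ji /=; have [fj|fj] := boolP (flat (al i) (be i) j); last exact: chord_h0.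
(* Parallel normals: two vertices of one triangle are linearly independent, so no triangle contains
   both and the sum is empty. *)
rewrite big1 ?oppr0// => t /andP[tT /andP[it jt]].
have [m [_ m1 _]] := triangle_normal P_polyhedron P_int0 T_triangulation tT.
have ij : i != j by rewrite eq_sym.
case/eqP: (cross_neq0 P_polyhedron p_inj P_vertices P_int0 ij (m1 _ it) (m1 _ jt)).
have /andP[/eqP fa /eqP fb] := fj.
have nE : nu j = ze i j *: nu i.
  apply: (frame_ext (det_neq0 i)); rewrite (dotZr (ze i j)).
  - by rewrite -/(al i j) fa -/(al i i) ali mulr0.
  - by rewrite -/(be i j) fb -/(be i i) bei mulr0.
  - by rewrite nunu mulr1.
by rewrite (pE i) (pE j) nE scalerA crossZl crossC crossZl crossxx scaler0 oppr0 scaler0.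
Qed.

Let partial2_diag i :
  partial i (partial i (Vol nu)) h0 = partial i (partial i (HE p T)) r0.
Proof.
have r0p l : 0 < r0 ord0 l by rewrite mxE.
have hHE : \sum_l ze i l * partial l (partial i (HE p T)) r0 = 0.
  (* The weights of the axial relation for [HE] are [dot (p i) (p l) / r_l], that is, [r_i] times
     the weights [ze i l] for the volume. *)
  apply: (mulfI (rn0 i)); rewrite mulr0 -[RHS](partial2_HE_axial p_inj T3 i nondeg r0p).
  rewrite mulr_sumr; apply: eq_bigr => l _; rewrite mulrA; congr (_ * _).
  rewrite gram_vertices /ze (dotZl (enorm (p i))^-1) (dotZr (enorm (p l))^-1) [r0 _ _]mxE.
  by field; rewrite !rn0.
exact: (sum_eq0_entry (zei i) (fun l li => partial2_offdiag li)
  (partial2_Vol_axial i simple_h0) hHE).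
Qed.

Lemma hessians_of_frames : twice_differentiable (Vol nu) h0 /\
  forall i j, partial i (partial j (Vol nu)) h0 = partial i (partial j (HE p T)) r0.
Proof.
split=> [|i j]; first exact: twice_differentiable_Vol_simple simple_h0.
have [->|ij] := eqVneq i j; [exact: partial2_diag|exact: partial2_offdiag].
Qed.

End fixed_frames.

Lemma Vol_HE_hessian : twice_differentiable (Vol nu) h0 /\
  forall i j, partial i (partial j (Vol nu)) h0 = partial i (partial j (HE p T)) r0.
Proof.
have [uv uvP] := choice (fun i => orthonormal_frame (nunu i)).
exact: (@hessians_of_frames (fun i => (uv i).1) (fun i => (uv i).2)).
Qed.

End volume_derivatives.

Theorem lemma4p1 (R : realType) (n : nat) (P : set 'rV[R]_3)
    (p : 'I_n -> 'rV[R]_3) (T : {set {set 'I_n}})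
    (P_polyhedron : is_convex_polyhedron P)
    (p_inj : injective p)
    (P_vertices : vertices P = range p)
    (P_int0 : interior P 0)
    (T_triangulation : is_triangulation P p T) :
  let nu := fun i : 'I_n => (enorm (p i))^-1 *: p i in
  let r0 := \row_(i < n) enorm (p i) in
  let h0 := \row_(i < n) (enorm (p i))^-1 in
  [/\ polar_dual P = polyhedron_of nu h0,
      twice_differentiable (Vol nu) h0,
      twice_differentiable (HE p T) r0 &
      forall i j : 'I_n,
        partial i (partial j (Vol nu)) h0 = partial i (partial j (HE p T)) r0].
Proof.
move=> nu r0 h0.
have [dVol hess] := Vol_HE_hessian P_polyhedron p_inj P_vertices P_int0 T_triangulation.
split=> //; first exact: polar_dual_polyhedron.
apply: twice_differentiable_HE => //; first exact: (triangle_card T_triangulation).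
exact: (all_nondegenerate_vertices P_polyhedron p_inj P_vertices P_int0 T_triangulation).
Qed.
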